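(* Let $\alpha\in(0,1)$, $\gamma\in(0,1/6)$, and let $G_n$ be the two-dimensional discrete torus $\mathcal V_n=\mathbb Z^2/2^n\mathbb Z^2$ with nearest-neighbour edges. Let $(\tau_x)$ be i.i.d. positive with $\lim_{u\to\infty}u^\alpha\mathbb P[\tau_x\ge u]=1$, and let $X_n$ be the continuous-time Markov chain on $\mathcal V_n$ started at $0$ with rates $w_{xy}=\tfrac14\tau_x^{-1}$ for neighbours $x,y$ (Bouchaud trap model with $a=0$, $\nu=1/4$). Put $t_w(n)=2^{2n/\alpha}n^{1-\gamma/\alpha}$. Then for every $\theta>0$ and $\mathbb P$-a.e. $\boldsymbol\tau$, \[\lim_{n\to\infty}\mathbb P[X_n(t_w(n))=X_n((1+\theta)t_w(n))\mid\boldsymbol\tau]=\mathrm{Asl}_\alpha\Big(\frac1{1+\theta}\Big).\]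
   Context: $\mathrm{Asl}_\alpha(u)=\frac{\sin\alpha\pi}{\pi}\int_0^u s^{\alpha-1}(1-s)^{-\alpha}ds$. *)

(* Defs.v *)
From HB Require Import structures.
From mathcomp Require Import all_boot all_order all_algebra.
From mathcomp Require Import all_classical all_reals all_analysis.
Unset Printing Implicit Defensive.
Import Order.TTheory GRing.Theory Num.Theory.
Import numFieldNormedType.Exports.
Local Open Scope classical_set_scope.
Local Open Scope ring_scope.

(* Vertices of the torus Z^2 / 2^n Z^2, represented by {0,..,2^n-1}^2. *)
Definition V (n : nat) : finType := ('I_(2 ^ n) * 'I_(2 ^ n))%type.

Lemma pow2_gt0 (n : nat) : (0 < 2 ^ n)%N.
Proof. by rewrite expn_gt0. Qed.

Definition oadd (n : nat) (i : 'I_(2 ^ n)) (k : nat) : 'I_(2 ^ n) :=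
  @Ordinal (2 ^ n) ((i + k) %% 2 ^ n) (ltn_pmod (i + k) (pow2_gt0 n)).

Definition origin (n : nat) : V n :=
  (@Ordinal (2 ^ n) 0 (pow2_gt0 n), @Ordinal (2 ^ n) 0 (pow2_gt0 n)).

Definition nbr (n : nat) (x : V n) (k : 'I_4) : V n :=
  match val k with
  | 0 => (oadd n x.1 1, x.2)
  | 1 => (oadd n x.1 (2 ^ n - 1), x.2)
  | 2 => (x.1, oadd n x.2 1)
  | _ => (x.1, oadd n x.2 (2 ^ n - 1))
  end.

(* the torus vertex x seen as the point of Z^2 carrying the trap tau_x *)
Definition emb (n : nat) (x : V n) : int * int := ((val x.1)%:Z, (val x.2)%:Z).

(* Generator of the Bouchaud trap model (a = 0, nu = 1/4):
   jump rate w_xy = (1/4) tau_x^{-1} along each edge {x,y}. *)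
Definition gen (R : realType) (tau : int * int -> R) (n : nat) (x y : V n) : R :=
  ((\sum_(k < 4) ((nbr n x k == y)%:R : R)) - 4 * ((x == y)%:R : R))
  / (4 * tau (emb n x)).

Definition mmul (R : realType) (n : nat) (A B : V n -> V n -> R) : V n -> V n -> R :=
  fun x y => \sum_(z : V n) A x z * B z y.

Definition mpow (R : realType) (n : nat) (A : V n -> V n -> R) (k : nat) :=
  iter k (fun B => mmul R n B A) (fun x y => ((x == y)%:R : R)).

(* transition semigroup P_t = exp(t Q) of the continuous-time Markov chain *)
Definition trans (R : realType) (tau : int * int -> R) (n : nat) (t : R) (x y : V n) : R :=
  limn (fun N : nat => \sum_(k < N) (t ^+ k / (k`!)%:R) * mpow R n (gen R tau n) k x y).

(* P[X_n(s) = X_n(t) | tau] for the chain started at 0, s <= t *)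
Definition prob_same (R : realType) (tau : int * int -> R) (n : nat) (s t : R) : R :=
  \sum_(x : V n) trans R tau n s (origin n) x * trans R tau n (t - s) x x.

Definition Asl (R : realType) (alpha u : R) : R :=
  sin (alpha * pi) / pi *
  Rintegral (@lebesgue_measure R) `]0, u[
    (fun s => s `^ (alpha - 1) * (1 - s) `^ (- alpha)).

Definition tw (R : realType) (alpha gamma : R) (n : nat) : R :=
  2 `^ (2 * n%:R / alpha) * n%:R `^ (1 - gamma / alpha).

Definition mutually_independent (R : realType) d (T : measurableType d)
  (P : probability T R) (I : eqType) (X : I -> T -> R) : Prop :=
  forall (J : seq I) (B : I -> set R), uniq J -> (forall i, measurable (B i)) ->
    P (\bigcap_(i in [set i | i \in J]) (X i @^-1` B i))
    = (\prod_(i <- J) P (X i @^-1` B i))%E.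

Definition identically_distributed (R : realType) d (T : measurableType d)
  (P : probability T R) (I : Type) (X : I -> T -> R) : Prop :=
  forall (i j : I) (B : set R), measurable B ->
    P (X i @^-1` B) = P (X j @^-1` B).

(* Main.v *)
(* Write a for the diagonal of the Green function of the torus, r = t_w / a and
   u_x = tau_x / r.  Fourier analysis on the torus gives a ~ n up to constants,
   a lower bound for the Green function and an l^2 bound for its rows.  Hence the
   resolvent equation of the rescaled chain decouples: if no deep trap is crowded
   by others, the resolvent from 0 to a deep trap x is asymptotic to
   1 / (b I (l + 1/u_x)), and the diagonal resolvent at x to 1 / (l + 1/u_x),
   where b is the number of traps with u_x of order one.  The chain is thus at
   time t_w in a deep trap chosen with the weights of an explicit law, and leaves
   x at rate 1/u_x.  Laplace transforms are inverted with the kernels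
   1 - (1 - exp (- p s))^q: return probabilities are monotone, and the increments
   in time of P[X(s) = X(s + t)] are controlled by the same quantity for short t.
   Almost surely the number of x with u_x >= d is asymptotic to b d^(-alpha)
   (Chernoff bounds), and a second moment bound on the crowding gives probabilities
   of order n^(5 gamma - 2), summable since gamma < 1/6.  The limit is the
   integral of 1 / (1 + v^(1/alpha)) over [0, theta^(-alpha)], normalised by its
   total mass, which is evaluated by the reflection formula
   pi / sin (pi alpha) = sum_k (-1)^k / (alpha + k). *)
Require Import Defs.
From HB Require Import structures.
From mathcomp Require Import all_boot all_order all_algebra.
From mathcomp Require Import all_classical all_reals all_analysis.
From mathcomp Require Import measurable_realfun.
From mathcomp Require Import ring lra zify.
Import Order.TTheory GRing.Theory Num.Theory.
Import numFieldNormedType.Exports.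
Local Open Scope classical_set_scope.
Local Open Scope ring_scope.
Set Implicit Arguments.
Unset Strict Implicit.

(** * Laplacian and Green function of the torus *)

(** The resolvent of the rescaled chain comes from the solution [f] of [v * f - lap f = delta_z]
    with [v = l * u / a]. Convolution with the Green function gives
    [f x * (1 + l * u x) = fmean + green x z] minus the sum over [y != x] of
    [green x y * v y * f y], and [v * f] is a probability vector. Traps thus interact only through
    off-diagonal Green entries, the one unknown constant is the mean of [f], and the total mass
    fixes it; no hitting time or capacity is estimated. The obstacle is the return from Laplace
    transforms to the fixed time [t_w]: the probability of [X(s) = X(s + t)] has no evident
    monotonicity in [s]. But if it is close to 1 for one [s] just below 1 and one [t = t0], then for
    every [t] it is almost constant in the first time on [[s, s + t0]]. The inversion kernels are
    finite sums of exponentials, so finitely many integer Laplace variables suffice, and the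
    resulting bounds are uniform over all deep traps. The level is always [n.+1], since the Green
    diagonal vanishes on the one-point torus. *)

Section Torus.
Context {R : realType} {n : nat}.
Implicit Types (f g v : V n -> R) (x y z k : V n).
Notation M := (2 ^ n)%N.
Notation N := ((4 ^ n)%:R : R).

Lemma oaddA (i : 'I_M) c c' : oadd n (oadd n i c) c' = oadd n i (c + c').
Proof. by apply: val_inj; rewrite /= modnDml addnA. Qed.

Lemma oadd_pow2 (i : 'I_M) : oadd n i M = i.
Proof. by apply: val_inj; rewrite /= modnDr modn_small. Qed.

Lemma oadd1K (i : 'I_M) : oadd n (oadd n i 1) (M - 1) = i.
Proof. by rewrite oaddA subnKC ?pow2_gt0// oadd_pow2. Qed.

Lemma oaddB1K (i : 'I_M) : oadd n (oadd n i (M - 1)) 1 = i.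
Proof. by rewrite oaddA subnK ?pow2_gt0// oadd_pow2. Qed.

Definition lap f x : R := (\sum_(k < 4) f (nbr n x k)) / 4 - f x.

Lemma lapE f x : lap f x = (f (oadd n x.1 1, x.2) + f (oadd n x.1 (M - 1), x.2)
  + f (x.1, oadd n x.2 1) + f (x.1, oadd n x.2 (M - 1))) / 4 - f x.
Proof. by rewrite /lap !big_ord_recl big_ord0 /nbr /= addr0 !addrA. Qed.

Lemma sum_shift1 (h : V n -> R) :
  \sum_x h (oadd n x.1 1, x.2) = \sum_x h x.
Proof.
by rewrite [RHS](reindex (fun x => (oadd n x.1 1, x.2)))//=;
  exists (fun x => (oadd n x.1 (M - 1), x.2)) => -[i j] _ /=; rewrite ?oadd1K ?oaddB1K.
Qed.

Lemma sum_shift2 (h : V n -> R) :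
  \sum_x h (x.1, oadd n x.2 1) = \sum_x h x.
Proof.
by rewrite [RHS](reindex (fun x => (x.1, oadd n x.2 1)))//=;
  exists (fun x => (x.1, oadd n x.2 (M - 1))) => -[i j] _ /=; rewrite ?oadd1K ?oaddB1K.
Qed.

Lemma sum_shift1N f g :
  \sum_x g x * f (oadd n x.1 (M - 1), x.2) = \sum_x f x * g (oadd n x.1 1, x.2).
Proof.
rewrite -(sum_shift1 (fun x => g x * _)); apply: eq_bigr => -[i j] _ /=.
by rewrite oadd1K mulrC.
Qed.

Lemma sum_shift2N f g :
  \sum_x g x * f (x.1, oadd n x.2 (M - 1)) = \sum_x f x * g (x.1, oadd n x.2 1).
Proof.
rewrite -(sum_shift2 (fun x => g x * _)); apply: eq_bigr => -[i j] _ /=.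
by rewrite oadd1K mulrC.
Qed.

(** Backward shifts are traded for forward ones by translating the summation variable; the
    right-hand side is then visibly symmetric in [f] and [g]. *)
Lemma sum_mul_lap f g : \sum_x g x * lap f x =
  (\sum_x g x * f (oadd n x.1 1, x.2) + \sum_x f x * g (oadd n x.1 1, x.2)
  + \sum_x g x * f (x.1, oadd n x.2 1) + \sum_x f x * g (x.1, oadd n x.2 1)) / 4
  - \sum_x g x * f x.
Proof.
rewrite -(sum_shift1N f g) -(sum_shift2N f g) -!big_split /= mulr_suml -sumrB.
by apply: eq_bigr => x _; rewrite lapE; field.
Qed.

Lemma lap_sym f g : \sum_x g x * lap f x = \sum_x f x * lap g x.
Proof.
rewrite !sum_mul_lap (eq_bigr _ (fun x _ => mulrC (g x) (f x))).
by congr (_ / 4 - _); ring.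
Qed.

Lemma lap_cst c x : lap (fun=> c) x = 0.
Proof. by rewrite lapE; field. Qed.

Lemma sum_lap f : \sum_x lap f x = 0.
Proof.
rewrite (eq_bigr (fun x => 1 * lap f x)); last by move=> *; rewrite mul1r.
by rewrite (lap_sym f (fun=> 1)) big1// => x _; rewrite lap_cst mulr0.
Qed.

(** Each product of neighbouring values is at most the mean of the two squares, and the sum of
    squares is translation invariant. *)
Lemma dirichlet_le0 f : \sum_x f x * lap f x <= 0.
Proof.
rewrite sum_mul_lap.
have h1 : \sum_x f x * f (oadd n x.1 1, x.2) <= \sum_x f x * f x.
  have: \sum_x f x * f (oadd n x.1 1, x.2) <=
     (\sum_x f x * f x + \sum_x f (oadd n x.1 1, x.2) * f (oadd n x.1 1, x.2)) / 2.
    rewrite -big_split /= mulr_suml ler_sum// => x _.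
    by have := sqr_ge0 (f x - f (oadd n x.1 1, x.2)); lra.
  rewrite (sum_shift1 (fun x => f x * f x)); lra.
have h2 : \sum_x f x * f (x.1, oadd n x.2 1) <= \sum_x f x * f x.
  have: \sum_x f x * f (x.1, oadd n x.2 1) <=
     (\sum_x f x * f x + \sum_x f (x.1, oadd n x.2 1) * f (x.1, oadd n x.2 1)) / 2.
    rewrite -big_split /= mulr_suml ler_sum// => x _.
    by have := sqr_ge0 (f x - f (x.1, oadd n x.2 1)); lra.
  rewrite (sum_shift2 (fun x => f x * f x)); lra.
lra.
Qed.

(** At a minimum point of [f] the Laplacian is nonnegative, so a negative minimum would make
    [v * f - lap f] negative there. *)
Lemma max_principle v f : (forall x, 0 < v x) ->
  (forall x, 0 <= v x * f x - lap f x) -> forall x, 0 <= f x.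
Proof.
move=> v0 h x; case: (@arg_minP _ R _ x xpredT f isT) => z _ zmin.
apply: le_trans (zmin x isT); rewrite leNgt; apply/negP => fz0.
have := h z; rewrite lapE.
have := zmin (oadd n z.1 1, z.2) isT; have := zmin (oadd n z.1 (M - 1), z.2) isT.
have := zmin (z.1, oadd n z.2 1) isT; have := zmin (z.1, oadd n z.2 (M - 1)) isT.
have := v0 z; nra.
Qed.

Lemma card_torus : #|V n| = (4 ^ n)%N.
Proof. by rewrite /V card_prod !card_ord -expnMn. Qed.

Lemma sum_delta x (h : V n -> R) : \sum_y (x == y)%:R * h y = h x.
Proof.
rewrite (bigD1 x)//= eqxx mul1r big1 ?addr0// => y /negbTE yx.
by rewrite eq_sym yx mul0r.
Qed.

End Torus.

(** * Real characters of the torus and the spectral form of the Green function *)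

Section Fourier.
Context {R : realType} {n : nat}.
Implicit Types (f g v c : V n -> R) (x y z k : V n).
Notation M := (2 ^ n)%N.
Notation N := ((4 ^ n)%:R : R).

Lemma pow2R_gt0 : 0 < M%:R :> R.
Proof. by rewrite ltr0n pow2_gt0. Qed.

Lemma pow4R_gt0 : 0 < N.
Proof. by rewrite ltr0n expn_gt0. Qed.

Definition ang : R := pi *+ 2 / M%:R.

Lemma angM (m : nat) : ang * (m * M)%:R = (pi *+ 2) *+ m.
Proof.
by rewrite /ang natrM mulrCA mulfVK ?mulr_natl// lt0r_neq0// pow2R_gt0.
Qed.

Definition phase k x : R := ang * (k.1 * x.1 + k.2 * x.2)%:R.

Lemma cos_ang_mod (a b : nat) (t : R) :
  cos (ang * (a * (b %% M))%:R + t) = cos (ang * (a * b)%:R + t).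
Proof.
rewrite {2}(divn_eq b M) mulnDr mulnA natrD mulrDr angM.
by rewrite -addrA addrC (periodicn (@cosD2pi R)).
Qed.

Lemma cos_ang_sub (a b : nat) (t : R) :
  cos (ang * (a * (b + (M - 1)))%:R + t) = cos (ang * (a * b)%:R - ang * a%:R + t).
Proof.
rewrite -(periodicn (@cosD2pi R) a (_ - _ + t)) -angM; congr cos.
have ->: (a * M)%:R = (a * (M - 1))%:R + a%:R :> R.
  by rewrite -natrD -mulnSr -subSn ?pow2_gt0// subSS subn0.
rewrite mulnDr natrD; move: (_%:R) (_%:R) (_%:R) ang => ? ? ? ?; ring.
Qed.

(** Eigenvalue of [- lap] at the character [k]: one minus the mean of the two cosines of
    [2 * pi * k_i / 2^n], rewritten by the half-angle formula. *)
Definition lam k : R :=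
  sin (pi * (k.1 : nat)%:R / M%:R) ^+ 2 + sin (pi * (k.2 : nat)%:R / M%:R) ^+ 2.

Lemma cos_ang (m : nat) : cos (ang * m%:R) = 1 - sin (pi * m%:R / M%:R) ^+ 2 *+ 2.
Proof.
have -> : ang * m%:R = (pi * m%:R / M%:R) *+ 2 by rewrite /ang; move: (M%:R^-1) => ?; ring.
by rewrite cos_mulr2n cos2sin2; move: (sin _) => ?; ring.
Qed.

(** Cosines with an arbitrary phase shift [t] replace complex exponentials; in the sum over opposite
    neighbours the sine terms cancel. *)
Lemma lap_cos k t x :
  lap (fun y => cos (phase k y - t)) x = - lam k * cos (phase k x - t).
Proof.
have e1 b : cos (phase k (oadd n x.1 b, x.2) - t) =
    cos (ang * (k.1 * (x.1 + b))%:R + (ang * (k.2 * x.2)%:R - t)).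
  by rewrite -cos_ang_mod /phase /= natrD mulrDr addrA.
have e2 b : cos (phase k (x.1, oadd n x.2 b) - t) =
    cos (ang * (k.2 * (x.2 + b))%:R + (ang * (k.1 * x.1)%:R - t)).
  by rewrite -cos_ang_mod /phase /= natrD mulrDr addrA [_ * _ + _ * _]addrC.
rewrite lapE !e1 !e2 !cos_ang_sub.
have p1 m : ang * (m * (x.1 + 1))%:R = ang * (m * x.1)%:R + ang * m%:R.
  by rewrite mulnDr muln1 natrD mulrDr.
have p2 m : ang * (m * (x.2 + 1))%:R = ang * (m * x.2)%:R + ang * m%:R.
  by rewrite mulnDr muln1 natrD mulrDr.
rewrite p1 p2.
set h1 := ang * (k.1 : nat)%:R; set h2 := ang * (k.2 : nat)%:R.
set P := phase k x - t.
have EP : P = ang * (k.1 * x.1)%:R + ang * (k.2 * x.2)%:R - t.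
  by rewrite /P /phase natrD mulrDr.
move: (ang * (k.1 * x.1)%:R) (ang * (k.2 * x.2)%:R) EP => a1 a2 EP.
rewrite (_ : _ + h1 + _ = P + h1); last by rewrite EP; ring.
rewrite (_ : _ - h1 + _ = P - h1); last by rewrite EP; ring.
rewrite (_ : _ + h2 + _ = P + h2); last by rewrite EP; ring.
rewrite (_ : _ - h2 + _ = P - h2); last by rewrite EP; ring.
rewrite !cosD !cosN !sinN !cos_ang /lam.
move: (sin (pi * _ / _)) (sin (pi * _ / _)) (cos P) (sin P) (sin h1) (sin h2) => ? ? ? ? ? ?.
by field.
Qed.

Lemma sin_pi_div_gt0 (m : nat) : (0 < m < M)%N -> 0 < sin (pi * m%:R / M%:R) :> R.
Proof.
move=> /andP[m0 mM]; apply: sin_gt0_pi; apply/andP; split.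
  by rewrite !mulr_gt0// ?pi_gt0// ?ltr0n// invr_gt0 pow2R_gt0.
by rewrite -mulrA gtr_pMr ?pi_gt0// ltr_pdivrMr ?pow2R_gt0// mul1r ltr_nat.
Qed.

(** Multiplication by the nonzero [sin (pi * m / 2^n)] makes the sum telescope, and periodicity
    equates the two ends. *)
Lemma sum_cos_ang (m : nat) t : (0 < m < M)%N ->
  \sum_(j < M) cos (ang * (m * j)%:R + t) = 0.
Proof.
move=> hm; pose s : R := sin (pi * m%:R / M%:R).
have s0 : s != 0 by rewrite gt_eqF// sin_pi_div_gt0.
apply: (mulfI s0); rewrite mulr0 mulr_sumr.
pose h := pi * m%:R / M%:R : R.
have -> : \sum_(j < M) s * cos (ang * (m * j)%:R + t) =
  \sum_(0 <= j < M) (sin (ang * (m * j.+1)%:R + t - h) - sin (ang * (m * j)%:R + t - h)) / 2.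
  rewrite big_mkord; apply: eq_bigr => j _.
  have -> : ang * (m * j.+1)%:R + t - h = (ang * (m * j)%:R + t) + h.
    by rewrite /ang /h mulnS natrD; move: (M%:R^-1 : R) ((m * j)%:R : R) => ? ?; ring.
  by rewrite sinD sinB -/h /s -/h; move: (sin h) => ?; field.
rewrite -mulr_suml telescope_sumr// angM muln0 mulr0 add0r.
rewrite (_ : _ + t - h = (t - h) + (pi *+ 2) *+ m); last by rewrite -addrA addrC.
by rewrite (periodicn (@sinD2pi R)) subrr mul0r.
Qed.

Lemma neq_origin k : k != origin n -> (0 < k.1)%N || (0 < k.2)%N.
Proof.
apply: contraNT; rewrite negb_or -!eqn0Ngt => /andP[/eqP h1 /eqP h2].
by apply/eqP; case: k h1 h2 => i j /= h1 h2; congr (_, _); exact: val_inj.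
Qed.

Lemma sum_phase k t : k != origin n -> \sum_x cos (phase k x - t) = 0.
Proof.
move=> /neq_origin /orP[k0|k0].
  rewrite -(pair_bigA _ (fun i j => cos (phase k (i, j) - t))) /=.
  rewrite exchange_big big1// => j _.
  rewrite -[RHS](@sum_cos_ang k.1 (ang * (k.2 * j)%:R - t)); last by rewrite k0/=.
  by apply: eq_bigr => i _; rewrite /phase /= natrD mulrDr addrA.
rewrite -(pair_bigA _ (fun i j => cos (phase k (i, j) - t))) /=.
rewrite big1// => i _.
rewrite -[RHS](@sum_cos_ang k.2 (ang * (k.1 * i)%:R - t)); last by rewrite k0/=.
by apply: eq_bigr => j _; rewrite /phase /= natrD mulrDr addrA [_ * _ + _ * _]addrC.
Qed.

(** A coordinate in which [x] and [y] differ gives a vanishing one-dimensional sum. Frequencies are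
    natural numbers, so the difference is taken in the order that keeps it positive; evenness of the
    cosine covers the other order. *)
Lemma sum_character x y :
  \sum_k cos (phase k x - phase k y) = N * (x == y)%:R.
Proof.
have [->|xy] := eqVneq x y.
  under eq_bigr do rewrite subrr cos0.
  by rewrite sumr_const card_torus mulr1.
rewrite mulr0.
have key1 (a b : 'I_M) (t : 'I_M -> R) : (b < a)%N ->
    \sum_(i < M) cos (ang * (i * a)%:R - ang * (i * b)%:R + t b) = 0.
  move=> ba; rewrite -[RHS](@sum_cos_ang (a - b) (t b)); last first.
    by rewrite subn_gt0 ba (leq_ltn_trans (leq_subr _ _)).
  apply: eq_bigr => i _; congr (cos (_ + _)).
  by rewrite -mulrBr -natrB ?leq_mul2l ?(ltnW ba) ?orbT// -mulnBr mulnC.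
have main (p q : V n) : (q.1 < p.1)%N || (q.2 < p.2)%N ->
    \sum_k cos (phase k p - phase k q) = 0.
  case/orP => h.
    rewrite -(pair_bigA _ (fun i j => cos (phase (i, j) p - phase (i, j) q))) /=.
    rewrite exchange_big big1// => j _.
    rewrite -[RHS](key1 _ _ (fun=> ang * (j * p.2)%:R - ang * (j * q.2)%:R) h).
    apply: eq_bigr => i _; congr cos; rewrite /phase /= !natrD; move: ang (_%:R) (_%:R) (_%:R) (_%:R) => ? ? ? ? ?; ring.
  rewrite -(pair_bigA _ (fun i j => cos (phase (i, j) p - phase (i, j) q))) /=.
  rewrite big1// => j _.
  rewrite -[RHS](key1 _ _ (fun=> ang * (j * p.1)%:R - ang * (j * q.1)%:R) h).
  apply: eq_bigr => i _; congr cos; rewrite /phase /= !natrD; move: ang (_%:R) (_%:R) (_%:R) (_%:R) => ? ? ? ? ?; ring.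
have [h|h] := boolP ((y.1 < x.1)%N || (y.2 < x.2)%N); first exact: main.
rewrite (eq_bigr (fun k => cos (phase k y - phase k x))); last first.
  by move=> k _; rewrite -cosN opprB.
apply: main; move: h; rewrite negb_or -!leqNgt => /andP[h1 h2].
rewrite !ltn_neqAle h1 h2 !andbT -negb_and; apply: contra xy => /andP[/eqP e1 /eqP e2].
by apply/eqP; case: x y e1 e2 {h1 h2} => [i j] [i' j'] /= e1 e2;
  congr (_, _); exact: val_inj.
Qed.

(** Convolution kernel with symbol [c]. The identity, the resolvents at constant mass and the Green
    function all have this form, so relations between them reduce to relations between symbols. *)
Definition fourier c x y : R := (\sum_k c k * cos (phase k x - phase k y)) / N.

Lemma fourierC c x y : fourier c x y = fourier c y x.
Proof.
by congr (_ / _); apply: eq_bigr => k _; rewrite -cosN opprB.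
Qed.

Lemma lap_fourier c x y :
  lap (fourier c ^~ y) x = - fourier (fun k => lam k * c k) x y.
Proof.
rewrite /fourier -mulNr -sumrN.
have -> : \sum_k - (lam k * c k * cos (phase k x - phase k y)) =
    \sum_k c k * lap (fun x => cos (phase k x - phase k y)) x.
  by apply: eq_bigr => k _; rewrite lap_cos; ring.
rewrite lapE -!mulrDl -!big_split /= -!mulrA [N^-1 * _]mulrC mulrA -mulrBl.
congr (_ * _); rewrite mulr_suml -sumrB; apply: eq_bigr => k _.
by rewrite lapE; ring.
Qed.

Lemma fourier1 x y : fourier (fun=> 1) x y = (x == y)%:R.
Proof.
rewrite /fourier; under eq_bigr do rewrite mul1r.
by rewrite sum_character mulrC mulKf// lt0r_neq0// pow4R_gt0.
Qed.

Lemma phase0 x : phase (origin n) x = 0.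
Proof. by rewrite /phase /= !mul0n mulr0. Qed.

Lemma sum_fourier c y : \sum_x fourier c x y = c (origin n).
Proof.
rewrite /fourier -mulr_suml exchange_big /= (bigD1 (origin n))//= [X in _ + X]big1 ?addr0.
  under eq_bigr do rewrite !phase0 subrr cos0 mulr1.
  by rewrite sumr_const card_torus -[_ *+ _]mulr_natr mulfK// gt_eqF// pow4R_gt0.
by move=> k k0; rewrite -mulr_sumr sum_phase// mulr0.
Qed.

Lemma fourier_diag c x : fourier c x x = (\sum_k c k) / N.
Proof. by congr (_ / _); apply: eq_bigr => k _; rewrite subrr cos0 mulr1. Qed.

Lemma fourier_norm c x y : (forall k, 0 <= c k) ->
  `|fourier c x y| <= (\sum_k c k) / N.
Proof.
move=> c0; rewrite normrM [`|_^-1|]ger0_norm; last by rewrite invr_ge0 ltW// pow4R_gt0.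
rewrite ler_pM2r ?invr_gt0 ?pow4R_gt0//; apply: (le_trans (ler_norm_sum _ _ _)).
apply: ler_sum => k _; rewrite normrM ger0_norm// ler_piMr// cos_max//.
Qed.

Lemma fourierB c c' x y :
  fourier c x y - fourier c' x y = fourier (fun k => c k - c' k) x y.
Proof.
by rewrite /fourier -mulrBl -sumrB; congr (_ / _); apply: eq_bigr => k _; rewrite mulrBl.
Qed.

Lemma eq_fourier c c' : c =1 c' -> fourier c =2 fourier c'.
Proof. by move=> e x y; congr (_ / _); apply: eq_bigr => k _; rewrite e. Qed.

Lemma fourier_origin x y : fourier (fun k => (k == origin n)%:R) x y = N^-1.
Proof.
rewrite /fourier (bigD1 (origin n))//= big1 ?addr0.
  by rewrite !phase0 subrr cos0 !mul1r.
by move=> k /negbTE ->; rewrite mul0r.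
Qed.

Lemma lam_origin : lam (origin n) = 0.
Proof. by rewrite /lam /= mulr0 mul0r sin0 expr0n addr0. Qed.

Lemma lam_gt0 k : k != origin n -> 0 < lam k.
Proof.
move=> /neq_origin /orP[k0|k0]; rewrite /lam.
  by rewrite ltr_wpDr ?sqr_ge0// exprn_gt0// sin_pi_div_gt0// k0/=.
by rewrite ltr_wpDl ?sqr_ge0// exprn_gt0// sin_pi_div_gt0// k0/=.
Qed.

Lemma lam_ge0 k : 0 <= lam k.
Proof. by rewrite addr_ge0// sqr_ge0. Qed.

(** Pseudo-inverse of [- lap]: the symbol [1 / lam] with the constant mode removed. *)
Definition green : V n -> V n -> R :=
  fourier (fun k => if k == origin n then 0 else (lam k)^-1).

Definition green_diag : R := (\sum_(k | k != origin n) (lam k)^-1) / N.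

(** By Parseval this is the squared [l^2] norm of every row of [green]; see [sum_green_sqr]. *)
Definition green_sqr : R := (\sum_(k | k != origin n) (lam k)^-2) / N.

Lemma greenC x y : green x y = green y x.
Proof. exact: fourierC. Qed.

Lemma sum_if (h : V n -> R) :
  \sum_k (if k == origin n then 0 else h k) = \sum_(k | k != origin n) h k.
Proof. by rewrite [RHS]big_mkcond; apply: eq_bigr => k _; case: eqP. Qed.

Lemma green_xx x : green x x = green_diag.
Proof. by rewrite /green fourier_diag sum_if. Qed.

Lemma green_norm x y : `|green x y| <= green_diag.
Proof.
rewrite /green_diag -sum_if; apply: fourier_norm => k.
by case: eqP => // _; rewrite invr_ge0 lam_ge0.
Qed.

Lemma lap_green x y : lap (green x) y = N^-1 - (x == y)%:R.
Proof.
have -> : green x = fourier (fun k => if k == origin n then 0 else (lam k)^-1) ^~ x.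
  by apply/funext => z; rewrite -/green greenC.
rewrite lap_fourier -(fourier_origin y x) [x == y]eq_sym -fourier1.
rewrite fourierB -[LHS]add0r -[X in X - _](subrr (fourier (fun=> 0) y x)) !fourierB.
apply: eq_fourier => k; case: eqP => [->|/eqP k0]; first by rewrite mulr0 !subr0 subrr.
by rewrite mulfV ?gt_eqF ?lam_gt0// subrr mulr0n !sub0r.
Qed.

(** By symmetry the Laplacian falls on the kernel. This is what turns the resolvent equation into an
    equation for the values of the resolvent. *)
Lemma green_repr f x : \sum_y green x y * lap f y = (\sum_y f y) / N - f x.
Proof.
rewrite lap_sym (eq_bigr (fun y => f y / N - (x == y)%:R * f y)); last first.
  by move=> y _; rewrite lap_green; ring.
by rewrite sumrB sum_delta mulr_suml.
Qed.

(** Apply [green_repr] to the kernel with symbol [lam^-2]: its Laplacian is [- green], and the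
    removed constant mode makes its sum vanish. *)
Lemma sum_green_sqr x : \sum_y green x y ^+ 2 = green_sqr.
Proof.
pose c2 k : R := if k == origin n then 0 else (lam k)^-2.
have e y : lap (fourier c2 ^~ x) y = - green x y.
  rewrite lap_fourier greenC; congr (- _); apply: eq_fourier => k; rewrite /c2.
  case: eqP => [_|/eqP k0]; first by rewrite mulr0.
  by rewrite expr2 invfM mulrA mulfV ?mul1r// gt_eqF// lam_gt0.
have := green_repr (fourier c2 ^~ x) x.
rewrite sum_fourier /c2 eqxx mul0r sub0r fourier_diag sum_if => h.
rewrite /green_sqr -[RHS]opprK -h -sumrN; apply: eq_bigr => y _.
by rewrite e expr2; ring.
Qed.

(* The resolvent at mass [1/N] is positive, and differs from the Green
   function by at most [1 + green_sqr / N]. *)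
Lemma green_lb x y : - (1 + green_sqr / N) <= green x y.
Proof.
pose q := N^-1; have q0 : 0 < q by rewrite invr_gt0 pow4R_gt0.
pose c k := (q + lam k)^-1.
have cp k : 0 < q + lam k by rewrite ltr_pwDl// lam_ge0.
have Gpos z : 0 <= fourier c z y.
  apply: (@max_principle _ _ (fun=> q) (fourier c ^~ y)) => // t; rewrite lap_fourier opprK.
  have -> : q * fourier c t y + fourier (fun k => lam k * c k) t y = fourier (fun=> 1) t y.
    rewrite /fourier mulrA -mulrDl mulr_sumr -big_split /=; congr (_ / _).
    apply: eq_bigr => k _.
    by rewrite /c -[in RHS](mulfV (lt0r_neq0 (cp k))); ring.
  by rewrite fourier1 ler0n.
(* On nonzero modes the two symbols differ by [- q / (lam * (q + lam))], of absolute value at most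
   [q * lam^-2]. The constant mode of the resolvent contributes [q^-1 / N = 1]. *)
have h : `|fourier (fun k => c k - (if k == origin n then 0 else (lam k)^-1)
     - (k == origin n)%:R * (c k)) x y| <= green_sqr / N.
  rewrite -normrN.
  have -> : - fourier (fun k => c k - (if k == origin n then 0 else (lam k)^-1)
       - (k == origin n)%:R * (c k)) x y =
     fourier (fun k => if k == origin n then 0 else q * ((lam k)^-1 * c k)) x y.
    rewrite -[LHS]add0r -[X in X - _](subrr (fourier (fun=> 0) x y)) !fourierB.
    apply: eq_fourier => k; case: eqP => [_|/eqP k0]; first by rewrite mul1r; ring.
    rewrite mul0r /c; field.
    by rewrite !gt_eqF ?lam_gt0.
  apply: le_trans (fourier_norm _ _ _) _.
    move=> k; case: eqP => // /eqP k0; rewrite !mulr_ge0 ?(ltW q0)//.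
      by rewrite invr_ge0 lam_ge0.
    by rewrite invr_ge0 ltW.
  rewrite sum_if /green_sqr -mulrA ler_pdivrMr ?pow4R_gt0//.
  rewrite !mulrA mulfVK ?gt_eqF ?pow4R_gt0// mulr_suml ler_sum// => k k0.
  rewrite mulrC ler_pM2r// expr2 invfM ler_wpM2l ?invr_ge0 ?lam_ge0//.
  by rewrite lef_pV2 ?posrE ?lam_gt0// lerDr ltW.
have e1 : fourier (fun k => (k == origin n)%:R * c k) x y = 1.
  rewrite /fourier (bigD1 (origin n))//= big1 ?addr0.
    rewrite !phase0 subrr cos0 mul1r mulr1 /c lam_origin addr0 /q invrK.
    by rewrite mulfV// gt_eqF// pow4R_gt0.
  by move=> k /negbTE ->; rewrite !mul0r.
move: h; rewrite -!fourierB e1 -/green.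
by rewrite ler_norml => /andP[h1 h2]; have := Gpos x; lra.
Qed.

End Fourier.

Section DerivativeSign.
Context {R : realType}.

(** Mean value theorem. It does the work of integration: nearly every integral estimate below
    compares primitives through the sign of a derivative. *)
Lemma is_derive_ge0_le (f df : R -> R) (a b : R) : a <= b ->
  (forall x, a <= x <= b -> is_derive x 1 f (df x)) ->
  (forall x, a <= x <= b -> 0 <= df x) -> f a <= f b.
Proof.
rewrite le_eqVlt => /orP[/eqP ->//|ab] fd df0.
have [c /andP[ac cb] e] : exists2 c, c \in `]a, b[%R & f b - f a = df c * (b - a).
  apply: MVT => // [x xab|].
    by apply: fd; move: xab; rewrite in_itv /= => /andP[? ?]; rewrite !ltW.
  apply: continuous_in_subspaceT => x; rewrite inE /= in_itv /= => xab.
  by apply: differentiable_continuous; apply/derivable1_diffP; have [] := fd _ xab.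
move: ac cb; rewrite !bnd_simp => ac cb.
rewrite -subr_ge0 e mulr_ge0 ?subr_ge0 ?(ltW ab)//.
by apply: df0; rewrite !ltW.
Qed.

End DerivativeSign.

(** * Order of the Green diagonal and of the Green rows in [l^2] *)

Section GreenBounds.
Context {R : realType}.

Lemma sin_le (x : R) : 0 <= x -> sin x <= x.
Proof.
move=> x0; rewrite -subr_ge0 -[leLHS](subrr (sin 0)) {1}sin0.
apply: (@is_derive_ge0_le _ (fun y => y - sin y) (fun y => 1 - cos y)) => // y _.
Qed.

(** A version of Jordan's inequality with a cruder constant: on [[0, 1]] the derivative of the sine
    is at least [cos 1]; beyond 1 the sine increases while [x <= 2]. *)
Lemma sin_ge (x : R) : 0 <= x <= pi / 2 -> cos 1 / 2 * x <= sin x.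
Proof.
have small y : 0 <= y <= 1 -> cos 1 * y <= sin y :> R.
  move=> /andP[y0 y1]; rewrite -subr_ge0.
  rewrite [leLHS](_ : 0 = sin 0 - cos 1 * 0); last by rewrite sin0 mulr0 subrr.
  apply: (@is_derive_ge0_le _ (fun y => sin y - cos 1 * y) (fun y => cos y - cos 1)) => //.
    by move=> t _; apply: is_derive_eq; rewrite /GRing.scale /=; ring.
  move=> t /andP[t0 ty]; rewrite subr_ge0.
  have t1 : t <= 1 := le_trans ty y1.
  move: t1; rewrite le_eqVlt => /orP[/eqP->//|t1].
  rewrite ltW// ltr_cos// ?in_itv/= ?ler01 ?t0/= ?(le_trans (ltW t1))//.
    by rewrite (le_trans _ (@pi_ge2 R))// ler1n.
  by rewrite (le_trans _ (@pi_ge2 R))// ler1n.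
move=> /andP[x0 x2]; have c1 := @cos1_gt0 R.
have [x1|x1] := leP x 1.
  apply: le_trans (small _ _); last by rewrite x0 x1.
  by have := mulr_ge0 (ltW c1) x0; lra.
have h1 : cos 1 <= sin 1 :> R by rewrite -[leLHS]mulr1 small// ler01 lexx.
have h2 : sin 1 <= sin x.
  rewrite ltW// ltr_sin// ?in_itv/=.
    by have := @pihalf_ge1 R; lra.
  by have := @pihalf_ge1 R; lra.
apply: le_trans (le_trans h1 h2).
rewrite mulrAC ler_pdivrMr// ler_pM2l//.
by rewrite (le_trans x2)// ltW// pihalf_lt2.
Qed.

(** Every dyadic block contributes between 1/2 and 1. The index 0 contributes 0, because the inverse
    of 0 is 0. *)
Lemma harmonic_pow2_bounds (n : nat) :
  n%:R / 2 <= \sum_(0 <= i < 2 ^ n) (i%:R^-1 : R) <= n%:R.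
Proof.
elim: n => [|n /andP[IH1 IH2]]; first by rewrite mul0r big_nat1 invr0 lexx.
have e : (2 ^ n.+1 = 2 ^ n + 2 ^ n)%N by rewrite expnS mul2n addnn.
rewrite (@big_cat_nat _ _ _ (2 ^ n))//=; last by rewrite e leq_addr.
have p0 : (0 : R) < (2 ^ n)%:R by rewrite ltr0n expn_gt0.
have h1 : 1 / 2 <= \sum_(2 ^ n <= i < 2 ^ n.+1) (i%:R^-1 : R).
  apply: le_trans (ler_sum_nat (F := fun=> ((2 ^ n.+1)%:R)^-1) _ ); last first.
    move=> i /andP[i1 i2]; rewrite lef_pV2 ?posrE ?ler_nat ?(ltnW i2)// ltr0n ?expn_gt0//.
    by rewrite (leq_trans _ i1)// expn_gt0.
  rewrite sumr_const_nat e addnK natrD -[_ *+ _]mulr_natr.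
  by rewrite le_eqVlt; apply/orP; left; apply/eqP; field; rewrite gt_eqF.
have h2 : \sum_(2 ^ n <= i < 2 ^ n.+1) (i%:R^-1 : R) <= 1.
  apply: le_trans (ler_sum_nat (G := fun=> ((2 ^ n)%:R)^-1) _ ) _.
    move=> i /andP[i1 i2]; rewrite lef_pV2 ?posrE ?ler_nat// ltr0n.
    by rewrite (leq_trans _ i1)// expn_gt0.
  by rewrite sumr_const_nat e addnK -[_ *+ _]mulr_natr mulVf// gt_eqF.
rewrite -natr1; apply/andP; split; lra.
Qed.

Lemma sum_inv_sqr_le2 (L : nat) : \sum_(0 <= i < L) (i%:R ^- 2 : R) <= 2.
Proof.
have [|L0] := leqP L 1.
  case: L => [|[|//]] _; first by rewrite big_geq.
  by rewrite big_nat1 expr0n invr0.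
suff h m : \sum_(0 <= i < m.+2) (i%:R ^- 2 : R) <= 2 - m.+1%:R^-1.
  by case: L L0 => [|[|m]]// _; apply: le_trans (h m) _; rewrite gerBl invr_ge0.
elim: m => [|m IH].
  by rewrite !big_nat_recr//= big_geq// expr0n invr0 expr1n invr1; lra.
rewrite big_nat_recr//=; apply: le_trans (lerD IH (lexx _)) _.
have p1 : (0 : R) < m.+1%:R by rewrite ltr0n.
have -> : m.+2%:R = m.+1%:R + 1 :> R by rewrite natr1.
move: (m.+1%:R) p1 => t t0.
rewrite -subr_ge0 [leRHS](_ : _ = (t * (t + 1) ^+ 2)^-1); last by field; rewrite !gt_eqF// ltr_wpDr.
by rewrite invr_ge0 mulr_ge0 ?sqr_ge0// ltW.
Qed.

(** Folding the cycle: a distance to 0 is attained at most once on either side. *)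
Lemma sum_minn_le (L : nat) (psi : nat -> R) : (forall i, 0 <= psi i) ->
  \sum_(k < L) psi (minn k (L - k)) <= 2 * \sum_(i < L.+1) psi i.
Proof.
move=> p0.
have h1 : \sum_(k < L) psi k <= \sum_(i < L.+1) psi i.
  by rewrite big_ord_recr /= lerDl.
have h2 : \sum_(k < L) psi (L - k)%N <= \sum_(i < L.+1) psi i.
  rewrite [leRHS](reindex_inj rev_ord_inj) /= big_ord_recr /=.
  apply: (@le_trans _ _ (\sum_(i < L) psi (L.+1 - i.+1)%N)); last by rewrite lerDl.
  by apply: ler_sum => i _; rewrite subSS.
apply: (@le_trans _ _ (\sum_(k < L) (psi k + psi (L - k)%N))).
  apply: ler_sum => k _; rewrite /minn; case: ltnP => _; first by rewrite lerDl.
  by rewrite lerDr.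
by rewrite big_split /=; lra.
Qed.

(** A pair is charged to its larger coordinate [i], which leaves at most [i.+1] values for the other
    one. *)
Lemma sum_maxn_le (L : nat) (phi : nat -> R) : (forall i, 0 <= phi i) ->
  \sum_(i < L) \sum_(j < L) phi (maxn i j) <= 2 * \sum_(i < L) i.+1%:R * phi i.
Proof.
move=> p0.
have cnt (i : 'I_L) : \sum_(j < L) (j <= i)%N%:R * phi i <= i.+1%:R * phi i.
  rewrite -mulr_suml ler_wpM2r// -natr_sum ler_nat.
  have -> : (\sum_(j < L) (j <= i) = \sum_(j < L | (j < i.+1)%N) 1)%N.
    by rewrite [RHS]big_mkcond; apply: eq_bigr => j _; rewrite ltnS; case: leqP.
  by rewrite (big_ord_narrow (ltn_ord i)) sum_nat_const card_ord muln1.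
apply: (@le_trans _ _ (\sum_(i < L) \sum_(j < L)
    ((j <= i)%N%:R * phi i + (i <= j)%N%:R * phi j))).
  apply: ler_sum => i _; apply: ler_sum => j _; rewrite /maxn; case: ltnP => ij.
    by rewrite (ltnW ij) mul1r lerDr mulr_ge0.
  by rewrite mul1r lerDl mulr_ge0.
under eq_bigr do rewrite big_split /=.
rewrite big_split /= [X in _ + X]exchange_big /=.
by rewrite mulr_natl mulr2n lerD// ler_sum// => i _; exact: cnt.
Qed.

Section Level.
Context {n : nat}.
Implicit Types k : V n.
Notation M := (2 ^ n)%N.
Notation N := ((4 ^ n)%:R : R).

Let dist (i : nat) := minn i (M - i).
Let rad k := maxn (dist k.1) (dist k.2).

Lemma pow4_sqr : N = M%:R ^+ 2.
Proof. by rewrite -natrX -expnM mulnC expnM. Qed.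

Lemma sin_dist (i : nat) : (i < M)%N ->
  cos 1 * (dist i)%:R / M%:R <= sin (pi * i%:R / M%:R) :> R.
Proof.
move=> iM; have M0 : (0 : R) < M%:R := pow2R_gt0.
have c1 := @cos1_gt0 R.
have main (j : nat) : (2 * j <= M)%N -> cos 1 * j%:R / M%:R <= sin (pi * j%:R / M%:R) :> R.
  move=> jM; apply: le_trans (sin_ge _).
    have -> : cos 1 / 2 * (pi * j%:R / M%:R) = cos 1 * j%:R / M%:R * (pi / 2) :> R.
      by move: (M%:R^-1) (j%:R) (pi : R) => ? ? ?; field.
    by rewrite ler_peMr ?pihalf_ge1// !mulr_ge0 ?(ltW c1)// invr_ge0.
  apply/andP; split; first by rewrite !mulr_ge0 ?pi_ge0// invr_ge0.
  rewrite -mulrA ler_pM2l ?pi_gt0// ler_pdivrMr// mulrC ler_pdivlMr//.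
  by rewrite mulrC -natrM ler_nat.
rewrite /dist /minn; case: ltnP => h; first by apply: main; lia.
have -> : sin (pi * i%:R / M%:R) = sin (pi * (M - i)%:R / M%:R) :> R.
  rewrite natrB ?(ltnW iM)// mulrBr mulrBl mulfK ?gt_eqF//.
  by rewrite sinB sinpi cospi mul0r sub0r mulN1r opprK.
by apply: main; lia.
Qed.

(** The coordinate farther from 0 suffices: after the reflection [i] to [M - i] its angle is at most
    [pi / 2], where [sin_ge] applies. *)
Lemma invlam_le k : k != origin n ->
  (lam k)^-1 <= N * (cos 1 : R) ^- 2 * (rad k)%:R ^- 2.
Proof.
move=> k0; have M0 : (0 : R) < M%:R := pow2R_gt0.
have c1 := @cos1_gt0 R.
have r0 : (0 < rad k)%N.
  have := neq_origin k0; rewrite /rad /dist leq_max !leq_min !subn_gt0 !ltn_ord !andbT//.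
have r0' : (0 : R) < (rad k)%:R by rewrite ltr0n.
rewrite pow4_sqr -!exprVn -!exprMn -[leRHS]invrK -exprVn lef_pV2 ?posrE ?lam_gt0//; last first.
  by rewrite exprn_gt0// invr_gt0 !mulr_gt0// ?invr_gt0.
have -> : (M%:R * (cos 1)^-1 * (rad k)%:R^-1)^-1 = cos 1 * (rad k)%:R / M%:R :> R.
  by field; rewrite !gt_eqF.
have sq (i : nat) : (i < M)%N -> (cos 1 * (dist i)%:R / M%:R) ^+ 2 <=
     sin (pi * i%:R / M%:R) ^+ 2 :> R.
  move=> iM; rewrite lerXn2r ?nnegrE ?sin_dist// ?divr_ge0 ?mulr_ge0 ?(ltW c1)//.
  apply: le_trans (sin_dist iM).
  by rewrite ?divr_ge0 ?mulr_ge0 ?(ltW c1).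
rewrite /lam /rad /maxn; case: ltnP => _.
  by apply: le_trans (sq _ (ltn_ord _)) _; rewrite lerDr sqr_ge0.
by apply: le_trans (sq _ (ltn_ord _)) _; rewrite lerDl sqr_ge0.
Qed.

(** The factor 8 is 2 for folding each of the two coordinates and 2 for the maximum. *)
Lemma sum_rad_le (phi : nat -> R) : (forall i, 0 <= phi i) ->
  \sum_k phi (rad k) <= 8 * \sum_(i < M.+1) i.+1%:R * phi i.
Proof.
move=> p0; rewrite -(pair_bigA _ (fun i j : 'I_M => phi (maxn (dist i) (dist j)))) /=.
apply: (@le_trans _ _ (\sum_(i < M) 2 * \sum_(j < M.+1) phi (maxn (dist i) j))).
  apply: ler_sum => i _; apply: (@sum_minn_le M (fun j => phi (maxn (dist i) j))) => //.
rewrite -mulr_sumr.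
have := @sum_minn_le M (fun i => \sum_(j < M.+1) phi (maxn i j)) (fun i => sumr_ge0 _ (fun j _ => p0 _)).
have := @sum_maxn_le M.+1 phi p0; rewrite /dist; lra.
Qed.

(** About [r] modes lie at distance [r] and each weighs [r^-2]; the harmonic sum up to [2^n] is of
    order [n]. *)
Lemma green_diag_le : green_diag (R := R) (n := n) <= 16 * (cos 1) ^- 2 * n.+1%:R.
Proof.
have c1 : (0 : R) < cos 1 ^- 2 by rewrite invr_gt0 exprn_gt0// cos1_gt0.
rewrite /green_diag ler_pdivrMr ?pow4R_gt0//.
apply: (@le_trans _ _ (\sum_k N * (cos 1 : R) ^- 2 * (rad k)%:R ^- 2)).
  rewrite [leRHS](bigID (fun k => k != origin n)) /= -[leLHS]addr0 lerD//.
    by apply: ler_sum => k k0; exact: invlam_le.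
  by apply: sumr_ge0 => k _; rewrite !mulr_ge0 ?(ltW c1)// invr_ge0 exprn_ge0.
rewrite -mulr_sumr.
have h1 := @sum_rad_le (fun i => i%:R ^- 2) (fun i => ltac:(by rewrite invr_ge0 exprn_ge0)).
have h2 : \sum_(i < M.+1) i.+1%:R * i%:R ^- 2 <= 2 * n.+1%:R :> R.
  apply: (@le_trans _ _ (\sum_(0 <= i < M.+1) 2 * i%:R^-1)).
    rewrite big_mkord; apply: ler_sum => -[[|i] ?] _ /=; first by rewrite expr0n invr0 !mulr0.
    rewrite expr2 invfM mulrA ler_pM2r ?invr_gt0 ?ltr0n// ler_pdivrMr ?ltr0n//.
    by rewrite -natrM ler_nat; lia.
  rewrite -mulr_sumr ler_pM2l// big_nat_recr//= -natr1 lerD//.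
    by have /andP[] := harmonic_pow2_bounds n.
  by rewrite invf_le1 ?ler1n ?pow2_gt0// pow2R_gt0.
have -> : 16 * cos 1 ^- 2 * n.+1%:R * N = N * cos 1 ^- 2 * (8 * (2 * n.+1%:R)) :> R.
  by move: N (cos 1 ^- 2) n.+1%:R => ? ? ?; ring.
rewrite ler_wpM2l// ?mulr_ge0 ?(ltW c1)//; lra.
Qed.

(** Here the weight is [r^-4], so the radial sum converges and only the factor [N] remains. *)
Lemma green_sqr_le : green_sqr (R := R) (n := n) <= 32 * (cos 1) ^- 4 * N.
Proof.
have c1 : (0 : R) < cos 1 by exact: cos1_gt0.
rewrite /green_sqr ler_pdivrMr ?pow4R_gt0//.
apply: (@le_trans _ _ (\sum_k N ^+ 2 * (cos 1 : R) ^- 4 * (rad k)%:R ^- 4)).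
  rewrite [leRHS](bigID (fun k => k != origin n)) /= -[leLHS]addr0 lerD//.
    apply: ler_sum => k k0; have := invlam_le k0; have := lam_gt0 (R := R) k0.
    move=> l0 h; rewrite -[lam k ^- 2]exprVn.
    have -> : N ^+ 2 * cos 1 ^- 4 * (rad k)%:R ^- 4 =
       (N * cos 1 ^- 2 * (rad k)%:R ^- 2) ^+ 2 :> R.
      rewrite !exprMn -!exprVn -!exprM.
      by [].
    by rewrite lerXn2r ?nnegrE ?invr_ge0 ?(ltW l0)// (le_trans _ h)// invr_ge0 ltW.
  by apply: sumr_ge0 => k _; rewrite !mulr_ge0 ?sqr_ge0// invr_ge0 exprn_ge0// ltW.
rewrite -mulr_sumr.
have h1 := @sum_rad_le (fun i => i%:R ^- 4) (fun i => ltac:(by rewrite invr_ge0 exprn_ge0)).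
have h2 : \sum_(i < M.+1) i.+1%:R * i%:R ^- 4 <= 4 :> R.
  apply: (@le_trans _ _ (\sum_(0 <= i < M.+1) 2 * i%:R^-2)).
    rewrite big_mkord; apply: ler_sum => -[[|i] ?] _ /=; first by rewrite !expr0n invr0 !mulr0.
    rewrite (_ : 4 = 2 + 2)%N// exprD invfM mulrA ler_pM2r ?invr_gt0 ?exprn_gt0 ?ltr0n//.
    by rewrite ler_pdivrMr ?exprn_gt0 ?ltr0n// -natrX -natrM ler_nat; nia.
  by rewrite -mulr_sumr; have := sum_inv_sqr_le2 M.+1; lra.
have -> : 32 * cos 1 ^- 4 * N * N = N ^+ 2 * cos 1 ^- 4 * (8 * 4) :> R.
  by move: N (cos 1 ^- 4) => ? ?; ring.
rewrite ler_wpM2l// ?mulr_ge0 ?sqr_ge0 ?invr_ge0 ?exprn_ge0 ?(ltW c1)//; lra.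
Qed.

(** Only modes [(i, j)] with [j < i] are kept: both sines are then at most [pi * i / 2^n], and the
    [i] modes of row [i] together give a multiple of [1 / i]. *)
Lemma green_diag_ge : (4 * pi ^+ 2)^-1 * n%:R <= green_diag (R := R) (n := n).
Proof.
have M0 : (0 : R) < M%:R := pow2R_gt0.
have p0 : (0 : R) < pi ^+ 2 by rewrite exprn_gt0// pi_gt0.
have lamle (i j : 'I_M) : (0 < i)%N -> (j < i)%N ->
    N * (2 * pi ^+ 2)^-1 * (i : nat)%:R ^- 2 <= (lam (R := R) (i, j))^-1.
  move=> i0 ji; have i0' : (0 : R) < (i : nat)%:R by rewrite ltr0n.
  have l0 : 0 < lam (R := R) (n := n) (i, j).
    by apply: lam_gt0; apply/eqP => -[e _]; rewrite e in i0.
  rewrite -[leLHS]invrK lef_pV2 ?posrE//; last first.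
    by rewrite invr_gt0 !mulr_gt0 ?pow4R_gt0 ?invr_gt0 ?exprn_gt0// mulr_gt0.
  have sq (m : 'I_M) : (m <= i)%N -> sin (pi * (m : nat)%:R / M%:R) ^+ 2 <= 
      (pi * (i : nat)%:R / M%:R) ^+ 2 :> R.
    move=> mi; rewrite lerXn2r ?nnegrE//.
    - apply: sin_ge0_pi; apply/andP; split; first by rewrite !mulr_ge0 ?pi_ge0// invr_ge0.
      by rewrite -mulrA ger_pMr ?pi_gt0// ler_pdivrMr// mul1r ler_nat ltnW.
    - by rewrite !mulr_ge0 ?pi_ge0// invr_ge0.
    apply: le_trans (sin_le _) _; first by rewrite !mulr_ge0 ?pi_ge0// invr_ge0.
    by rewrite ler_pM2r ?invr_gt0// ler_pM2l ?pi_gt0// ler_nat.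
  apply: le_trans (lerD (sq _ (leqnn _)) (sq j (ltnW ji))) _.
  rewrite pow4_sqr le_eqVlt; apply/orP; left; apply/eqP.
  move: (pi : R) (@pi_gt0 R) M%:R (i : nat)%:R M0 i0' => p q m l m0 l0'.
  by field; rewrite !gt_eqF.
rewrite /green_diag ler_pdivlMr ?pow4R_gt0//.
have /andP[H _] := harmonic_pow2_bounds n.
apply: (@le_trans _ _ (N * (2 * pi ^+ 2)^-1 * \sum_(0 <= i < M) (i%:R^-1 : R))).
  have -> : (4 * pi ^+ 2)^-1 * n%:R * N = N * (2 * pi ^+ 2)^-1 * (n%:R / 2) :> R.
    by move: (pi ^+ 2) p0 N => q q0 ?; field; rewrite gt_eqF.
  by rewrite ler_pM2l// mulr_gt0 ?pow4R_gt0// invr_gt0 mulr_gt0.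
have nn i j : 0 <= (if ((i, j) : V n) != origin n then (lam (R := R) (i, j))^-1 else 0).
  by case: ifP => // _; rewrite invr_ge0 lam_ge0.
rewrite mulr_sumr big_mkord [leRHS]big_mkcond /=.
rewrite -(pair_bigA _ (fun i j => if ((i, j) : V n) != origin n then (lam (R := R) (i, j))^-1 else 0)) /=.
apply: ler_sum => i _.
have [->|i0] := posnP i; first by rewrite invr0 mulr0 sumr_ge0.
rewrite (bigID (fun j : 'I_M => (j < i)%N)) /= -[leLHS]addr0 lerD ?sumr_ge0//.
apply: (@le_trans _ _ (\sum_(j < M | (j < i)%N) N * (2 * pi ^+ 2)^-1 * (i : nat)%:R ^- 2)).
  rewrite (big_ord_narrow (ltnW (ltn_ord i))) sumr_const card_ord -[leRHS]mulr_natr.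
  have i1 : (i : nat)%:R != 0 :> R by rewrite pnatr_eq0 -lt0n.
  move: (N * _) => Q; rewrite le_eqVlt; apply/orP; left; apply/eqP; field.
  by rewrite i1.
apply: ler_sum => j ji; rewrite ifT ?lamle//.
by apply/eqP => -[e _]; rewrite e in i0.
Qed.

End Level.
End GreenBounds.

(** * Matrix exponentials and the trap chain *)

Section ExponentialSeries.
Context {R : realType}.

Lemma cvg_big_sum (I : Type) (r : seq I) (f : I -> nat -> R) (l : I -> R) :
  (forall i, f i @ \oo --> l i) ->
  (fun N => \sum_(i <- r) f i N) @ \oo --> \sum_(i <- r) l i.
Proof.
move=> h; elim: r => [|i r IH].
  by under eq_fun do rewrite big_nil; rewrite big_nil; exact: cvg_cst.
under eq_fun do rewrite big_cons; rewrite big_cons; exact: cvgD.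
Qed.

Lemma is_derive_big_sum (I : Type) (r : seq I) (f : I -> R -> R) (df : I -> R) (x : R) :
  (forall i, is_derive x 1 (f i) (df i)) ->
  is_derive x 1 (fun y => \sum_(i <- r) f i y) (\sum_(i <- r) df i).
Proof.
move=> h; elim: r => [|i r IH].
  by under eq_fun do rewrite big_nil; rewrite big_nil; exact: is_derive_cst.
under eq_fun do rewrite big_cons; rewrite big_cons; exact: is_deriveD.
Qed.

Lemma is_derive_conv (f : R -> R) (x df df' : R) :
  is_derive x 1 f df -> df = df' -> is_derive x 1 f df'.
Proof. by move=> h <-. Qed.

Lemma is_derive_mul (f g : R -> R) (x df dg : R) :
  is_derive x 1 f df -> is_derive x 1 g dg ->
  is_derive x 1 (fun y => f y * g y) (df * g x + f x * dg).
Proof.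
move=> hf hg; apply: (is_derive_conv (@is_deriveM _ _ f g x 1 df dg hf hg)).
by rewrite /GRing.scale /= addrC [g x * df]mulrC.
Qed.

Lemma is_derive_scale (f : R -> R) (c x df : R) :
  is_derive x 1 f df -> is_derive x 1 (fun y => c * f y) (c * df).
Proof.
move=> hf; apply: (is_derive_conv (is_derive_mul (is_derive_cst c x 1) hf)).
by rewrite mul0r add0r.
Qed.

Lemma is_derive_expR_scale (c r : R) :
  is_derive r (1 : R) (fun t : R => expR (c * t)) (c * expR (c * r)).
Proof.
have h : is_derive r (1 : R) (fun t : R => c * t) c.
  by apply: (is_derive_conv (is_derive_scale c (is_derive_id r (1 : R)))); rewrite mulr1.
have := @is_derive1_comp _ expR (fun t : R => c * t) r _ _ (is_derive_expR _) h.
by rewrite mulrC.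
Qed.

Definition eterm (m : nat -> R) (k : nat) : R := m k / k`!%:R.

Definition eser (m : nat -> R) (t : R) : R := limn (pseries (eterm m) t).

Definition geom_bounded (m : nat -> R) :=
  exists C B : R, forall k, `|m k| <= C * B ^+ k.

Lemma geom_boundedS m : geom_bounded m -> geom_bounded (fun k => m k.+1).
Proof.
move=> [C [B h]]; exists (C * B), B => k.
by apply: le_trans (h k.+1) _; rewrite exprS mulrA.
Qed.

Lemma eser_is_cvg m t : geom_bounded m -> cvgn (pseries (eterm m) t).
Proof.
move=> [C [B h]].
have C0 : 0 <= C by have := h 0%N; rewrite expr0 mulr1; apply: le_trans.
have h2 k : `|m k| <= C * `|B| ^+ k.
  apply: le_trans (h k) _; rewrite ler_wpM2l// -normrX; exact: ler_norm.
apply: normed_cvg; rewrite /normed_series_of /=.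
apply: (@series_le_cvg _ _ (fun k => C * exp_coeff (`|B| * `|t|) k)).
- by move=> k; exact: normr_ge0.
- by move=> k; rewrite mulr_ge0// /exp_coeff /= divr_ge0// exprn_ge0// mulr_ge0.
- move=> k; rewrite /eterm /exp_coeff /= !normrM normfV normrX (ger0_norm (ler0n _ _)).
  rewrite exprMn mulrAC !mulrA ler_wpM2r ?invr_ge0//.
  by rewrite ler_wpM2r ?exprn_ge0.
rewrite (_ : series _ = fun N => C * series (exp_coeff (`|B| * `|t|)) N).
  by apply: is_cvgMr; exact: is_cvg_series_exp_coeff.
by apply/funext => N; rewrite /series /= mulr_sumr.
Qed.

Lemma pseries_diffs_eterm m : pseries_diffs (eterm m) = eterm (fun k => m k.+1).
Proof.
apply/funext => k; rewrite /pseries_diffs /eterm factS natrM invfM mulrCA.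
by rewrite mulVKf// pnatr_eq0.
Qed.

(** Differentiating an exponential series shifts its coefficients, and geometric growth is stable
    under shifts. *)
Lemma eser_derive m (t : R) : geom_bounded m ->
  is_derive t (1 : R) (eser m) (eser (fun k => m k.+1) t).
Proof.
move=> h; have := @pseries_snd_diffs _ (eterm m) (`|t| + 1) t.
rewrite !pseries_diffs_eterm; apply.
- exact: eser_is_cvg.
- exact/eser_is_cvg/geom_boundedS.
- by apply: eser_is_cvg; exact: (geom_boundedS (geom_boundedS h)).
by rewrite (ger0_norm (addr_ge0 _ _))// ltrDl.
Qed.

Lemma eser_cvg m t : geom_bounded m ->
  (fun N => \sum_(k < N) t ^+ k / k`!%:R * m k) @ \oo --> eser m t.
Proof.
move=> h; have := @eser_is_cvg m t h; rewrite /eser.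
set u := pseries _ _; have -> : u = fun N => \sum_(k < N) t ^+ k / k`!%:R * m k.
  apply/funext => N; rewrite /u /pseries /series /= big_mkord.
  by apply: eq_bigr => k _; rewrite /eterm; ring.
by [].
Qed.

End ExponentialSeries.

Section MatrixExponential.
Context {R : realType} {n : nat}.
Implicit Types (A B : V n -> V n -> R) (x y z : V n) (s t c : R).

Local Notation mpow := (@mpow R n).

Definition mexp A t x y : R :=
  limn (fun N : nat => \sum_(k < N) (t ^+ k / (k`!)%:R) * mpow A k x y).

Lemma mpowS A k x y : mpow A k.+1 x y = \sum_z mpow A k x z * A z y.
Proof. by []. Qed.

Lemma mpowSl A k x y : mpow A k.+1 x y = \sum_z A x z * mpow A k z y.
Proof.
elim: k x y => [|k IH] x y.
  rewrite mpowS /mpow /= sum_delta (eq_bigr (fun z => (y == z)%:R * A x z)).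
    by rewrite sum_delta.
  by move=> z _; rewrite eq_sym mulrC.
rewrite mpowS; under eq_bigr do rewrite IH mulr_suml.
rewrite exchange_big; apply: eq_bigr => z _; rewrite mpowS mulr_sumr.
by apply: eq_bigr => w _; rewrite mulrA.
Qed.

Lemma mpow_bounded A x y : geom_bounded (fun k => mpow A k x y).
Proof.
pose B := \sum_z \sum_y `|A z y|.
have B0 : 0 <= B by apply: sumr_ge0 => z _; apply: sumr_ge0.
exists 1, B => k; rewrite mul1r.
elim: k y => [|k IH] y; first by rewrite /mpow /= expr0; case: eqP; rewrite ?normr1 ?normr0.
rewrite mpowS; apply: le_trans (ler_norm_sum _ _ _) _.
rewrite exprSr /B mulr_sumr ler_sum// => z _; rewrite normrM ler_pM//.
by rewrite (bigD1 y)//= lerDl sumr_ge0.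
Qed.

Lemma mexpE A t x y : mexp A t x y = eser (fun k => mpow A k x y) t.
Proof. exact/cvg_lim/eser_cvg/mpow_bounded. Qed.

Lemma mexp_cvg A t x y :
  (fun N : nat => \sum_(k < N) (t ^+ k / (k`!)%:R) * mpow A k x y) @ \oo --> mexp A t x y.
Proof. by rewrite mexpE; exact/eser_cvg/mpow_bounded. Qed.

Lemma eser_lin (I : finType) (a : I -> R) (m : I -> nat -> R) t :
  (forall i, geom_bounded (m i)) -> 
  (fun N => \sum_(k < N) t ^+ k / k`!%:R * \sum_i a i * m i k) @ \oo -->
    \sum_i a i * eser (m i) t.
Proof.
move=> h.
have H := @cvg_big_sum R I (index_enum I)
  (fun i N => a i * \sum_(k < N) t ^+ k / k`!%:R * m i k) (fun i => a i * eser (m i) t)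
  (fun i => ltac:(by apply: cvgMr; exact: eser_cvg)).
apply: cvg_trans H; apply: near_eq_cvg; apply: nearW => N.
under eq_bigr do rewrite mulr_sumr; rewrite exchange_big /=.
apply: eq_bigr => k _; rewrite mulr_sumr; apply: eq_bigr => i _; ring.
Qed.

(** Kolmogorov's forward equation; the backward one follows from the same series by expanding powers
    on the left. *)
Lemma mexp_fwd A t x y :
  is_derive t (1 : R) (fun s => mexp A s x y) (\sum_z mexp A t x z * A z y).
Proof.
have -> : (fun s => mexp A s x y) = eser (fun k => mpow A k x y).
  by apply/funext => s; rewrite mexpE.
apply: (@is_derive_eq _ _ _ _ _ _ _ _ (eser_derive t (mpow_bounded A x y))).
have h : forall z, geom_bounded (fun k => mpow A k x z) := fun z => mpow_bounded A x z.
have := cvg_lim (@norm_hausdorff _ _) (@eser_lin _ (fun z => A z y) _ t h).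
have := cvg_lim (@norm_hausdorff _ _) (@eser_cvg _ _ t (geom_boundedS (mpow_bounded A x y))).
move=> <- e; rewrite (eq_bigr _ (fun z _ => congr1 (fun r => r * _) (mexpE A t x z))).
rewrite (eq_bigr _ (fun z _ => mulrC _ _)) -e; congr (lim (_ @ \oo)).
apply/funext => N; apply: eq_bigr => k _; rewrite mpowS; congr (_ * _).
by apply: eq_bigr => z _; rewrite mulrC.
Qed.

Lemma mexp_bwd A t x y :
  is_derive t (1 : R) (fun s => mexp A s x y) (\sum_z A x z * mexp A t z y).
Proof.
have -> : (fun s => mexp A s x y) = eser (fun k => mpow A k x y).
  by apply/funext => s; rewrite mexpE.
apply: (@is_derive_eq _ _ _ _ _ _ _ _ (eser_derive t (mpow_bounded A x y))).
have h : forall z, geom_bounded (fun k => mpow A k z y) := fun z => mpow_bounded A z y.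
have := cvg_lim (@norm_hausdorff _ _) (@eser_lin _ (fun z => A x z) _ t h).
have := cvg_lim (@norm_hausdorff _ _) (@eser_cvg _ _ t (geom_boundedS (mpow_bounded A x y))).
move=> <- e; rewrite (eq_bigr _ (fun z _ => congr1 (fun r => _ * r) (mexpE A t z y))).
rewrite -e; congr (lim (_ @ \oo)).
by apply/funext => N; apply: eq_bigr => k _; rewrite mpowSl.
Qed.

Lemma mexp0 A x y : mexp A 0 x y = (x == y)%:R.
Proof.
apply: cvg_lim => //; apply: cvg_near_cst; exists 1%N => // -[//|N] _ /=.
rewrite big_ord_recl big1 ?addr0 /=; first by rewrite expr0 divr1 mul1r.
by move=> i _; rewrite expr0n mul0r mul0r.
Qed.

(** The left side has zero derivative in [s] and equals the right side at [s = 0]. With [c = 0] it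
    is the semigroup law; at [s = t] it compares the exponentials of [A] and of [A] plus a multiple
    of the identity. *)
Lemma mexp_comp A B c t : (forall x y, B x y = A x y + c * (x == y)%:R) ->
  forall s x y, expR (- c * s) * \sum_z mexp B s x z * mexp A (t - s) z y = mexp A t x y.
Proof.
move=> BA s x y.
pose Z r := expR (- c * r) * \sum_z mexp B r x z * mexp A (t - r) z y.
have dA r z : is_derive r (1 : R) (fun r => mexp A (t - r) z y)
    (- \sum_w A z w * mexp A (t - r) w y).
  have h : is_derive r (1 : R) (fun r => t - r) (-1).
    by apply: is_derive_eq; rewrite add0r mul1r.
  have := @is_derive1_comp _ (fun r => mexp A r z y) (fun r => t - r) r _ _ (mexp_bwd A (t - r) z y) h.
  by rewrite mulrN1.
have dE r : is_derive r (1 : R) (fun r => expR (- c * r)) (- c * expR (- c * r)).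
  exact: is_derive_expR_scale.
have dZ r : is_derive r (1 : R) Z 0.
  apply: (is_derive_conv (is_derive_mul (dE r) (@is_derive_big_sum R _ (index_enum _)
    (fun z r => mexp B r x z * mexp A (t - r) z y) _ r
    (fun z => is_derive_mul (mexp_fwd B r x z) (dA r z))))).
  have e1 : \sum_z (\sum_w mexp B r x w * B w z) * mexp A (t - r) z y =
      \sum_z mexp B r x z * (\sum_w A z w * mexp A (t - r) w y)
      + c * \sum_z mexp B r x z * mexp A (t - r) z y.
    under eq_bigr do rewrite mulr_suml; rewrite exchange_big /=.
    rewrite mulr_sumr -big_split /=; apply: eq_bigr => z _.
    rewrite (eq_bigr (fun w => mexp B r x z * (A z w * mexp A (t - r) w y)
       + c * mexp B r x z * ((z == w)%:R * mexp A (t - r) w y))); last first.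
      by move=> w _; rewrite BA; ring.
    by rewrite big_split /= -!mulr_sumr sum_delta; ring.
  rewrite big_split /= e1.
  have -> : \sum_z mexp B r x z * - (\sum_w A z w * mexp A (t - r) w y) =
    - \sum_z mexp B r x z * (\sum_w A z w * mexp A (t - r) w y).
    by rewrite -sumrN; apply: eq_bigr => z _; rewrite mulrN.
  by ring.
have -> : expR (- c * s) * \sum_z mexp B s x z * mexp A (t - s) z y = Z s by [].
rewrite (is_derive_0_is_cst s 0 dZ) /Z mulr0 expR0 mul1r subr0.
by under eq_bigr do rewrite mexp0; rewrite sum_delta.
Qed.

Lemma mexpD A s t x y : mexp A (s + t) x y = \sum_z mexp A s x z * mexp A t z y.
Proof.
have BA u v : A u v = A u v + 0 * (u == v)%:R by rewrite mul0r addr0.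
rewrite -(mexp_comp (s + t) BA s x y) oppr0 mul0r expR0 mul1r.
by rewrite (_ : s + t - s = t)// addrC addKr.
Qed.

(** Adding a large multiple of the identity makes all entries nonnegative, so the partial sums of
    the exponential are nonnegative too. *)
Lemma mexp_ge0 A t x y : (forall u v, u != v -> 0 <= A u v) -> 0 <= t -> 0 <= mexp A t x y.
Proof.
move=> Aoff t0.
pose c := \sum_u `|A u u|.
pose B u v := A u v + c * (u == v)%:R.
have B0 u v : 0 <= B u v.
  rewrite /B; have [<-|uv] := eqVneq u v; last by rewrite mulr0 addr0 Aoff.
  rewrite mulr1 /c (bigD1 u)//=.
  have h : 0 <= \sum_(i | i != u) `|A i i| by apply: sumr_ge0.
  have := ler_norm (- A u u); rewrite normrN; lra.
have Bk k u v : 0 <= mpow B k u v.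
  elim: k v => [|k IH] v; first by rewrite /mpow /= ler0n.
  by rewrite mpowS sumr_ge0// => z _; rewrite mulr_ge0.
rewrite -(@mexp_comp A B c t (fun u v => erefl) t x y) subrr.
apply: mulr_ge0; first exact: expR_ge0.
apply: sumr_ge0 => z _; rewrite mexp0 mulr_ge0//.
apply: limr_ge; first by apply: cvgP; exact: mexp_cvg.
apply: nearW => N; apply: sumr_ge0 => k _.
by rewrite mulr_ge0// divr_ge0// exprn_ge0.
Qed.

Lemma mexp_row_sum A t x : (forall u, \sum_v A u v = 0) -> \sum_y mexp A t x y = 1.
Proof.
move=> A0; pose Z r := \sum_y mexp A r x y.
have dZ r : is_derive r (1 : R) Z 0.
  apply: (is_derive_conv (@is_derive_big_sum R _ (index_enum _) (fun y r => mexp A r x y) _ r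
    (fun y => mexp_fwd A r x y))).
  rewrite exchange_big /= big1// => z _.
  by rewrite -mulr_sumr A0 mulr0.
rewrite -/(Z t) (is_derive_0_is_cst t 0 dZ) /Z.
rewrite (eq_bigr (fun y => (x == y)%:R * 1)) ?sum_delta// => y _.
by rewrite mexp0 mulr1.
Qed.

Lemma mexpZ A s t x y : mexp A (s * t) x y = mexp (fun u v => t * A u v) s x y.
Proof.
rewrite /mexp; congr (lim (_ @ \oo)); apply/funext => N; apply: eq_bigr => k _.
have -> : mpow (fun u v => t * A u v) k x y = t ^+ k * mpow A k x y.
  elim: (k : nat) y => [|j IH] y; first by rewrite expr0 mul1r.
  rewrite !mpowS mulr_sumr; apply: eq_bigr => z _; rewrite IH exprS; ring.
by rewrite exprMn; ring.
Qed.

(** Detailed balance passes to all powers, hence to the series. *)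
Lemma mexp_reversible A (u : V n -> R) t x y :
  (forall a b, u a * A a b = u b * A b a) -> u x * mexp A t x y = u y * mexp A t y x.
Proof.
move=> h.
have hk k a b : u a * mpow A k a b = u b * mpow A k b a.
  elim: k a b => [|k IH] a b.
    by rewrite /mpow /= eq_sym; case: eqP => [->|]//; rewrite !mulr0.
  rewrite mpowS mpowSl !mulr_sumr; apply: eq_bigr => z _.
  by rewrite mulrA IH mulrAC -h; ring.
have c w x' y' : (fun N => w * \sum_(k < N) t ^+ k / k`!%:R * mpow A k x' y') @ \oo -->
    w * mexp A t x' y' by apply: cvgMr; exact: mexp_cvg.
have c1 := c (u x) x y; have c2 := c (u y) y x.
apply: (cvg_unique _ c1); first exact: norm_hausdorff.
apply: cvg_trans c2; apply: near_eq_cvg; apply: nearW => N.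
rewrite !mulr_sumr; apply: eq_bigr => k _.
by rewrite mulrCA hk mulrCA.
Qed.

End MatrixExponential.

(** * Resolvent, semigroup and reversibility of the chain with site-dependent rates *)

Section TrapChain.
Context {R : realType} {n : nat}.
Implicit Types (f g h v : V n -> R) (x y z : V n) (s t : R).

Definition lapm x y : R := lap (fun z => (z == y)%:R) x.

Lemma lapm_sym x y : lapm x y = lapm y x.
Proof.
have := lap_sym (R := R) (fun z => (y == z)%:R) (fun z => (x == z)%:R).
rewrite !sum_delta /lapm => e.
have e' w : (fun z => (z == w)%:R) = (fun z => (w == z)%:R) :> (V n -> R).
  by apply/funext => z; rewrite eq_sym.
by rewrite !e'.
Qed.

Lemma lapmE f x : \sum_y lapm x y * f y = lap f x.
Proof.
have e := lap_sym (R := R) f (fun z => (x == z)%:R).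
rewrite sum_delta in e; rewrite e; apply: eq_bigr => y _.
rewrite lapm_sym /lapm mulrC; congr (_ * lap _ _).
by apply/funext => z; rewrite eq_sym.
Qed.

Lemma lapmEr f y : \sum_x f x * lapm x y = lap f y.
Proof. by rewrite -lapmE; apply: eq_bigr => x _; rewrite lapm_sym mulrC. Qed.

Lemma lapm_off x y : x != y -> 0 <= lapm x y.
Proof.
move=> /negbTE xy; rewrite /lapm /lap xy subr0 divr_ge0// sumr_ge0// => k _; exact: ler0n.
Qed.

(** Green function of [v - lap], taken as a matrix inverse; that the matrix is invertible is shown
    in [resolventP]. *)
Definition resolvent v z x : R :=
  invmx (\matrix_(i < #|V n|, j < #|V n|)
    (v (enum_val i) * (i == j)%:R - lapm (enum_val i) (enum_val j)))
  (enum_rank z) (enum_rank x).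

(** A row vector in the kernel solves the homogeneous equation; the maximum principle applied to it
    and to its negative makes it zero. *)
Lemma resolventP v z : (forall x, 0 < v x) ->
  forall x, v x * resolvent v z x - lap (resolvent v z) x = (z == x)%:R.
Proof.
move=> v0 x; rewrite /resolvent.
set Mx := \matrix_(i, j) _.
have T (r : 'rV[R]_(#|V n|)) j : (r *m Mx) 0 j =
    v (enum_val j) * r 0 j - lap (fun x => r 0 (enum_rank x)) (enum_val j).
  rewrite mxE -lapmEr (reindex enum_rank)/=; last first.
    by exists enum_val => k _; rewrite ?enum_rankK ?enum_valK.
  rewrite (eq_bigr (fun w => (enum_val j == w)%:R * (v w * r 0 (enum_rank w))
      - r 0 (enum_rank w) * lapm w (enum_val j))).
    by rewrite sumrB sum_delta enum_valK.
  move=> w _; rewrite mxE enum_rankK mulrBr; congr (_ - _).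
  by rewrite -(can_eq enum_valK) enum_rankK eq_sym; ring.
have U : Mx \in unitmx.
  rewrite -row_free_unit -kermx_eq0; apply/eqP/row_matrixP => i.
  set r := row i (kermx Mx).
  have rM : r *m Mx = 0 by rewrite /r -row_mul mulmx_ker row0.
  pose f w := r 0 (enum_rank w).
  have fe w : v w * f w - lap f w = 0.
    have := T r (enum_rank w); rewrite rM mxE enum_rankK => /esym; exact.
  have f0 w : f w = 0.
    apply/eqP; rewrite eq_le; apply/andP; split; last first.
      by apply: (max_principle v0) => t; rewrite fe.
    rewrite -oppr_ge0; apply: (max_principle (f := fun w => - f w) v0) => t.
    have := fe t; rewrite !lapE; lra.
  by apply/rowP => j; have := f0 (enum_val j); rewrite /f enum_valK => ->; rewrite row0 mxE.
have := T (row (enum_rank z) (invmx Mx)) (enum_rank x).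
rewrite -row_mul mulVmx// row1 mxE enum_rankK mxE eqxx /=.
have -> : (enum_rank x == enum_rank z) = (z == x).
  by rewrite eq_sym (can_eq enum_rankK).
move=> ->; congr (_ - lap _ _); apply/funext => w; by rewrite mxE.
Qed.

Lemma resolvent_ge0 v z x : (forall x, 0 < v x) -> 0 <= resolvent v z x.
Proof.
move=> v0; apply: (max_principle v0) => y; by rewrite resolventP// ler0n.
Qed.

Lemma sum_resolvent v z : (forall x, 0 < v x) -> \sum_x v x * resolvent v z x = 1.
Proof.
move=> v0.
transitivity (\sum_x v x * resolvent v z x - \sum_x lap (resolvent v z) x).
  by rewrite sum_lap subr0.
rewrite -sumrB.
rewrite (eq_bigr (fun x => (z == x)%:R * 1)) ?sum_delta// => x _.
by rewrite resolventP// mulr1.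
Qed.

Context (q : V n -> R) (q0 : forall x, 0 < q x).

Definition tgen x y : R := q x * lapm x y.

Definition semi t x y : R := mexp tgen t x y.

Lemma semi_ge0 t x y : 0 <= t -> 0 <= semi t x y.
Proof.
by apply: mexp_ge0 => u w uw; rewrite mulr_ge0 ?(ltW (q0 _))// lapm_off.
Qed.

Lemma semi_row_sum t x : \sum_y semi t x y = 1.
Proof.
apply: mexp_row_sum => u; rewrite -mulr_sumr.
have := lapmE (fun=> 1) u; rewrite lap_cst.
by under eq_bigr do rewrite mulr1; move=> ->; rewrite mulr0.
Qed.

Lemma semi_le1 t x y : 0 <= t -> semi t x y <= 1.
Proof.
move=> t0; rewrite -(semi_row_sum t x) (bigD1 y)//= lerDl sumr_ge0// => z _.
exact: semi_ge0.
Qed.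

Lemma semi0 x y : semi 0 x y = (x == y)%:R.
Proof. exact: mexp0. Qed.

Lemma semiD s t x y : semi (s + t) x y = \sum_z semi s x z * semi t z y.
Proof. exact: mexpD. Qed.

Lemma semi_rev t x y : semi t x y / q x = semi t y x / q y.
Proof.
have := @mexp_reversible _ _ tgen (fun x => (q x)^-1) t x y.
rewrite ![(q _)^-1 * mexp _ _ _ _]mulrC; apply=> a b.
by rewrite /tgen lapm_sym !mulKf ?gt_eqF.
Qed.

(** By reversibility the return probability at time [2 * r] is a weighted sum of squares of
    [semi r x], and the derivative of that sum is twice a Dirichlet form. *)
Lemma semi_diag_noninc x s t : 0 <= s <= t -> semi t x x <= semi s x x.
Proof.
move=> /andP[s0 st].
have E r : semi (r + r) x x = (q x)^-1 * \sum_z q z * semi r x z ^+ 2.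
  rewrite semiD mulr_sumr; apply: eq_bigr => z _.
  have := semi_rev r x z => h.
  have -> : semi r z x = semi r x z / q x * q z by rewrite h mulfVK// gt_eqF.
  by ring.
have -> : t = t / 2 + t / 2 by field.
have -> : s = s / 2 + s / 2 by field.
rewrite !E ler_pM2l ?invr_gt0//.
pose H r := - \sum_z q z * semi r x z ^+ 2.
suff : H (s / 2) <= H (t / 2) by rewrite lerN2.
pose dS r z := \sum_w semi r x w * tgen w z.
apply: (@is_derive_ge0_le _ H (fun r => - \sum_z q z * (dS r z * semi r x z + semi r x z * dS r z))).
- lra.
- move=> r _; apply: is_deriveN; apply: is_derive_big_sum => z.
  apply: is_derive_scale; exact: (is_derive_mul (mexp_fwd _ _ _ _) (mexp_fwd _ _ _ _)).
move=> r /andP[r0 _]; rewrite oppr_ge0.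
pose F w := semi r x w * q w.
have dSE z : dS r z = lap F z.
  by rewrite -lapmEr; apply: eq_bigr => w _; rewrite /tgen mulrA.
rewrite (eq_bigr (fun z => 2 * (F z * lap F z))).
  by rewrite -mulr_sumr pmulr_rle0// dirichlet_le0.
by move=> z _; rewrite dSE /F; ring.
Qed.

(** Condition on the position [x] at time [s]: the value of [f] can change only if the chain is away
    from [x] at time [s + u], and it changes by at most 1. *)
Lemma semi_increment f z s u : 0 <= s -> 0 <= u -> (forall x, 0 <= f x <= 1) ->
  `|\sum_y semi (s + u) z y * f y - \sum_y semi s z y * f y| <=
  1 - \sum_x semi s z x * semi u x x.
Proof.
move=> s0 u0 f01.
have -> : \sum_y semi (s + u) z y * f y - \sum_y semi s z y * f y =
   \sum_x semi s z x * (\sum_y semi u x y * f y - f x).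
  rewrite (eq_bigr (fun y => \sum_x semi s z x * (semi u x y * f y))); last first.
    by move=> y _; rewrite semiD mulr_suml; apply: eq_bigr => x _; rewrite mulrA.
  rewrite exchange_big /= -sumrB; apply: eq_bigr => x _.
  by rewrite -mulr_sumr mulrBr.
rewrite -(semi_row_sum s z) -sumrB; apply: le_trans (ler_norm_sum _ _ _) _.
apply: ler_sum => x _; rewrite normrM (ger0_norm (semi_ge0 _ _ s0)).
rewrite -[X in _ <= X - _]mulr1 -mulrBr ler_wpM2l ?semi_ge0//.
rewrite (bigD1 x)//=.
have h1 : 0 <= \sum_(i | i != x) semi u x i * f i.
  by apply: sumr_ge0 => y _; rewrite mulr_ge0 ?semi_ge0//; case/andP: (f01 y).
have h2 : \sum_(i | i != x) semi u x i * f i <= 1 - semi u x x.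
  rewrite -(semi_row_sum u x) [X in _ <= X - _](bigD1 x)//= addrAC subrr add0r.
  by apply: ler_sum => y _; rewrite ler_piMr ?semi_ge0//; case/andP: (f01 y).
have h3 := semi_le1 x x u0.
have /andP[f0 f1] := f01 x.
by rewrite ler_norml; apply/andP; split; nra.
Qed.

(** Inverse of [l - tgen]: factoring out the rates, [l - q * lap = q * (l / q - lap)]. *)
Definition res (l : R) z x : R := resolvent (fun y => l / q y) z x / q x.

Lemma res_ge0 l z x : 0 < l -> 0 <= res l z x.
Proof.
by move=> l0; rewrite divr_ge0 ?(ltW (q0 _))// resolvent_ge0// => y; rewrite divr_gt0.
Qed.

Lemma sum_res l z : 0 < l -> \sum_x res l z x = l^-1.
Proof.
move=> l0; have := @sum_resolvent (fun y => l / q y) z (fun y => divr_gt0 l0 (q0 y)).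
move=> e; apply: (mulfI (lt0r_neq0 l0)); rewrite mulfV ?gt_eqF// -[RHS]e mulr_sumr.
by apply: eq_bigr => x _; rewrite /res; ring.
Qed.

Lemma resP l z y : 0 < l -> l * res l z y - \sum_w res l z w * tgen w y = (z == y)%:R.
Proof.
move=> l0; rewrite -(@resolventP (fun y => l / q y) z (fun y => divr_gt0 l0 (q0 y)) y).
congr (_ - _); first by rewrite /res; ring.
rewrite -lapmEr; apply: eq_bigr => w _; rewrite /res /tgen mulrA; congr (_ * _).
by rewrite mulfVK// gt_eqF.
Qed.

End TrapChain.

(** * A Tauberian theorem *)

Section Kernel.
Context {R : realType}.
Implicit Types (h l : R -> R) (s a b : R) (p q : nat).

(* [l] is the Laplace transform of [h : [0,oo[ -> [0,1]], witnessed by the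
   antiderivatives of [exp (- lam s) h s] that vanish at infinity. *)
Definition has_laplace h l := forall lam : R, 0 < lam -> exists Psi : R -> R,
  [/\ forall s, 0 <= s -> is_derive s 1 Psi (expR (- lam * s) * h s),
      Psi 0 = - l lam &
      forall s, 0 <= s -> `|Psi s| <= expR (- lam * s) / lam].

(* Tail of the maximum of [q] independent exponential times of rate [p]. *)
Definition ktail p q s : R := 1 - (1 - expR (- p%:R * s)) ^+ q.

Definition kcoef q (j : nat) : R := (-1) ^+ j * 'C(q, j.+1)%:R.

(** The integral of [h] against the density [- ktail'], written through the Laplace transform [l] of
    [h] at integers only. *)
Definition kmean p q l : R :=
  \sum_(j < q) kcoef q j * (p * j.+1)%:R * l (p * j.+1)%:R.

Lemma ktailE p q s :
  ktail p q s = \sum_(j < q) kcoef q j * expR (- (p * j.+1)%:R * s).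
Proof.
rewrite /ktail exprDn big_ord_recl /= expr0 bin0 mulr1n expr1n mul1r opprD addrA subrr add0r.
rewrite -sumrN; apply: eq_bigr => j _; rewrite /bump /= add1n /kcoef.
have -> : expR (- (p * j.+1)%:R * s) = expR (- p%:R * s) ^+ j.+1.
  by rewrite -expRM_natl natrM; congr expR; ring.
rewrite expr1n mul1r [(- expR _) ^+ _]exprNn -[_ *+ 'C(_, _)]mulr_natr !exprS; ring.
Qed.

(** The alternating sum is the density of a maximum of exponential times:
    [p * q * x * (1 - x)^(q - 1)] with [x = exp (- p * s)]. *)
Lemma kdens_ge0 p q s : 0 <= s ->
  0 <= \sum_(j < q) kcoef q j * (p * j.+1)%:R * expR (- (p * j.+1)%:R * s).
Proof.
move=> s0; case: q => [|q]; first by rewrite big_ord0.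
set x := expR (- p%:R * s).
have x01 : 0 <= x <= 1.
  by rewrite expR_ge0 /x expR_le1 mulNr oppr_le0 mulr_ge0.
rewrite (_ : \sum_(j < _) _ = p%:R * q.+1%:R * x * (1 - x) ^+ q).
  by rewrite !mulr_ge0 ?exprn_ge0//; lra.
rewrite exprDn mulr_sumr; apply: eq_bigr => j _; rewrite /kcoef.
have -> : expR (- (p * j.+1)%:R * s) = x ^+ j.+1.
  by rewrite /x -expRM_natl natrM; congr expR; ring.
have e : 'C(q.+1, j.+1)%:R * j.+1%:R = q.+1%:R * 'C(q, j)%:R :> R.
  by rewrite -!natrM mulnC -mul_bin_diag.
rewrite natrM [(- x) ^+ _]exprNn expr1n mul1r -[_ *+ 'C(_, _)]mulr_natr exprS.
transitivity ((-1) ^+ j * p%:R * x * x ^+ j * ('C(q.+1, j.+1)%:R * j.+1%:R)); first by ring.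
by rewrite e; ring.
Qed.

Lemma ktail_bounds p q s : 0 <= s -> 0 <= ktail p q s <= 1.
Proof.
move=> s0; rewrite /ktail.
have x01 : 0 <= 1 - expR (- p%:R * s) <= 1.
  have : expR (- p%:R * s) <= 1 by rewrite expR_le1 mulNr oppr_le0 mulr_ge0.
  have := expR_ge0 (- p%:R * s); lra.
case/andP: x01 => x0 x1.
have := exprn_ge0 q x0; have := exprn_ile1 q x0 x1; lra.
Qed.

Lemma ktail0 p q : (0 < q)%N -> ktail p q 0 = 1.
Proof. by move=> q0; rewrite /ktail mulr0 expR0 subrr expr0n gtn_eqF// subr0. Qed.

Lemma ktail_derive p q s : is_derive s 1 (ktail p q)
  (- \sum_(j < q) kcoef q j * (p * j.+1)%:R * expR (- (p * j.+1)%:R * s)).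
Proof.
have -> : ktail p q = fun s => \sum_(j < q) kcoef q j * expR (- (p * j.+1)%:R * s).
  by apply/funext => t; exact: ktailE.
apply: (is_derive_conv (@is_derive_big_sum R _ (index_enum _)
  (fun (j : 'I_q) s => kcoef q j * expR (- (p * j.+1)%:R * s)) _ s
  (fun j => is_derive_scale _ (is_derive_expR_scale _ s)))).
by rewrite -sumrN; apply: eq_bigr => j _; ring.
Qed.

Lemma ktail_noninc p q a b : 0 <= a <= b -> ktail p q b <= ktail p q a.
Proof.
move=> /andP[a0 ab]; rewrite -lerN2.
apply: (@is_derive_ge0_le _ (fun s => - ktail p q s)
  (fun s => - - \sum_(j < q) kcoef q j * (p * j.+1)%:R * expR (- (p * j.+1)%:R * s))).
- exact: ab.
- by move=> x _; apply: is_deriveN; exact: ktail_derive.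
- by move=> x /andP[ax _]; rewrite opprK kdens_ge0// (le_trans a0).
Qed.

(** The Laplace witnesses are combined with the coefficients of the density. The density is
    nonnegative, so bounds on [h] pass to the increments of the combination. *)
Lemma kmean_primitive h l p q : (0 < p)%N -> (forall s, 0 <= s -> 0 <= h s <= 1) ->
  has_laplace h l ->
  exists Psi : R -> R,
  [/\ Psi 0 = - kmean p q l,
      Psi s @[s --> +oo] --> 0,
      forall a b M, 0 <= a <= b -> (forall s, a <= s <= b -> h s <= M) ->
        Psi b - Psi a <= M * (ktail p q a - ktail p q b) &
      forall a b m, 0 <= a <= b -> (forall s, a <= s <= b -> m <= h s) ->
        m * (ktail p q a - ktail p q b) <= Psi b - Psi a].
Proof.
move=> p0 h01 hl.
have lam0 j : (0 : R) < (p * j.+1)%:R by rewrite ltr0n muln_gt0 p0.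
have /choice [Psi HPsi] : forall j : nat, exists Psi : R -> R,
    [/\ forall s, 0 <= s -> is_derive s 1 Psi (expR (- (p * j.+1)%:R * s) * h s),
      Psi 0 = - l (p * j.+1)%:R &
      forall s, 0 <= s -> `|Psi s| <= expR (- (p * j.+1)%:R * s) / (p * j.+1)%:R].
  by move=> j; exact: hl.
pose c j : R := kcoef q j * (p * j.+1)%:R.
pose K s : R := \sum_(j < q) c j * expR (- (p * j.+1)%:R * s).
pose F s : R := \sum_(j < q) c j * Psi j s.
have dF s : 0 <= s -> is_derive s 1 F (K s * h s).
  move=> s0; apply: (is_derive_conv (@is_derive_big_sum R _ (index_enum _)
    (fun j : 'I_q => fun s => c j * Psi j s) _ s (fun j => is_derive_scale (c j)
      (let: And3 d _ _ := HPsi j in d s s0)))).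
  by rewrite /K mulr_suml; apply: eq_bigr => j _; rewrite mulrA.
exists F; split.
- rewrite /F /kmean -sumrN; apply: eq_bigr => j _; have [_ -> _] := HPsi j.
  by rewrite mulrN.
- have e0 : (0 : R) = \sum_(j < q) c j * 0 by rewrite big1// => j _; rewrite mulr0.
  rewrite [X in _ --> X]e0; rewrite /F.
  have cj (j : nat) : Psi j s @[s --> +oo] --> 0.
    apply/cvgr0Pnorm_le => e e0'.
    have h1 : expR (- s) @[s --> +oo] --> (0 : R) by exact: cvgr_expR.
    have /cvgr0Pnorm_le /(_ _ e0') := h1.
    move=> H; near=> s.
    have s0 : 0 <= s by near: s; exact: nbhs_pinfty_ge.
    have [_ _ /(_ s s0)] := HPsi j; move=> /le_trans; apply.
    have : `|expR (- s)| <= e by near: s.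
    rewrite ger0_norm ?expR_ge0//; apply: le_trans.
    have l1 : 1 <= (p * j.+1)%:R :> R by rewrite ler1n muln_gt0 p0.
    rewrite ler_pdivrMr//; apply: (@le_trans _ _ (expR (- s))); last first.
      by rewrite ler_peMr// expR_ge0.
    by rewrite ler_expR mulNr lerN2 ler_peMl.
  elim: (index_enum _) => [|j r IH].
    by under eq_fun do rewrite big_nil; rewrite big_nil; exact: cvg_cst.
  under eq_fun do rewrite big_cons; rewrite big_cons; apply: cvgD => //.
  by apply: cvgMr; exact: cj.
- move=> a b M /andP[a0 ab] hM.
  rewrite -subr_ge0 (_ : _ - _ = (- M * ktail p q b - F b) - (- M * ktail p q a - F a)); last by ring.
  rewrite subr_ge0.
  apply: (@is_derive_ge0_le _ (fun s => - M * ktail p q s - F s)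
    (fun s => - M * - K s - K s * h s)); first exact: ab.
    move=> x /andP[ax xb]; apply: is_deriveB; last by apply: dF; exact: le_trans ax.
    by apply: is_derive_scale; exact: ktail_derive.
  move=> x /andP[ax xb].
  have K0 : 0 <= K x by apply: kdens_ge0; exact: le_trans ax.
  have := hM x; rewrite ax xb => /(_ isT) hx.
  by rewrite mulrNN mulrC -mulrBr mulr_ge0// subr_ge0.
- move=> a b m /andP[a0 ab] hm.
  rewrite -subr_ge0 (_ : _ - _ = (m * ktail p q b + F b) - (m * ktail p q a + F a)); last by ring.
  rewrite subr_ge0.
  apply: (@is_derive_ge0_le _ (fun s => m * ktail p q s + F s)
    (fun s => m * - K s + K s * h s)); first exact: ab.
    move=> x /andP[ax xb]; apply: is_deriveD; last by apply: dF; exact: le_trans ax.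
    by apply: is_derive_scale; exact: ktail_derive.
  move=> x /andP[ax xb].
  have K0 : 0 <= K x by apply: kdens_ge0; exact: le_trans ax.
  have := hm x; rewrite ax xb => /(_ isT) hx.
  by rewrite mulrN addrC mulrC -mulrBl mulr_ge0// subr_ge0.
Unshelve. all: by end_near. Qed.

(** Outside [[a, b]] the kernel has mass [1 - ktail p q a] on the left and [ktail p q b] on the
    right, and there [h <= 1] is used. *)
Lemma kmean_le h l p q a b M : (0 < p)%N -> (0 < q)%N ->
  (forall s, 0 <= s -> 0 <= h s <= 1) -> has_laplace h l ->
  0 <= a <= b -> (forall s, a <= s <= b -> h s <= M) ->
  kmean p q l <= M * (ktail p q a - ktail p q b) + (1 - ktail p q a) + ktail p q b.
Proof.
move=> p0 q0 h01 hl /andP[a0 ab] hM.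
have [F [F0 Fy Fu _]] := @kmean_primitive h l p q p0 h01 hl.
have h1 := Fu a b M _ hM; rewrite a0 ab in h1.
have := Fu 0 a 1; rewrite lexx a0 => /(_ isT) h2.
have {}h2 := h2 (fun s hs => proj2 (andP (h01 s (proj1 (andP hs))))).
have b0 := le_trans a0 ab.
have h3 S : b <= S -> F S <= F b + ktail p q b.
  move=> bS; have := Fu b S 1; rewrite b0 bS => /(_ isT).
  move=> /(_ (fun s hs => proj2 (andP (h01 s (le_trans b0 (proj1 (andP hs))))))).
  have /andP[] := @ktail_bounds p q S (le_trans b0 bS); lra.
have h4 : 0 <= F b + ktail p q b.
  rewrite -(cvg_lim (@norm_hausdorff _ _) Fy); apply: limr_le; first exact: (cvgP _ Fy).
  by near=> S; apply: h3; near: S; apply: nbhs_pinfty_ge; exact: num_real.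
have := h1 isT; have := ktail0 p q0; lra.
Unshelve. all: by end_near. Qed.

Lemma kmean_ge h l p q a b m : (0 < p)%N ->
  (forall s, 0 <= s -> 0 <= h s <= 1) -> has_laplace h l ->
  0 <= a <= b -> (forall s, a <= s <= b -> m <= h s) ->
  m * (ktail p q a - ktail p q b) <= kmean p q l.
Proof.
move=> p0 h01 hl /andP[a0 ab] hm.
have [F [F0 Fy _ Fl]] := @kmean_primitive h l p q p0 h01 hl.
have h1 := Fl a b m _ hm; rewrite a0 ab in h1.
have := Fl 0 a 0; rewrite lexx a0 => /(_ isT).
move=> /(_ (fun s hs => proj1 (andP (h01 s (proj1 (andP hs)))))) h2.
have b0 := le_trans a0 ab.
have h3 S : b <= S -> F b <= F S.
  move=> bS; have := Fl b S 0; rewrite b0 bS => /(_ isT).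
  move=> /(_ (fun s hs => proj1 (andP (h01 s (le_trans b0 (proj1 (andP hs))))))); lra.
have h4 : F b <= 0.
  rewrite -(cvg_lim (@norm_hausdorff _ _) Fy); apply: limr_ge; first exact: (cvgP _ Fy).
  by near=> S; apply: h3; near: S; apply: nbhs_pinfty_ge; exact: num_real.
have := h1 isT; lra.
Unshelve. all: by end_near. Qed.

Lemma bernoulli_pow (x : R) q : 0 <= x <= 1 -> 1 - (1 - x) ^+ q <= q%:R * x.
Proof.
move=> /andP[x0 x1]; elim: q => [|q IH]; first by rewrite expr0 subrr mul0r.
have := exprn_ge0 q (_ : 0 <= 1 - x); rewrite subr_ge0 => /(_ x1) e0.
have e1 := exprn_ile1 q (_ : 0 <= 1 - x) (_ : 1 - x <= 1).
have {}e1 : (1 - x) ^+ q <= 1 by apply: e1; lra.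
rewrite exprS -natr1; nra.
Qed.

(** The maximum of [q] exponential times of rate [p] concentrates at [ln q / p] with width of order
    [1 / p]. Hence [p] is large against [1 / (e * d)], and [q] is close to [exp (p * s0)]. *)
Lemma kernel_exists (s0 d e : R) : 0 < d -> d <= s0 -> 0 < e ->
  exists p q, [/\ (0 < p)%N, (0 < q)%N, ktail p q (s0 + d) <= e &
                  1 - e <= ktail p q (s0 - d)].
Proof.
move=> d0 ds0 e0.
pose p := (Num.truncn (2 / (e * d))).+1.
pose q := (Num.truncn (expR (p%:R * s0))).+1.
have p0 : (0 : R) < p%:R by rewrite ltr0n.
have pe : 2 * expR (- (p%:R * d)) <= e.
  have := @truncnS_gt R (2 / (e * d)); rewrite -/p => hp.
  have : 2 / (e * d) < p%:R by [].
  rewrite ltr_pdivrMr ?mulr_gt0// => h.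
  rewrite expRN -[leLHS]/(2 / _) ler_pdivrMr ?expR_gt0//.
  have := expR_ge1Dx (p%:R * d); nra.
have q1 : expR (p%:R * s0) <= q%:R by exact/ltW/truncnS_gt.
have q2 : q%:R <= 2 * expR (p%:R * s0).
  have : (Num.truncn (expR (p%:R * s0)))%:R <= expR (p%:R * s0).
    by rewrite truncn_le ?expR_ge0.
  have : 1 <= expR (p%:R * s0) by rewrite -expR0 ler_expR mulr_ge0// ?(ltW p0)// (le_trans (ltW d0)).
  rewrite /q -natr1; lra.
exists p, q; split => //.
- apply: le_trans pe; rewrite /ktail; apply: le_trans (bernoulli_pow _ _) _.
    rewrite expR_ge0 expR_le1 mulNr oppr_le0 mulr_ge0 ?(ltW p0)//; lra.
  apply: le_trans (ler_wpM2r (expR_ge0 _) q2) _.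
  rewrite -mulrA -expRD; rewrite (_ : _ + _ = - (p%:R * d))//; ring.
- apply: le_trans (lerB (lexx 1) pe) _; rewrite /ktail lerD2l lerN2.
  set x := expR (- p%:R * (s0 - d)).
  have x1 : x <= 1 by rewrite expR_le1 mulNr oppr_le0 mulr_ge0 ?(ltW p0)//; lra.
  have h1 : 1 - x <= expR (- x) by have := expR_ge1Dx (- x); lra.
  apply: (@le_trans _ _ (expR (- x) ^+ q)).
    by rewrite lerXn2r ?nnegrE ?expR_ge0 ?subr_ge0.
  rewrite -expRM_natl.
  have h2 : expR (p%:R * d) <= q%:R * x.
    apply: le_trans (ler_wpM2r (expR_ge0 _) q1).
    by rewrite -expRD (_ : _ + _ = p%:R * d)//; ring.
  have h3 := expR_ge1Dx (p%:R * d).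
  apply: (@le_trans _ _ (expR (- (p%:R * d)))); first by rewrite ler_expR; lra.
  have := expR_ge0 (- (p%:R * d)); lra.
Qed.

End Kernel.

(** * Uniform Laplace inversion for monotone functions *)

Section Tauberian.
Context {R : realType}.
Implicit Types (h l : R -> R) (p q : nat).

Lemma has_laplace_expR (w : R) : 0 <= w ->
  has_laplace (fun s => expR (- w * s)) (fun m => (m + w)^-1).
Proof.
move=> w0 m m0; have mw : 0 < m + w by rewrite ltr_wpDr.
exists (fun s => - (m + w)^-1 * expR (- (m + w) * s)); split.
- move=> s s0; apply: (is_derive_conv (is_derive_scale _ (is_derive_expR_scale (- (m + w)) s))).
  rewrite -expRD mulrA mulrNN mulVf ?gt_eqF// mul1r; congr expR; ring.
- by rewrite mulr0 expR0 mulr1.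
move=> s s0; rewrite normrM normrN !ger0_norm ?expR_ge0 ?invr_ge0 ?(ltW mw)// mulrC.
rewrite ler_pM ?expR_ge0 ?invr_ge0 ?(ltW mw)//.
  by rewrite ler_expR !mulNr lerN2 ler_wpM2r// lerDl.
by rewrite lef_pV2 ?posrE// lerDl.
Qed.

Lemma kmean_dist p q l l' (e : R) : 
  (forall i, (0 < i <= p * q)%N -> `|l i%:R - l' i%:R| <= e) -> (0 < p)%N ->
  `|kmean p q l - kmean p q l'| <= (\sum_(j < q) `|kcoef q j * (p * j.+1)%:R : R|) * e.
Proof.
move=> h p0; rewrite /kmean -sumrB mulr_suml; apply: le_trans (ler_norm_sum _ _ _) _.
apply: ler_sum => j _; rewrite -mulrBr normrM ler_wpM2l// h//.
by rewrite muln_gt0 p0 /= leq_pmul2l.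
Qed.

Lemma expR_lipschitz (x y : R) : 0 <= x -> 0 <= y -> expR (- x) - expR (- (x + y)) <= y.
Proof.
move=> x0 y0; have h1 : expR (- x) <= 1 by rewrite expR_le1 oppr_le0.
have h2 := expR_ge1Dx (- y); have h3 := expR_ge0 (- x).
rewrite opprD expRD.
have h4 : expR (- y) <= 1 by rewrite expR_le1 oppr_le0.
nra.
Qed.

Lemma kernel_upper (M x y k e : R) : 0 <= M -> 1 - e <= x <= 1 -> 0 <= y <= e ->
  k <= M * (x - y) + (1 - x) + y -> k <= M + 2 * e.
Proof.
move=> M0 /andP[x0 x1] /andP[y0 y1].
have : M * (x - y) <= M by rewrite ler_piMr//; lra.
lra.
Qed.

Lemma kernel_lower (m z k e : R) : m <= 1 -> 1 - e <= z <= 1 -> m * z <= k -> m - e <= k.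
Proof.
move=> m1 /andP[z0 z1]; have : m * (1 - z) <= 1 * (1 - z) by rewrite ler_wpM2r// subr_ge0.
lra.
Qed.

(** A kernel supported mostly on [[th, th + 2 * d]] bounds [h th] from below, one on
    [[th - 2 * d, th]] from above. The numbers [m] and [d] are fixed before [h] and [w], so that one
    [n] serves all deep traps. *)
Lemma tauber_monotone (th W e : R) : 0 < th -> 0 <= W -> 0 < e ->
  exists (m : nat) (d : R), 0 < d /\ forall h l w,
    has_laplace h l -> (forall s, 0 <= s -> 0 <= h s <= 1) ->
    (forall s t, 0 <= s <= t -> h t <= h s) -> 0 <= w <= W ->
    (forall i, (0 < i <= m)%N -> `|l i%:R - (i%:R + w)^-1| <= d) ->
    `|h th - expR (- w * th)| <= e.
Proof.
move=> th0 W0 e0.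
(* With this [d] the exponential of rate at most [W] varies by at most [e / 4] over a time [2 * d],
   and both windows stay in [[0, +oo[]. *)
pose d := Num.min (th / 2) (e / (8 * (W + 1))).
have W1 : 0 < 8 * (W + 1) by rewrite mulr_gt0// ltr_wpDl.
have d0 : 0 < d by rewrite lt_min !divr_gt0.
have dth : d <= th / 2 by rewrite ge_min lexx.
have dW : 2 * d * W <= e / 4.
  have : d <= e / (8 * (W + 1)) by rewrite ge_min lexx orbT.
  rewrite ler_pdivlMr//; lra.
have e12 : 0 < e / 12 by rewrite divr_gt0.
have [p1 [q1 [p10 q10 tb1 ta1]]] := @kernel_exists R (th + d) d (e / 12) d0 (ltac:(lra)) e12.
have [p2 [q2 [p20 q20 tb2 ta2]]] := @kernel_exists R (th - d) d (e / 12) d0 (ltac:(lra)) e12.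
rewrite addrK in ta1; rewrite subrK in tb2.
pose K1 : R := \sum_(j < q1) `|kcoef q1 j * (p1 * j.+1)%:R : R|.
pose K2 : R := \sum_(j < q2) `|kcoef q2 j * (p2 * j.+1)%:R : R|.
have K10 : 0 <= K1 by apply: sumr_ge0.
have K20 : 0 <= K2 by apply: sumr_ge0.
have K0 : 0 < K1 + K2 + 1 by lra.
exists (maxn (p1 * q1) (p2 * q2)), (e / 4 / (K1 + K2 + 1)); split; first by rewrite !divr_gt0.
set D := e / 4 / _; move=> h l w hl h01 hmon /andP[w0 wW] hlD.
have D0 : 0 < D by rewrite /D !divr_gt0.
have KD : (K1 + K2 + 1) * D = e / 4 by rewrite /D; field; rewrite gt_eqF.
have hw := has_laplace_expR w0.
have hw01 s : 0 <= s -> 0 <= expR (- w * s) <= 1.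
  by move=> s0; rewrite expR_ge0 expR_le1 mulNr oppr_le0 mulr_ge0.
have c1 := @kmean_dist p1 q1 l (fun m => (m + w)^-1) D _ p10.
have {}c1 : `|kmean p1 q1 l - kmean p1 q1 (fun m => (m + w)^-1)| <= K1 * D.
  by apply: c1 => i /andP[i0 i1]; apply: hlD; rewrite i0 leq_max i1.
have c2 := @kmean_dist p2 q2 l (fun m => (m + w)^-1) D _ p20.
have {}c2 : `|kmean p2 q2 l - kmean p2 q2 (fun m => (m + w)^-1)| <= K2 * D.
  by apply: c2 => i /andP[i0 i1]; apply: hlD; rewrite i0 leq_max i1 orbT.
have K1D : K1 * D <= e / 4 by rewrite -KD ler_wpM2r ?(ltW D0)//; lra.
have K2D : K2 * D <= e / 4 by rewrite -KD ler_wpM2r ?(ltW D0)//; lra.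
have /andP[hth0 hth1] := h01 th (ltW th0).
have thb : th + d + d = th + 2 * d by ring.
rewrite thb in tb1.
have tha : th - d - d = th - 2 * d by ring.
rewrite tha in ta2.
have a1 : kmean p1 q1 l <= h th + e / 6.
  have := @kmean_le R h l p1 q1 th (th + 2 * d) (h th) p10 q10 h01 hl.
  have -> : 0 <= th <= th + 2 * d by lra.
  move=> /(_ isT) /(_ (fun s hs => hmon th s (ltac:(lra)))).
  have /andP[_ t1] := @ktail_bounds R p1 q1 th (ltW th0).
  have /andP[t2 _] := @ktail_bounds R p1 q1 (th + 2 * d) (ltac:(lra)).
  have -> : e / 6 = 2 * (e / 12) by field.
  by apply: kernel_upper => //; rewrite ?ta1 ?t1 ?t2.
have ex s t : 0 <= s <= t -> expR (- w * t) <= expR (- w * s).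
  by move=> /andP[? ?]; rewrite ler_expR !mulNr lerN2 ler_wpM2l.
have a2 : expR (- w * (th + 2 * d)) - e / 12 <= kmean p1 q1 (fun m => (m + w)^-1).
  have := @kmean_ge R _ _ p1 q1 0 (th + 2 * d) (expR (- w * (th + 2 * d))) p10 hw01 hw.
  have -> : 0 <= (0 : R) <= th + 2 * d by lra.
  move=> /(_ isT) /(_ (fun s hs => ex s (th + 2 * d) hs)).
  rewrite ktail0//.
  have /andP[_ t1] := hw01 (th + 2 * d) (ltac:(lra)).
  have /andP[t2 _] := @ktail_bounds R p1 q1 (th + 2 * d) (ltac:(lra)).
  by apply: kernel_lower => //; rewrite lerD2l lerN2 tb1 gerBl.
have a3 : h th - e / 12 <= kmean p2 q2 l.
  have := @kmean_ge R _ _ p2 q2 0 th (h th) p20 h01 hl.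
  rewrite lexx (ltW th0) => /(_ isT) /(_ (fun s hs => hmon s th (ltac:(lra)))).
  rewrite ktail0//.
  have /andP[t2 _] := @ktail_bounds R p2 q2 th (ltac:(lra)).
  by apply: kernel_lower => //; rewrite lerD2l lerN2 tb2 gerBl.
have a4 : kmean p2 q2 (fun m => (m + w)^-1) <= expR (- w * (th - 2 * d)) + e / 6.
  have := @kmean_le R _ _ p2 q2 (th - 2 * d) th (expR (- w * (th - 2 * d))) p20 q20 hw01 hw.
  have -> : 0 <= th - 2 * d <= th by lra.
  move=> /(_ isT) /(_ (fun s hs => ex (th - 2 * d) s (ltac:(lra)))).
  have /andP[t1 _] := hw01 (th - 2 * d) (ltac:(lra)).
  have /andP[t2 _] := @ktail_bounds R p2 q2 th (ltW th0).
  have /andP[_ t3] := @ktail_bounds R p2 q2 (th - 2 * d) (ltac:(lra)).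
  have -> : e / 6 = 2 * (e / 12) by field.
  by apply: kernel_upper => //; rewrite ?ta2 ?t2 ?t3.
have wd0 : 0 <= w * (2 * d) by rewrite !mulr_ge0// ltW.
have wd : w * (2 * d) <= e / 4.
  by apply: le_trans dW; rewrite [w * _]mulrC ler_pM2l// mulr_gt0.
have l1 : expR (- w * th) - expR (- w * (th + 2 * d)) <= e / 4.
  have := @expR_lipschitz (w * th) (w * (2 * d)) (mulr_ge0 w0 (ltW th0)) wd0.
  by rewrite -mulrDr !mulNr => /le_trans; apply.
have l2 : expR (- w * (th - 2 * d)) - expR (- w * th) <= e / 4.
  have t0 : 0 <= th - 2 * d by lra.
  have := @expR_lipschitz (w * (th - 2 * d)) (w * (2 * d)) (mulr_ge0 w0 t0) wd0.
  by rewrite -mulrDr subrK !mulNr => /le_trans; apply.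
move: c1 c2; rewrite !ler_norml => /andP[? ?] /andP[? ?].
apply/andP; split; lra.
Qed.

End Tauberian.


Section TauberianIncrement.
Context {R : realType}.
Implicit Types (h l : R -> R) (p q : nat).

(* The increments in [s] are controlled by the value of [F] itself at short
   times, which turns convergence of Laplace transforms into pointwise
   convergence. *)
Lemma tauber_increment (F : nat -> R -> R -> R) (l : nat -> R -> R -> R)
    (E Hc : R -> R) (th : R) :
  0 < th ->
  (forall n s t, 0 <= s -> 0 <= t -> 0 <= F n s t <= 1) ->
  (forall n s t t', 0 <= s -> 0 <= t <= t' -> F n s t' <= F n s t) ->
  (forall n s u t, 0 <= s -> 0 <= u -> 0 <= t ->
    `|F n (s + u) t - F n s t| <= 1 - F n s u) ->
  (forall n t, 0 < t -> has_laplace (F n ^~ t) (l n t)) ->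
  (forall t i, 0 < t -> (0 < i)%N -> l n t i%:R @[n --> \oo] --> E (i%:R * t) / i%:R) ->
  (forall p q t y, (0 < p)%N -> (0 < q)%N -> 0 < t -> 0 < y ->
    Hc y * ktail p q (t * y) <= \sum_(j < q) kcoef q j * E ((p * j.+1)%:R * t) <=
    Hc y + ktail p q (t * y)) ->
  (forall y, 0 <= Hc y <= 1) ->
  {for th^-1, continuous Hc} -> Hc y @[y --> +oo] --> (1 : R) ->
  F n 1 th @[n --> \oo] --> Hc th^-1.
Proof.
move=> th0 F01 Fmon Finc Flap lim mix Hc01 Hcont Hinf.
have klim p q t : (0 < p)%N -> 0 < t -> kmean p q (l n t) @[n --> \oo] -->
    \sum_(j < q) kcoef q j * E ((p * j.+1)%:R * t).
  move=> p0 t0; apply: cvg_big_sum => j.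
  have m0 : (0 < p * j.+1)%N by rewrite muln_gt0 p0.
  rewrite (_ : kcoef q j * E _ = kcoef q j * (p * j.+1)%:R *
    (E ((p * j.+1)%:R * t) / (p * j.+1)%:R)); first by apply: cvgMr; exact: lim.
  by rewrite -mulrA [X in _ = _ * X]mulrC mulfVK// pnatr_eq0 -lt0n.
apply/cvgrPdist_le => e0 e00.
pose e := Num.min (e0 / 20) (1 / 16).
have e_gt0 : 0 < e by rewrite lt_min !divr_gt0.
have e16 : e <= 1 / 16 by rewrite ge_min lexx orbT.
have e20 : 20 * e <= e0.
  have : e <= e0 / 20 by rewrite ge_min lexx.
  lra.
have [Y [Y0 HY]] : exists Y, 0 < Y /\ forall y, Y <= y -> 1 - e <= Hc y.
  have /cvgrPdist_le /(_ _ e_gt0) [Y [Yr HY]] := Hinf.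
  exists (Num.max 1 (Y + 1)); split; first by rewrite lt_max ltr01.
  move=> y; rewrite ge_max => /andP[_ y1]; have := HY y (ltac:(lra)).
  by rewrite ler_norml => /andP[? ?]; lra.
(* Short second time: near [s = 1] the ratio [s / d0] exceeds [Y], so the expected limit
   [Hc (s / d0)] is within [e] of 1. *)
pose d0 := Num.min (1 / 2) (1 / (2 * Y)).
have d00 : 0 < d0 by rewrite lt_min !divr_gt0// mulr_gt0.
have d02 : d0 <= 1 / 2 by rewrite ge_min lexx.
have d0Y : 2 * (d0 * Y) <= 1.
  have : d0 <= 1 / (2 * Y) by rewrite ge_min lexx orbT.
  rewrite ler_pdivlMr ?mulr_gt0//; lra.
have [d1 [d10 Hd1]] : exists d1, 0 < d1 /\ forall y, `|th^-1 - y| < d1 ->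
    `|Hc th^-1 - Hc y| <= e.
  have /cvgrPdist_le /(_ _ e_gt0) [d1 /= d10 HY'] := Hcont.
  by exists d1; split => // y hy; apply: HY'.
pose d := Num.min (d0 / 4) (d1 * th / 4).
have dd : 0 < d by rewrite lt_min !divr_gt0// mulr_gt0.
have dd0 : 4 * d <= d0.
  have : d <= d0 / 4 by rewrite ge_min lexx.
  lra.
have dd1 : 2 * d / th < d1.
  have : d <= d1 * th / 4 by rewrite ge_min lexx orbT.
  by rewrite ltr_pdivrMr// => ?; have := mulr_gt0 d10 th0; lra.
have [p1 [q1 [p10 q10 tb1 ta1]]] := @kernel_exists R (1 - d) d e dd (ltac:(lra)) e_gt0.
have [p2 [q2 [p20 q20 tb2 ta2]]] := @kernel_exists R (1 + d) d e dd (ltac:(lra)) e_gt0.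
rewrite subrK in tb1; rewrite addrK in ta2.
have Phi1 : 1 - 2 * e <= \sum_(j < q1) kcoef q1 j * E ((p1 * j.+1)%:R * d0).
  pose y := (1 - d - d) / d0.
  have y0 : 0 < y by rewrite divr_gt0//; lra.
  have /andP[+ _] := mix p1 q1 d0 y p10 q10 d00 y0.
  have -> : d0 * y = 1 - d - d by rewrite /y mulrC divfK// gt_eqF.
  have : 1 - e <= Hc y by apply: HY; rewrite /y ler_pdivlMr//; lra.
  have /andP[_ h1] := Hc01 y => h2 h3.
  have : Hc y - e <= \sum_(j < q1) kcoef q1 j * E ((p1 * j.+1)%:R * d0).
    apply: kernel_lower h1 _ h3; rewrite ta1 /=.
    by have /andP[] := @ktail_bounds R p1 q1 (1 - d - d) (ltac:(lra)).
  by lra.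
have Phi2 : `|\sum_(j < q2) kcoef q2 j * E ((p2 * j.+1)%:R * th) - Hc th^-1| <= 2 * e.
  have ith : 0 < th^-1 by rewrite invr_gt0.
  have /andP[h1 _] := mix p2 q2 th th^-1 p20 q20 th0 ith.
  rewrite mulfV ?gt_eqF// in h1.
  have y0 : 0 < (1 + d + d) / th by rewrite divr_gt0//; lra.
  have /andP[_ h2] := mix p2 q2 th _ p20 q20 th0 y0.
  rewrite [th * _]mulrC divfK ?gt_eqF// in h2.
  have := Hd1 ((1 + d + d) / th).
  have -> : th^-1 - (1 + d + d) / th = - (2 * d / th) by ring.
  rewrite normrN ger0_norm ?divr_ge0 ?mulr_ge0 ?(ltW dd) ?(ltW th0)// dd1 => /(_ isT).
  rewrite ler_norml => /andP[h3 h4].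
  have /andP[_ h5] := Hc01 th^-1.
  have h6 : Hc th^-1 - e <= \sum_(j < q2) kcoef q2 j * E ((p2 * j.+1)%:R * th).
    apply: kernel_lower h5 _ h1; rewrite ta2 /=.
    by have /andP[] := @ktail_bounds R p2 q2 1 ler01.
  by rewrite ler_norml; apply/andP; split; lra.
have /cvgrPdist_le /(_ _ e_gt0) k1 := klim p1 q1 d0 p10 d00.
have /cvgrPdist_le /(_ _ e_gt0) k2 := klim p2 q2 th p20 th0.
near=> n.
have : `|\sum_(j < q1) kcoef q1 j * E ((p1 * j.+1)%:R * d0) - kmean p1 q1 (l n d0)| <= e.
  by near: n.
have : `|\sum_(j < q2) kcoef q2 j * E ((p2 * j.+1)%:R * th) - kmean p2 q2 (l n th)| <= e.
  by near: n.
move: Phi2; rewrite !ler_norml => /andP[? ?] /andP[n1 n2] /andP[n3 n4].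
(* Averaging: the kernel mean over [[1 - 2 * d, 1]] is at least [1 - 3 * e], which is impossible if
   all values there are at most [1 - 6 * e]. *)
have [s [sa sb Fs]] : exists s, [/\ 1 - 2 * d <= s, s <= 1 & 1 - 6 * e < F n s d0].
  apply: contrapT => nex.
  have all s : 1 - 2 * d <= s <= 1 -> F n s d0 <= 1 - 6 * e.
    move=> /andP[s1 s2]; rewrite leNgt; apply/negP => ?; apply: nex.
    by exists s.
  have := @kmean_le R (F n ^~ d0) (l n d0) p1 q1 (1 - 2 * d) 1 (1 - 6 * e) p10 q10
    (fun s s0 => F01 n s d0 s0 (ltW d00)) (Flap n d0 d00).
  have -> : 0 <= 1 - 2 * d <= 1 by lra.
  move=> /(_ isT all).
  have : 1 - d - d = 1 - 2 * d by ring.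
  move=> e1; rewrite e1 in ta1.
  set x := ktail p1 q1 (1 - 2 * d) in ta1 *; set z := ktail p1 q1 1 in tb1 * => up.
  have : e * (1 - 2 * e) <= e * (x - z) by rewrite ler_pM2l//; lra.
  have : e * e <= e * (1 / 8) by rewrite ler_pM2l//; lra.
  by lra.
have s0 : 0 <= s by lra.
have inc u : 0 <= u <= d0 -> `|F n (s + u) th - F n s th| <= 6 * e.
  move=> /andP[u0 ud]; have := Finc n s u th s0 u0 (ltW th0).
  have := Fmon n s u d0 s0; rewrite u0 ud => /(_ isT); lra.
(* Both [r] and 1 lie in [[s, s + d0]], because [s >= 1 - 2 * d] and [4 * d <= d0]; they are
   compared through [s]. *)
have win r : 1 <= r <= 1 + 2 * d -> `|F n r th - F n 1 th| <= 12 * e.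
  move=> /andP[r1 r2].
  have := inc (r - s) (ltac:(lra)); have := inc (1 - s) (ltac:(lra)).
  rewrite ![s + _]addrC !subrK !ler_norml => /andP[? ?] /andP[? ?].
  by apply/andP; split; lra.
have /andP[F0 F1] := F01 n 1 th ler01 (ltW th0).
have e2 : 1 + d + d = 1 + 2 * d by ring.
rewrite e2 in tb2.
have /andP[_ t1] := @ktail_bounds R p2 q2 1 ler01.
have /andP[t2 _] := @ktail_bounds R p2 q2 (1 + 2 * d) (ltac:(lra)).
have up : kmean p2 q2 (l n th) <= F n 1 th + 14 * e.
  have := @kmean_le R (F n ^~ th) (l n th) p2 q2 1 (1 + 2 * d) (F n 1 th + 12 * e) p20 q20
    (fun s s0 => F01 n s th s0 (ltW th0)) (Flap n th th0).
  have -> : 0 <= (1 : R) <= 1 + 2 * d by lra.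
  move=> /(_ isT) H.
  have := H (fun r hr => ltac:(by have := win r hr; rewrite ler_norml => /andP[? ?]; lra)).
  have M0 : 0 <= F n 1 th + 12 * e by lra.
  have -> : F n 1 th + 14 * e = F n 1 th + 12 * e + 2 * e by ring.
  by apply: kernel_upper => //; rewrite ?ta2 ?t1 ?t2.
have lo : F n 1 th - 14 * e <= kmean p2 q2 (l n th).
  have := @kmean_ge R (F n ^~ th) (l n th) p2 q2 1 (1 + 2 * d) (F n 1 th - 12 * e) p20
    (fun s s0 => F01 n s th s0 (ltW th0)) (Flap n th th0).
  have -> : 0 <= (1 : R) <= 1 + 2 * d by lra.
  move=> /(_ isT) H.
  have := H (fun r hr => ltac:(by have := win r hr; rewrite ler_norml => /andP[? ?]; lra)).
  have m1 : F n 1 th - 12 * e <= 1 by lra.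
  have -> : F n 1 th - 14 * e = F n 1 th - 12 * e - 2 * e by ring.
  by apply: kernel_lower => //; apply/andP; split; lra.
by apply/andP; split; lra.
Unshelve. all: by end_near. Qed.

End TauberianIncrement.

Section ChainLaplace.
Context {R : realType} {n : nat} (q : V n -> R) (q0 : forall x, 0 < q x).

(** The antiderivative is [- exp (- l * s)] times the resolvent row paired with the semigroup
    applied to [f]. Its derivative comes from the resolvent equation, its bound from the total mass
    [1 / l] of the row. *)
Lemma semi_has_laplace (z : V n) (f : V n -> R) : (forall x, 0 <= f x <= 1) ->
  has_laplace (fun s => \sum_y semi q s z y * f y) (fun l => \sum_y res q l z y * f y).
Proof.
move=> f01 l l0.
pose S s w := \sum_y semi q s w y * f y.
have dS s w : is_derive s (1 : R) (S ^~ w) (\sum_x tgen q w x * S s x).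
  apply: (is_derive_conv (@is_derive_big_sum R _ (index_enum _) (fun y s => semi q s w y * f y) _ s
    (fun y => is_derive_mul (mexp_bwd (tgen q) s w y) (is_derive_cst (f y) s 1)))).
  under eq_bigr do rewrite mulr0 addr0 mulr_suml; rewrite exchange_big /=.
  apply: eq_bigr => x _; rewrite mulr_sumr; apply: eq_bigr => y _; by rewrite mulrA.
exists (fun s => (-1 * expR (- l * s)) * \sum_w res q l z w * S s w); split.
- move=> s s0.
  apply: (is_derive_conv (is_derive_mul (is_derive_scale (-1) (is_derive_expR_scale (- l) s))
    (@is_derive_big_sum R _ (index_enum _) (fun w s => res q l z w * S s w) _ s
     (fun w => is_derive_scale (res q l z w) (dS s w))))).
  rewrite -/(S s z).
  have -> : S s z = \sum_y (l * res q l z y - \sum_w res q l z w * tgen q w y) * S s y.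
    by under eq_bigr do rewrite resP//; rewrite sum_delta.
  under [in RHS]eq_bigr do rewrite mulrBl; rewrite sumrB.
  have -> : \sum_i (\sum_w res q l z w * tgen q w i) * S s i =
     \sum_w res q l z w * \sum_x tgen q w x * S s x.
    under eq_bigr do rewrite mulr_suml; rewrite exchange_big /=.
    by apply: eq_bigr => w _; rewrite mulr_sumr; apply: eq_bigr => x _; rewrite mulrA.
  have -> : \sum_i l * res q l z i * S s i = l * \sum_w res q l z w * S s w.
    by rewrite mulr_sumr; apply: eq_bigr => w _; rewrite mulrA.
  by ring.
- rewrite mulr0 expR0 mulr1 mulN1r; congr (- _); apply: eq_bigr => w _; congr (_ * _).
  by rewrite /S; under eq_bigr do rewrite semi0; rewrite sum_delta.
move=> s s0; rewrite mulN1r mulNr normrN normrM ger0_norm ?expR_ge0// ler_wpM2l ?expR_ge0//.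
have S01 w : 0 <= S s w <= 1.
  apply/andP; split.
    by apply: sumr_ge0 => y _; rewrite mulr_ge0 ?semi_ge0//; case/andP: (f01 y).
  rewrite -(semi_row_sum q s w); apply: ler_sum => y _.
  by rewrite ler_piMr ?semi_ge0//; case/andP: (f01 y).
rewrite ger0_norm; last first.
  by apply: sumr_ge0 => w _; rewrite mulr_ge0 ?res_ge0//; case/andP: (S01 w).
rewrite -(sum_res q0 z l0); apply: ler_sum => w _.
by rewrite ler_piMr ?res_ge0//; case/andP: (S01 w).
Qed.

End ChainLaplace.

(** * The resolvent of the trap chain *)

Section ResolventEstimates.
Context {R : realType} {n : nat}.
Implicit Types (x y z : V n).
Notation N := ((4 ^ n)%:R : R).
Let a : R := green_diag (R := R) (n := n).
Let A : V n -> V n -> R := green.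
Let C0 : R := 1 + green_sqr (R := R) (n := n) / N.

Context (u : V n -> R) (l : R).
Hypothesis u0 : forall x, 0 < u x.
Hypothesis l0 : 0 < l.
Hypothesis a0 : 0 < a.

Definition phi x : R := l * u x / (1 + l * u x).

(** Interaction of [x] with the other traps. The truncation of the depth at 1 matches the saturation
    of [phi], see [phi_le]. *)
Definition crowd x : R := \sum_(y | y != x) `|A x y| * Num.min (u y) 1.

Let v x : R := l * u x / a.
Let f z x : R := resolvent v z x.
(** The one global unknown of the decoupled equation; [fmean_ub] and [fmean_lb] determine it from
    the mass of [v * f]. *)
Definition fmean z : R := (\sum_x f z x) / N.

Let v0 x : 0 < v x. Proof. by rewrite /v divr_gt0// mulr_gt0. Qed.

Let f_ge0 z x : 0 <= f z x. Proof. exact: resolvent_ge0. Qed.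

Let ul x : 0 < 1 + l * u x. Proof. by rewrite ltr_wpDr// ltW// mulr_gt0. Qed.

Let C00 : 0 <= C0.
Proof.
rewrite addr_ge0// divr_ge0 ?(ltW pow4R_gt0)// divr_ge0 ?(ltW pow4R_gt0)//.
by apply: sumr_ge0 => k _; rewrite invr_ge0 sqr_ge0.
Qed.

Lemma phi_ge0 x : 0 <= phi x.
Proof. by rewrite divr_ge0 ?(ltW (ul _))// ltW// mulr_gt0. Qed.

Lemma phi_le1 x : phi x <= 1.
Proof. by rewrite ler_pdivrMr// mul1r lerDr. Qed.

Lemma phi_le_u x : phi x <= l * u x.
Proof.
rewrite ler_pdivrMr// ler_peMr ?(ltW (mulr_gt0 _ _))//.
by rewrite lerDl ltW// mulr_gt0.
Qed.

Lemma phi_le x : phi x <= (l + 1) * Num.min (u x) 1.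
Proof.
have h1 := phi_le1 x; have h2 := phi_le_u x; have h3 := u0 x; have h4 := l0.
by rewrite minEle; case: ifP => _; lra.
Qed.

Let pa x : 0 <= phi x / a. Proof. exact: divr_ge0 (phi_ge0 x) (ltW a0). Qed.

Lemma fmean_ge0 z : 0 <= fmean z.
Proof. by rewrite divr_ge0 ?(ltW pow4R_gt0)// sumr_ge0. Qed.

Let ka z : 0 <= (l + 1) * (fmean z + C0 + a).
Proof.
apply: mulr_ge0; first by rewrite addr_ge0 ?(ltW l0).
by apply: addr_ge0 (ltW a0); apply: addr_ge0 (fmean_ge0 z) C00.
Qed.

Let sum_vf z : \sum_x v x * f z x = 1. Proof. exact: sum_resolvent. Qed.

(** [green_repr] with the term [y = x] moved to the left: since [a * v x = l * u x], the remaining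
    sum only sees other traps. *)
Let repr z x : f z x * (1 + l * u x) =
  fmean z + A x z - \sum_(y | y != x) A x y * (v y * f z y).
Proof.
have := green_repr (f z) x; rewrite -/(fmean z).
rewrite (eq_bigr (fun y => A x y * (v y * f z y) - (z == y)%:R * A x y)); last first.
  move=> y _; have := resolventP z v0 y; rewrite -/(f z y) -/(f z) => e.
  have -> : lap (f z) y = v y * f z y - (z == y)%:R by lra.
  by rewrite -/(A x y); ring.
rewrite sumrB sum_delta (bigD1 x)//= {1}/A green_xx -/a.
have -> : a * (v x * f z x) = l * u x * f z x by rewrite /v; field; rewrite gt_eqF.
lra.
Qed.

(** The weights [v y * f z y] form a subprobability, so the lower bound [- C0] on the Green function
    bounds the whole interaction from one side. *)
Lemma res_le z x : f z x * (1 + l * u x) <= fmean z + A x z + C0.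
Proof.
rewrite repr.
suff : - C0 <= \sum_(y | y != x) A x y * (v y * f z y) by lra.
have h : \sum_(y | y != x) v y * f z y <= 1.
  by rewrite -(sum_vf z) [leRHS](bigD1 x)//= lerDr mulr_ge0// ltW.
apply: (@le_trans _ _ (\sum_(y | y != x) - C0 * (v y * f z y))).
  rewrite -mulr_sumr; have : 0 <= \sum_(y | y != x) v y * f z y.
    by apply: sumr_ge0 => y _; rewrite mulr_ge0// ltW.
  have := C00; nra.
apply: ler_sum => y _; apply: ler_wpM2r; first exact: mulr_ge0 (ltW (v0 y)) (f_ge0 z y).
exact: green_lb.
Qed.

Lemma vf_le z x : v x * f z x <= phi x / a * (fmean z + C0 + A x z).
Proof.
have -> : v x * f z x = phi x / a * (f z x * (1 + l * u x)).
  by rewrite /v /phi; field; rewrite !gt_eqF.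
rewrite ler_wpM2l//.
by have := res_le z x; lra.
Qed.

(** Bootstrap: the one-sided bound just obtained controls each [v y * f z y] by the truncated depth
    of [y], and reinserting it yields a two-sided estimate. *)
Lemma res_err z x : `|f z x * (1 + l * u x) - (fmean z + A x z)| <=
  (l + 1) * (fmean z + C0 + a) * crowd x / a.
Proof.
rewrite repr addrAC subrr add0r normrN; apply: le_trans (ler_norm_sum _ _ _) _.
rewrite /crowd mulr_sumr mulr_suml; apply: ler_sum => y _.
rewrite normrM (ger0_norm (mulr_ge0 (ltW (v0 y)) (f_ge0 z y))).
have h1 : v y * f z y <= (l + 1) * Num.min (u y) 1 / a * (fmean z + C0 + a).
  apply: le_trans (vf_le z y) _.
  have h : A y z <= a by apply: le_trans (ler_norm _) (green_norm y z).
  apply: (@le_trans _ _ (phi y / a * (fmean z + C0 + a))).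
    by rewrite ler_wpM2l// lerD2l.
  apply: ler_wpM2r; first by apply: addr_ge0 (ltW a0); apply: addr_ge0 (fmean_ge0 z) C00.
  by rewrite ler_pM2r ?invr_gt0// phi_le.
apply: le_trans (ler_wpM2l (normr_ge0 _) h1) _.
by rewrite le_eqVlt; apply/orP; left; apply/eqP; field; rewrite gt_eqF.
Qed.

(** The mass that [v * f] gives to the uncrowded set [D] is at most 1, while each of its points
    receives at least about [phi x * fmean z / a]. *)
Lemma fmean_ub z (D : pred (V n)) (sg : R) : (forall x, D x -> crowd x <= sg) -> 0 <= sg ->
  (\sum_(x | D x) phi x) *
    (fmean z / a * (1 - (l + 1) * sg / a) - C0 / a - (l + 1) * (C0 / a + 1) * sg / a) <= 1.
Proof.
move=> hD sg0; rewrite mulr_suml.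
apply: (@le_trans _ _ (\sum_(x | D x) v x * f z x)); last first.
  rewrite -(sum_vf z) [leRHS](bigID D)//= lerDl sumr_ge0// => x _.
  by rewrite mulr_ge0// ltW.
apply: ler_sum => x Dx.
have -> : v x * f z x = phi x * (f z x * (1 + l * u x) / a).
  by rewrite /v /phi; field; rewrite !gt_eqF.
rewrite ler_wpM2l ?phi_ge0// ler_pdivlMr//.
have -> : (fmean z / a * (1 - (l + 1) * sg / a) - C0 / a - (l + 1) * (C0 / a + 1) * sg / a) * a =
    fmean z - C0 - (l + 1) * (fmean z + C0 + a) * sg / a by field; rewrite gt_eqF.
have := res_err z x; rewrite ler_norml => /andP[h _].
have h2 : (l + 1) * (fmean z + C0 + a) * crowd x / a <= (l + 1) * (fmean z + C0 + a) * sg / a.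
  by rewrite ler_pM2r ?invr_gt0// ler_wpM2l ?hD.
have := green_lb (R := R) x z; rewrite -/(A x z) -/C0; lra.
Qed.

Lemma sum_phi_green z (D : pred (V n)) :
  \sum_(x | D x) phi x / a * (fmean z + C0 + A x z) <=
  (\sum_(x | D x) phi x) * (fmean z / a + C0 / a) + (l + 1) * crowd z / a + phi z.
Proof.
have -> : \sum_(x | D x) phi x / a * (fmean z + C0 + A x z) =
   (\sum_(x | D x) phi x) * (fmean z / a + C0 / a) + \sum_(x | D x) phi x / a * A x z.
  rewrite mulr_suml -big_split /=; apply: eq_bigr => x _; field; by rewrite gt_eqF.
rewrite -addrA lerD2l//.
apply: (@le_trans _ _ (\sum_x phi x / a * `|A x z|)).
  rewrite [leRHS](bigID D)/= -[leLHS]addr0 lerD//.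
    by apply: ler_sum => x _; rewrite ler_wpM2l// ler_norm.
  by apply: sumr_ge0 => x _; exact: mulr_ge0 (pa x) (normr_ge0 _).
rewrite (bigD1 z)//= addrC; apply: lerD; last first.
  rewrite {1}/A green_xx -/a ger0_norm ?(ltW a0)// divfK ?gt_eqF//.
rewrite /crowd mulr_sumr mulr_suml; apply: ler_sum => x _.
rewrite /A greenC [leLHS]mulrAC ler_pM2r ?invr_gt0// [leRHS]mulrCA [leRHS]mulrC.
by rewrite ler_wpM2r// mulrC -mulrC phi_le.
Qed.

(** The converse count: the masses [v x * f z x] add up to 1 and [vf_le] bounds each of them from
    above. *)
Lemma fmean_lb z :
  1 <= (\sum_x phi x) * (fmean z / a + C0 / a) + (l + 1) * crowd z / a + phi z.
Proof.
apply: le_trans (sum_phi_green z xpredT).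
by rewrite -(sum_vf z); apply: ler_sum => x _; exact: vf_le.
Qed.

Let q x : R := a / u x.

Lemma resE z x : res q l z x = f z x * u x / a.
Proof.
rewrite /res (_ : (fun y => l / q y) = v); last first.
  by apply/funext => y; rewrite /q /v; field; rewrite !gt_eqF.
by rewrite -/(f z x) /q; field; rewrite !gt_eqF.
Qed.

Lemma res_mass z (D : pred (V n)) :
  l * \sum_(x | D x) res q l z x <=
  (\sum_(x | D x) phi x) * (fmean z / a + C0 / a) + (l + 1) * crowd z / a + phi z.
Proof.
apply: le_trans (sum_phi_green z D); rewrite mulr_sumr; apply: ler_sum => x _.
rewrite resE; apply: le_trans (vf_le z x); rewrite /v.
by rewrite le_eqVlt; apply/orP; left; apply/eqP; field; rewrite gt_eqF.
Qed.

(** On the diagonal the Green entry is [a] and dominates the mean, so the chain started at [x]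
    behaves as if it were killed at rate [l] in a trap left at rate [1 / u x]. *)
Lemma res_diag_err x (sg : R) : crowd x <= sg ->
  `|res q l x x - (l + (u x)^-1)^-1| <=
  l^-1 * (fmean x / a + (l + 1) * (fmean x / a + C0 / a + 1) * sg / a).
Proof.
move=> hs; rewrite resE.
have -> : f x x * u x / a - (l + (u x)^-1)^-1 =
    u x / (1 + l * u x) * ((f x x * (1 + l * u x) - a) / a).
  field; rewrite !gt_eqF//= ltr_wpDl ?invr_gt0//.
have h0 : u x / (1 + l * u x) <= l^-1.
  by rewrite ler_pdivrMr// ler_pdivlMl// lerDr.
rewrite normrM ger0_norm; last by rewrite divr_ge0// ltW.
apply: ler_pM => //; first by rewrite divr_ge0// ltW.
rewrite normrM normfV (ger0_norm (ltW a0)) ler_pdivrMr//.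
have := res_err x x; rewrite {1}/A green_xx -/a => h.
have h2 : (l + 1) * (fmean x + C0 + a) * crowd x / a <= (l + 1) * (fmean x + C0 + a) * sg / a.
  by rewrite ler_pM2r ?invr_gt0// ler_wpM2l.
have -> : (fmean x / a + (l + 1) * (fmean x / a + C0 / a + 1) * sg / a) * a =
    fmean x + (l + 1) * (fmean x + C0 + a) * sg / a by field; rewrite gt_eqF.
move: h; rewrite !ler_norml => /andP[h3 h4]; have := fmean_ge0 x.
by move=> ?; apply/andP; split; lra.
Qed.

(** Away from [z] the mean dominates: [x] is itself one of the traps in [crowd z], which bounds the
    Green entry between [x] and [z]. *)
Lemma res_off_err z x (sg : R) : x != z -> crowd x <= sg ->
  `|res q l z x - (l + (u x)^-1)^-1 * (fmean z / a)| <=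
  (l + (u x)^-1)^-1 * (crowd z / Num.min (u x) 1 / a
    + (l + 1) * (fmean z / a + C0 / a + 1) * sg / a).
Proof.
move=> xz hs; rewrite resE.
have m0 : 0 < Num.min (u x) 1 by rewrite lt_min ltr01 u0.
have e : (l + (u x)^-1)^-1 = u x / (1 + l * u x).
  by field; rewrite !gt_eqF//= ltr_wpDl ?invr_gt0.
rewrite e.
have -> : f z x * u x / a - u x / (1 + l * u x) * (fmean z / a) =
    u x / (1 + l * u x) * ((f z x * (1 + l * u x) - fmean z) / a).
  by field; rewrite !gt_eqF.
have h0 : 0 <= u x / (1 + l * u x) by rewrite divr_ge0// ltW.
rewrite normrM (ger0_norm h0) ler_wpM2l//.
rewrite normrM normfV (ger0_norm (ltW a0)) ler_pdivrMr//.
have h := res_err z x.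
have h2 : (l + 1) * (fmean z + C0 + a) * crowd x / a <= (l + 1) * (fmean z + C0 + a) * sg / a.
  by rewrite ler_pM2r ?invr_gt0// ler_wpM2l.
have h3 : `|A x z| <= crowd z / Num.min (u x) 1.
  rewrite ler_pdivlMr// /crowd (bigD1 x)//= /A greenC lerDl sumr_ge0// => y _.
  by rewrite mulr_ge0// le_min ler01 ltW.
have -> : (crowd z / Num.min (u x) 1 / a + (l + 1) * (fmean z / a + C0 / a + 1) * sg / a) * a =
    crowd z / Num.min (u x) 1 + (l + 1) * (fmean z + C0 + a) * sg / a.
  by field; rewrite !gt_eqF.
move: h h3; rewrite !ler_norml => /andP[? ?] /andP[? ?].
by apply/andP; split; lra.
Qed.

End ResolventEstimates.

Section RealAlgebra.
Context {R : realType}.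

(** Perturbed form of solving [I * Y = 1], applied to [Y = b * fmean / a] and [s] the normalised sum
    of [phi]. *)
Lemma upper_threshold (I e : R) : 0 < I -> 0 < e -> exists h, [/\ 0 < h, h <= 1 &
  forall Y s, 0 <= Y -> I - h <= s -> s * (Y * (1 - h) - h) <= 1 -> Y <= I^-1 + e].
Proof.
move=> I0 e0; set i := I^-1.
have i0 : 0 < i by rewrite invr_gt0.
have Ii : I * i = 1 by rewrite mulfV// gt_eqF.
(* Minus the linear coefficient in [h] of [(I - h) * c]; keeping [h * K] below [I * e / 2] leaves
   that product above 1. *)
pose K := (i + e) + I * (i + e + 1).
have K0 : 0 < K by rewrite addr_gt0 ?mulr_gt0 ?addr_gt0.
pose h := Num.min (Num.min (I / 2) 1) (I * e / (2 * K)).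
have h0 : 0 < h by rewrite !lt_min ltr01 !divr_gt0 ?mulr_gt0.
have hI : h <= I / 2 by rewrite !ge_min lexx.
have h1 : h <= 1 by rewrite !ge_min lexx orbT.
have hK : h * K <= I * e / 2.
  have : h <= I * e / (2 * K) by rewrite !ge_min lexx !orbT.
  rewrite ler_pdivlMr ?mulr_gt0//; lra.
exists h; split => // Y s Y0 sI hs.
rewrite leNgt; apply/negP => Yie.
pose c := (i + e) * (1 - h) - h.
have g1 : 1 < (I - h) * c.
  have -> : (I - h) * c = I * i + I * e - h * K + h * h * (i + e + 1) by rewrite /c /K; ring.
  rewrite Ii.
  have := mulr_gt0 (mulr_gt0 h0 h0) (_ : 0 < i + e + 1); rewrite !addr_gt0// => /(_ isT).
  have := mulr_gt0 I0 e0; lra.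
have c0 : 0 < c.
  have Ih : 0 < I - h by lra.
  by rewrite -(pmulr_rgt0 _ Ih) (lt_trans _ g1).
have cY : c <= Y * (1 - h) - h.
  by rewrite /c lerD2r// ler_wpM2r ?subr_ge0// ltW.
have := ler_pM (_ : 0 <= I - h) (ltW c0) sI cY.
have -> : 0 <= I - h by lra.
by move=> /(_ isT); lra.
Qed.

Lemma lower_threshold (I e : R) : 0 < I -> 0 < e -> exists h, [/\ 0 < h, h <= 1 &
  forall Y s, 0 <= Y -> s <= I + h -> 1 <= s * (Y + h) + 2 * h -> I^-1 - e <= Y].
Proof.
move=> I0 e0; set i := I^-1.
have i0 : 0 < i by rewrite invr_gt0.
have Ii : I * i = 1 by rewrite mulfV// gt_eqF.
pose K := I + i + 3.
have K0 : 0 < K by rewrite /K; lra.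
pose h := Num.min 1 (I * e / (2 * K)).
have h0 : 0 < h by rewrite !lt_min ltr01 !divr_gt0 ?mulr_gt0.
have h1 : h <= 1 by rewrite !ge_min lexx.
have hK : h * K <= I * e / 2.
  have : h <= I * e / (2 * K) by rewrite !ge_min lexx !orbT.
  rewrite ler_pdivlMr ?mulr_gt0//; lra.
exists h; split => // Y s Y0 sI hs.
rewrite leNgt; apply/negP => Yie.
have c1 : s * (Y + h) <= (I + h) * (i - e + h).
  apply: (@le_trans _ _ ((I + h) * (Y + h))); first by rewrite ler_wpM2r// addr_ge0// ltW.
  by rewrite ler_wpM2l ?addr_ge0 ?(ltW I0) ?(ltW h0)// lerD2r// ltW.
have c2 : (I + h) * (i - e + h) = 1 - I * e + h * (I + i + h - e).
  by rewrite -Ii; ring.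
have c3 : h * (I + i + h - e) + 2 * h <= h * K.
  by rewrite /K; nra.
have := mulr_gt0 I0 e0; lra.
Qed.

Lemma near_forall_nat (m : nat) (P : nat -> nat -> Prop) :
  (forall i, (0 < i)%N -> \forall n \near \oo, P i n) ->
  \forall n \near \oo, forall i, (0 < i <= m)%N -> P i n.
Proof.
move=> h; elim: m => [|m IH].
  by apply: nearW => n i; rewrite lt0n andbC leqn0 => /andP[/eqP ->].
have h1 := h m.+1 isT; near=> n => i /andP[i0]; rewrite leq_eqVlt => /orP[/eqP ->|im].
  by near: n.
have H : forall i, (0 < i <= m)%N -> P i n by near: n.
by apply: H; rewrite i0.
Unshelve. all: by end_near. Qed.

End RealAlgebra.

Definition gdiag {R : realType} (n : nat) : R := green_diag (R := R) (n := n.+1).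

Definition glow {R : realType} (n : nat) : R :=
  1 + green_sqr (R := R) (n := n.+1) / (4 ^ n.+1)%:R.

(** * Aging in a fixed environment with regular counts, light shallow traps and no crowding *)

Section Asymptotics.
Context {R : realType} (u : forall n, V n.+1 -> R) (b : nat -> R) (I : R -> R) (J : R -> R -> R).
Arguments u : clear implicits.
Local Notation a := (@gdiag R).
Local Notation C0 := (@glow R).
Let o n : V n.+1 := origin n.+1.

Hypothesis u0 : forall n x, 0 < u n x.
Hypothesis b0 : forall n, 0 < b n.
Hypothesis binf : b n @[n --> \oo] --> +oo.
Hypothesis ba : b n / a n @[n --> \oo] --> (0 : R).
Hypothesis I0 : forall l, 0 < l -> 0 < I l.
Hypothesis HI : forall l, 0 < l -> (\sum_x phi (u n) l x) / b n @[n --> \oo] --> I l.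
Hypothesis HJ : forall l t, 0 < l -> 0 < t ->
  (\sum_x expR (- (u n x)^-1 * t) * (l + (u n x)^-1)^-1) / b n @[n --> \oo] --> J l t.
Hypothesis Hsmall : forall e, 0 < e -> exists d, 0 < d /\
  \forall n \near \oo, \sum_(x | u n x < d) u n x <= e * b n.
Hypothesis Hcrowd : forall d e, 0 < d -> 0 < e ->
  \forall n \near \oo, forall x, (d <= u n x) || (x == o n) -> crowd (u n) x <= e * a n / b n.
Hypothesis H0 : u n (o n) @[n --> \oo] --> (0 : R).

Lemma green_diag_gt0 n : 0 < a n.
Proof.
apply: lt_le_trans (green_diag_ge (R := R) (n := n.+1)).
by rewrite mulr_gt0 ?ltr0n// invr_gt0 mulr_gt0// exprn_gt0// pi_gt0.
Qed.

Let a0 := green_diag_gt0.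

Let q n (x : V n.+1) : R := a n / u n x.
Arguments q : clear implicits.

Let q0 n x : 0 < q n x. Proof. by rewrite divr_gt0. Qed.

Let near_b (M : R) : \forall n \near \oo, M <= b n.
Proof. by move/cvgryPge : binf; apply. Qed.

Let near_ba (e : R) : 0 < e -> \forall n \near \oo, b n / a n <= e.
Proof.
move=> e0; have /cvgr0Pnorm_le /(_ _ e0) := ba; apply: filterS => n.
by rewrite ger0_norm// divr_ge0// ltW.
Qed.

Let CC : R := 1 + 32 * (cos 1) ^- 4.

Let C0_bounds n : 0 <= C0 n <= CC.
Proof.
have N0 : (0 : R) < (4 ^ n.+1)%:R := pow4R_gt0.
apply/andP; split.
  rewrite addr_ge0// divr_ge0 ?(ltW N0)// divr_ge0 ?(ltW N0)//.
  by apply: sumr_ge0 => k _; rewrite invr_ge0 sqr_ge0.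
by rewrite lerD2l ler_pdivrMr// green_sqr_le.
Qed.

Let CC0 : 0 < CC.
Proof. by rewrite ltr_pwDl// mulr_ge0// invr_ge0 exprn_ge0// ltW// cos1_gt0. Qed.

Let near_C0b (e : R) : 0 < e -> \forall n \near \oo, C0 n * (b n / a n) <= e.
Proof.
move=> e0; have := near_ba (divr_gt0 e0 CC0); apply: filterS => n h.
have /andP[h1 h2] := C0_bounds n.
apply: le_trans (ler_wpM2r _ h2) _; first by rewrite divr_ge0// ltW.
by rewrite mulrC -ler_pdivlMr.
Qed.

Let near_C0 : \forall n \near \oo, C0 n / a n <= 1.
Proof.
near=> n; have h1 : C0 n * (b n / a n) <= 1 by near: n; exact: near_C0b.
have h2 : 1 <= b n by near: n; exact: near_b.
have /andP[c0 _] := C0_bounds n.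
apply: le_trans h1; rewrite ler_wpM2l// ler_peMl// invr_ge0 ltW//.
Unshelve. all: by end_near. Qed.

Let Xge0 n l z : 0 < l -> 0 <= fmean (u n) l z / a n.
Proof.
by move=> l0; apply: divr_ge0 (ltW (a0 n)); apply: fmean_ge0 => //; exact: a0.
Qed.

(** The deep traps alone carry almost the whole sum of [phi], since [phi <= l * u] and shallow
    depths sum to little. The bound is uniform in [z], as [near_res_diag] starts the chain at every
    deep trap. *)
Lemma near_fmean_ub (l e : R) : 0 < l -> 0 < e ->
  \forall n \near \oo, forall z, b n * (fmean (u n) l z / a n) <= (I l)^-1 + e.
Proof.
move=> l0 e0; have [h [h0 h1 H]] := upper_threshold (I0 l0) e0.
have hl : 0 < h / 2 / l by rewrite !divr_gt0.
have [d [d0 Hd]] := Hsmall hl.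
have k0 : 0 < h / (4 * (l + 1)) by rewrite divr_gt0// mulr_gt0// ltr_wpDr// ltW.
have h4 : 0 < h / 4 by rewrite divr_gt0.
have h2 : 0 < h / 2 by rewrite divr_gt0.
have /cvgrPdist_le /(_ _ h2) HIn := HI l0.
near=> n => z.
have hC : forall x, (d <= u n x) || (x == o n) ->
    crowd (u n) x <= h / (4 * (l + 1)) * a n / b n by near: n; exact: Hcrowd.
have hb : 1 <= b n by near: n; exact: near_b.
have hC0 : C0 n * (b n / a n) <= h / 4 by near: n; exact: near_C0b.
have hC1 : C0 n / a n <= 1 by near: n; exact: near_C0.
have hS : \sum_(x | u n x < d) u n x <= h / 2 / l * b n by near: n.
have hIn : `|I l - (\sum_x phi (u n) l x) / b n| <= h / 2 by near: n.
pose sg := h / (4 * (l + 1)) * a n / b n.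
have sg0 : 0 <= sg.
  by apply: divr_ge0 (ltW (b0 n)); exact: mulr_ge0 (ltW k0) (ltW (a0 n)).
have := @fmean_ub R n.+1 (u n) l (u0 (n := n)) l0 (a0 n) z (fun x => d <= u n x) sg.
move=> /(_ (fun x dx => hC x (introT orP (or_introl dx))) sg0).
rewrite -![green_diag]/(a n) -![1 + green_sqr / _]/(C0 n).
set SD := \sum_(x | _) _; set X := fmean _ _ _ / _ => ub.
have X0 : 0 <= X by exact: Xge0.
apply: (H _ (SD / b n)); first by rewrite mulr_ge0// ltW.
  have eS : \sum_x phi (u n) l x = SD + \sum_(x | u n x < d) phi (u n) l x.
    rewrite (bigID (fun x => d <= u n x)) /=; congr (_ + _).
    by apply: eq_bigl => x; rewrite -ltNge.
  have hsh : \sum_(x | u n x < d) phi (u n) l x <= h / 2 * b n.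
    apply: le_trans (ler_sum _ (fun x _ => phi_le_u (u0 (n := n)) l0 x)) _.
    rewrite -mulr_sumr; apply: le_trans (ler_wpM2l (ltW l0) hS) _.
    by rewrite le_eqVlt; apply/orP; left; apply/eqP; field; rewrite gt_eqF.
  move: hIn; rewrite eS mulrDl ler_norml => /andP[_ i2].
  have : (\sum_(x | u n x < d) phi (u n) l x) / b n <= h / 2 by rewrite ler_pdivrMr.
  lra.
apply: le_trans ub; rewrite mulrAC -mulrA ler_wpM2l//.
  by rewrite /SD sumr_ge0// => x _; exact: phi_ge0.
rewrite ler_pdivrMr//.
have -> : (X * (1 - (l + 1) * sg / a n) - C0 n / a n - (l + 1) * (C0 n / a n + 1) * sg / a n) * b n =
  b n * X - X * (h / 4) - C0 n * (b n / a n) - (C0 n / a n + 1) * (h / 4).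
  by rewrite /sg; field; rewrite !gt_eqF//= ltr_wpDr// ltW.
have XbX : X <= b n * X by rewrite ler_peMl.
have : (C0 n / a n + 1) * (h / 4) <= 2 * (h / 4) by rewrite ler_wpM2r ?(ltW h4)//; lra.
have : X * (h / 4) <= b n * X * h by nra.
lra.
Unshelve. all: by end_near. Qed.

(** Stated at the starting point only, where the crowding is controlled and the trap itself becomes
    negligible. *)
Lemma near_fmean_lb (l e : R) : 0 < l -> 0 < e ->
  \forall n \near \oo, (I l)^-1 - e <= b n * (fmean (u n) l (o n) / a n).
Proof.
move=> l0 e0; have [h [h0 h1 H]] := lower_threshold (I0 l0) e0.
have k0 : 0 < h / (l + 1) by rewrite divr_gt0// ltr_wpDr// ltW.
have hl : 0 < h / l by rewrite divr_gt0.
have /cvgrPdist_le /(_ _ h0) HIn := HI l0.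
have /cvgr0Pnorm_le /(_ _ hl) H0n := H0.
near=> n.
have hC : forall x, (1 <= u n x) || (x == o n) ->
    crowd (u n) x <= h / (l + 1) * a n / b n by near: n; exact: Hcrowd.
have hb : 1 <= b n by near: n; exact: near_b.
have hC0 : C0 n * (b n / a n) <= h by near: n; exact: near_C0b.
have hIn : `|I l - (\sum_x phi (u n) l x) / b n| <= h by near: n.
have hu : `|u n (o n)| <= h / l by near: n.
have := @fmean_lb R n.+1 (u n) l (u0 (n := n)) l0 (a0 n) (o n).
rewrite -![green_diag]/(a n) -![1 + green_sqr / _]/(C0 n); set S := \sum_x _; set X := fmean _ _ _ / _ => lb.
have X0 : 0 <= X by exact: Xge0.
apply: (H _ (S / b n)); first by rewrite mulr_ge0// ltW.
  by move: hIn; rewrite -/S ler_norml => /andP[? ?]; lra.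
have c1 : (l + 1) * crowd (u n) (o n) / a n <= h.
  have := hC (o n); rewrite eqxx orbT => /(_ isT) hc.
  rewrite ler_pdivrMr//; apply: le_trans (ler_wpM2l _ hc) _; first by rewrite addr_ge0// ltW.
  rewrite (_ : (l + 1) * _ = h * a n / b n); last first.
    by field; rewrite !gt_eqF//= ltr_wpDr// ltW.
  by rewrite ler_pdivrMr// ler_peMr// mulr_ge0 ?(ltW h0) ?(ltW (a0 n)).
have c2 : phi (u n) l (o n) <= h.
  apply: le_trans (phi_le_u (u0 (n := n)) l0 _) _.
  by move: hu; rewrite ger0_norm ?(ltW (u0 _))// ler_pdivlMr// mulrC.
have c3 : S * (X + C0 n / a n) <= S / b n * (b n * X + h).
  rewrite -mulrA ler_wpM2l//; first by rewrite /S sumr_ge0// => x _; exact: phi_ge0.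
  rewrite ler_pdivlMl//.
  have -> : b n * (X + C0 n / a n) = b n * X + C0 n * (b n / a n) by field; rewrite gt_eqF.
  by rewrite lerD2l.
lra.
Unshelve. all: by end_near. Qed.

(** The main term is of order [1 / b], so errors must be of smaller order; this is why crowding is
    required to be small against [a / b]. *)
Lemma near_res_off (l d e : R) : 0 < l -> 0 < d -> 0 < e ->
  \forall n \near \oo, forall x, d <= u n x ->
    `|b n * res (q n) l (o n) x - (l + (u n x)^-1)^-1 * (I l)^-1| <=
    e * (l + (u n x)^-1)^-1.
Proof.
move=> l0 d0 e0; set d' := Num.min d 1.
have d'0 : 0 < d' by rewrite lt_min d0 ltr01.
have e4 : 0 < e / 4 by rewrite divr_gt0.
pose K := (I l)^-1 + 1.
have K0 : 0 < K by rewrite addr_gt0// invr_gt0 I0.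
pose e1 := Num.min (e / 4 * d') (e / 4 / ((l + 1) * (K + 2))).
have l1 : 0 < l + 1 by rewrite ltr_wpDr// ltW.
have e10 : 0 < e1.
  by rewrite lt_min !mulr_gt0// ?invr_gt0// ?mulr_gt0// addr_gt0.
near=> n => x dx.
have hC : forall x, (d <= u n x) || (x == o n) ->
    crowd (u n) x <= e1 * a n / b n by near: n; exact: Hcrowd.
have hb : 1 <= b n by near: n; exact: near_b.
have hC1 : C0 n / a n <= 1 by near: n; exact: near_C0.
have ub1 : forall z, b n * (fmean (u n) l z / a n) <= (I l)^-1 + 1.
  by near: n; exact: near_fmean_ub.
have ub : forall z, b n * (fmean (u n) l z / a n) <= (I l)^-1 + e / 4.
  by near: n; exact: near_fmean_ub.
have lb : (I l)^-1 - e / 4 <= b n * (fmean (u n) l (o n) / a n).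
  by near: n; exact: near_fmean_lb.
have hu : `|u n (o n)| < d by near: n; move/cvgr0Pnorm_lt : H0; exact.
have xo : x != o n.
  apply/eqP => xo; move: hu; rewrite -xo ger0_norm ?(ltW (u0 _))// => ud.
  by have := lt_le_trans ud dx; rewrite ltxx.
have := hC x; rewrite dx => /(_ isT) hx.
have := hC (o n); rewrite eqxx orbT => /(_ isT) ho.
have := @res_off_err R n.+1 (u n) l (u0 (n := n)) l0 (a0 n) (o n) x _ xo hx.
rewrite -![green_diag]/(a n) -![1 + green_sqr / _]/(C0 n) -/(q n); set X := fmean _ _ _ / a n; set w := (l + _)^-1 => h.
have w0 : 0 <= w by rewrite invr_ge0 addr_ge0 ?(ltW l0)// invr_ge0 ltW.
have X0 : 0 <= X by exact: Xge0.
have m0 : 0 < Num.min (u n x) 1 by rewrite lt_min ltr01 u0.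
have XK : X <= K by apply: le_trans (ub1 (o n)); rewrite ler_peMl.
have md : d' <= Num.min (u n x) 1.
  by rewrite le_min !ge_min dx lexx orbT.
have t1 : b n * (crowd (u n) (o n) / Num.min (u n x) 1 / a n) <= e / 4.
  rewrite mulrCA !mulrA [_ * b n]mulrC !mulrA.
  have -> : b n * crowd (u n) (o n) / Num.min (u n x) 1 / a n =
     (b n / a n * crowd (u n) (o n)) / Num.min (u n x) 1 by field; rewrite !gt_eqF.
  rewrite ler_pdivrMr//.
  apply: le_trans (ler_wpM2l _ ho) _; first by rewrite divr_ge0// ltW.
  rewrite (_ : b n / a n * (e1 * a n / b n) = e1); last by field; rewrite !gt_eqF.
  have : e1 <= e / 4 * d' by rewrite ge_min lexx.
  move=> /le_trans; apply; by rewrite ler_wpM2l// ltW.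
have t2 : b n * ((l + 1) * (X + C0 n / a n + 1) * (e1 * a n / b n) / a n) <= e / 4.
  rewrite (_ : b n * _ = (l + 1) * (X + C0 n / a n + 1) * e1); last by field; rewrite !gt_eqF.
  have : e1 <= e / 4 / ((l + 1) * (K + 2)) by rewrite ge_min lexx orbT.
  have lK : 0 < (l + 1) * (K + 2) by rewrite mulr_gt0// (lt_trans K0)// ltrDl.
  rewrite ler_pdivlMr// => hh; apply: le_trans hh.
  by rewrite mulrC ler_wpM2l ?(ltW e10)// ler_wpM2l ?(ltW l1)//; lra.
have -> : b n * res (q n) l (o n) x - w * (I l)^-1 =
    b n * (res (q n) l (o n) x - w * X) + w * (b n * X - (I l)^-1) by ring.
apply: le_trans (ler_normD _ _) _; rewrite normrM (ger0_norm (ltW (b0 n))).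
have h1 : b n * `|res (q n) l (o n) x - w * X| <= w * (e / 2).
  apply: le_trans (ler_wpM2l (ltW (b0 n)) h) _.
  by rewrite mulrCA ler_wpM2l// mulrDr; lra.
have h2 : `|w * (b n * X - (I l)^-1)| <= w * (e / 4).
  rewrite normrM ger0_norm// ler_wpM2l// ler_norml; apply/andP; split.
    by have := lb; rewrite -/X; lra.
  by have := ub (o n); rewrite -/X; lra.
nra.
Unshelve. all: by end_near. Qed.

Lemma near_res_diag (l d e : R) : 0 < l -> 0 < d -> 0 < e ->
  \forall n \near \oo, forall x, d <= u n x ->
    `|res (q n) l x x - (l + (u n x)^-1)^-1| <= e.
Proof.
move=> l0 d0 e0.
pose K := (I l)^-1 + 1.
have K0 : 0 < K by rewrite addr_gt0// invr_gt0 I0.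
have l1 : 0 < l + 1 by rewrite ltr_wpDr// ltW.
pose M := (K + (l + 1) * (K + 2)) / (e * l).
near=> n => x dx.
have hC : forall x, (d <= u n x) || (x == o n) ->
    crowd (u n) x <= 1 * a n / b n by near: n; exact: Hcrowd.
have hb : 1 <= b n by near: n; exact: near_b.
have hM : M <= b n by near: n; exact: near_b.
have hC1 : C0 n / a n <= 1 by near: n; exact: near_C0.
have ub1 : forall z, b n * (fmean (u n) l z / a n) <= (I l)^-1 + 1.
  by near: n; exact: near_fmean_ub.
have := hC x; rewrite dx => /(_ isT) hx.
have := @res_diag_err R n.+1 (u n) l (u0 (n := n)) l0 (a0 n) x _ hx.
rewrite -![green_diag]/(a n) -![1 + green_sqr / _]/(C0 n) -/(q n); set X := fmean _ _ _ / a n => /le_trans; apply.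
have X0 : 0 <= X by exact: Xge0.
have XK : b n * X <= K by exact: ub1.
have XK1 : X <= K by apply: le_trans XK; rewrite ler_peMl.
rewrite ler_pdivrMl// -(ler_pM2l (b0 n)).
rewrite (_ : b n * (X + _) = b n * X + (l + 1) * (X + C0 n / a n + 1)); last first.
  by field; rewrite !gt_eqF.
apply: (@le_trans _ _ (K + (l + 1) * (K + 2))).
  by rewrite lerD// ler_wpM2l ?(ltW l1)//; lra.
move: hM; rewrite /M ler_pdivrMr ?mulr_gt0// => /le_trans; apply.
by rewrite [l * e]mulrC.
Unshelve. all: by end_near. Qed.

(** Return probabilities decrease in time, and a trap of depth at least [d] is left at rate at most
    [1 / d]; so the monotone inversion applies to all deep traps at once. *)
Lemma near_semi_diag (t d e : R) : 0 < t -> 0 < d -> 0 < e ->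
  \forall n \near \oo, forall x, d <= u n x ->
    `|semi (q n) t x x - expR (- (u n x)^-1 * t)| <= e.
Proof.
move=> t0 d0 e0; have [m [D [D0 H]]] := @tauber_monotone R t d^-1 e t0 (ltac:(by rewrite invr_ge0 ltW)) e0.
have : \forall n \near \oo, forall i, (0 < i <= m)%N -> forall x, d <= u n x ->
    `|res (q n) i%:R x x - (i%:R + (u n x)^-1)^-1| <= D.
  apply: (@near_forall_nat m (fun i n => forall x, d <= u n x -> _)) => i i0.
  by apply: near_res_diag => //; rewrite ltr0n.
apply: filterS => n hn x dx.
have f01 (y : V n.+1) : 0 <= ((y == x)%:R : R) <= 1 by case: (y == x); rewrite ?lexx ?ler01.
have := @semi_has_laplace R n.+1 (q n) (q0 (n := n)) x (fun y => (y == x)%:R) f01.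
have e1 (F : V n.+1 -> R) : \sum_y F y * (y == x)%:R = F x.
  by rewrite -(sum_delta x F); apply: eq_bigr => y _; rewrite mulrC eq_sym.
have -> : (fun s => \sum_y semi (q n) s x y * (y == x)%:R) = (fun s => semi (q n) s x x).
  by apply/funext => s; rewrite e1.
have -> : (fun l => \sum_y res (q n) l x y * (y == x)%:R) = (fun l => res (q n) l x x).
  by apply/funext => s; rewrite e1.
move=> lap; apply: (H _ _ _ lap).
- by move=> s s0; rewrite semi_ge0// semi_le1.
- by move=> s r sr; exact: semi_diag_noninc.
- by rewrite invr_ge0 (ltW (u0 x)) lef_pV2 ?posrE.
- by move=> i hi; exact: hn.
Qed.

(** Tightness: it excludes that the chain spends its time in traps too shallow for the pointwise
    asymptotics. *)
Lemma near_res_small (l e : R) : 0 < l -> 0 < e -> exists d, 0 < d /\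
  \forall n \near \oo, \sum_(x | u n x < d) res (q n) l (o n) x <= e /\
    \sum_(x | u n x < d) u n x <= e * b n.
Proof.
move=> l0 e0; pose K := (I l)^-1 + 2.
have K0 : 0 < K by rewrite addr_gt0// invr_gt0 I0.
pose e1 := Num.min e (e / (3 * K)).
have e10 : 0 < e1 by rewrite lt_min e0 divr_gt0// mulr_gt0.
have [d [d0 Hd]] := Hsmall e10.
exists d; split => //.
have l1 : 0 < l + 1 by rewrite ltr_wpDr// ltW.
have k0 : 0 < l * e / 3 / (l + 1) by rewrite !divr_gt0// mulr_gt0.
have e3 : 0 < e / 3 by rewrite divr_gt0.
near=> n.
have hC : forall x, (1 <= u n x) || (x == o n) ->
    crowd (u n) x <= l * e / 3 / (l + 1) * a n / b n by near: n; exact: Hcrowd.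
have hb : 1 <= b n by near: n; exact: near_b.
have hC0 : C0 n * (b n / a n) <= 1 by near: n; exact: near_C0b.
have ub1 : forall z, b n * (fmean (u n) l z / a n) <= (I l)^-1 + 1.
  by near: n; exact: near_fmean_ub.
have hu : `|u n (o n)| <= e / 3 by near: n; move/cvgr0Pnorm_le : H0; exact.
have hS : \sum_(x | u n x < d) u n x <= e1 * b n by near: n.
split; last first.
  by apply: le_trans hS _; rewrite ler_wpM2r ?(ltW (b0 n))// ge_min lexx.
have := @res_mass R n.+1 (u n) l (u0 (n := n)) l0 (a0 n) (o n) (fun x => u n x < d).
rewrite -![green_diag]/(a n) -![1 + green_sqr / _]/(C0 n) -/(q n); set S := \sum_(x | _) phi _ _ _.
set X := fmean _ _ _ / a n => h.
rewrite -(ler_pM2l l0); apply: le_trans h _.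
have X0 : 0 <= X by exact: Xge0.
have c1 : (l + 1) * crowd (u n) (o n) / a n <= l * e / 3.
  have := hC (o n); rewrite eqxx orbT => /(_ isT) hc.
  rewrite ler_pdivrMr//; apply: le_trans (ler_wpM2l (ltW l1) hc) _.
  rewrite (_ : (l + 1) * _ = l * e / 3 * a n / b n); last by field; rewrite !gt_eqF.
  rewrite ler_pdivrMr// ler_peMr//; apply: mulr_ge0 (ltW (a0 n)).
  by apply: divr_ge0 => //; exact: mulr_ge0 (ltW l0) (ltW e0).
have c2 : phi (u n) l (o n) <= l * e / 3.
  apply: le_trans (phi_le_u (u0 (n := n)) l0 _) _.
  by move: hu; rewrite ger0_norm ?(ltW (u0 _))// => hu; rewrite -mulrA ler_wpM2l ?(ltW l0).
have c3 : S * (X + C0 n / a n) <= l * e / 3.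
  have S1 : S <= l * e1 * b n.
    apply: le_trans (ler_sum _ (fun x _ => phi_le_u (u0 (n := n)) l0 x)) _.
    by rewrite -mulr_sumr -mulrA ler_wpM2l ?(ltW l0).
  have /andP[c0 _] := C0_bounds n.
  have XC : 0 <= X + C0 n / a n by rewrite addr_ge0// divr_ge0// ltW.
  apply: le_trans (ler_wpM2r XC S1) _.
  rewrite (_ : l * e1 * b n * _ = l * (e1 * (b n * X + C0 n * (b n / a n)))); last first.
    by field; rewrite gt_eqF.
  rewrite -mulrA ler_wpM2l ?(ltW l0)//.
  have h1 : e1 <= e / (3 * K) by rewrite ge_min lexx orbT.
  have h2 : b n * X + C0 n * (b n / a n) <= K by have := ub1 (o n); rewrite -/X /K; lra.
  apply: le_trans (ler_wpM2l (ltW e10) h2) _.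
  apply: le_trans (ler_wpM2r (ltW K0) h1) _.
  by rewrite le_eqVlt; apply/orP; left; apply/eqP; field; rewrite gt_eqF.
lra.
Unshelve. all: by end_near. Qed.

Lemma laplace_limit (l t : R) : 0 < l -> 0 < t ->
  \sum_x res (q n) l (o n) x * semi (q n) t x x @[n --> \oo] --> J l t / I l.
Proof.
move=> l0 t0; apply/cvgrPdist_le => e e0.
have Il := I0 l0.
pose i := (I l)^-1; have i0 : 0 < i by rewrite invr_gt0.
pose e1 := Num.min (e / 8) (Num.min (e / (8 * i)) (e / (8 * (i + 1) * (I l / l + 1)))).
have l1 : 0 < I l / l + 1 by rewrite ltr_wpDl// divr_ge0// ltW.
have e10 : 0 < e1 by rewrite !lt_min !divr_gt0// !mulr_gt0// addr_gt0.
pose e2 := Num.min 1 e1; have e20 : 0 < e2 by rewrite lt_min ltr01.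
have [d [d0 Hd]] := near_res_small l0 e10.
have e8 : 0 < e / (8 * i) by rewrite divr_gt0// mulr_gt0.
have /cvgrPdist_le /(_ _ e8) HJn := HJ l0 t0.
have /cvgrPdist_le /(_ _ l0) HIn := HI l0.
near=> n.
have hJ : `|J l t - (\sum_x expR (- (u n x)^-1 * t) * (l + (u n x)^-1)^-1) / b n| <= e / (8 * i).
  by near: n.
have hI : `|I l - (\sum_x phi (u n) l x) / b n| <= l by near: n.
have [hs1 hs2] : \sum_(x | u n x < d) res (q n) l (o n) x <= e1 /\
    \sum_(x | u n x < d) u n x <= e1 * b n by near: n.
have hR : forall x, d <= u n x ->
    `|b n * res (q n) l (o n) x - (l + (u n x)^-1)^-1 * (I l)^-1| <=
    e2 * (l + (u n x)^-1)^-1 by near: n; exact: near_res_off.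
have hP : forall x, d <= u n x ->
    `|semi (q n) t x x - expR (- (u n x)^-1 * t)| <= e2 by near: n; exact: near_semi_diag.
pose w x := (l + (u n x)^-1)^-1.
have w0 x : 0 <= w x by rewrite invr_ge0 addr_ge0 ?(ltW l0)// invr_ge0 ltW.
have wphi x : w x = l^-1 * phi (u n) l x.
  have e3 : l + (u n x)^-1 = (1 + l * u n x) / u n x by field; rewrite gt_eqF.
  have e4 : 0 < 1 + l * u n x by rewrite ltr_wpDr// ltW// mulr_gt0.
  by rewrite /w e3 invf_div /phi; field; rewrite !gt_eqF.
have wu x : w x <= u n x.
  by rewrite /w -[leRHS]invrK lef_pV2 ?posrE ?invr_gt0// ?lerDr ?(ltW l0)// addr_gt0// invr_gt0.
pose E x := expR (- (u n x)^-1 * t).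
have E01 x : 0 <= E x <= 1.
  by rewrite expR_ge0 expR_le1 mulNr oppr_le0 mulr_ge0 ?invr_ge0 ?(ltW t0) ?ltW.
have P01 x : 0 <= semi (q n) t x x <= 1.
  by rewrite semi_ge0 ?(ltW t0)// semi_le1 ?(ltW t0).
pose Sw := (\sum_x w x) / b n.
have Sw_le : Sw <= I l / l + 1.
  rewrite /Sw (eq_bigr _ (fun x _ => wphi x)) -mulr_sumr -mulrA mulrC ler_pdivrMr//.
  rewrite mulrDl mul1r divfK ?gt_eqF//; move: hI; rewrite ler_norml => /andP[? ?]; lra.
have Sw0 : 0 <= Sw by rewrite divr_ge0 ?(ltW (b0 n))// sumr_ge0.
(* Deep traps: both factors are replaced by their limits, with errors weighted by [w], whose sum is
   of order [b]. *)
pose T1 := \sum_(x | d <= u n x) `|res (q n) l (o n) x * semi (q n) t x x - i / b n * (E x * w x)|.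
have hT1 : T1 <= e / 4.
  have tx x : d <= u n x -> `|res (q n) l (o n) x * semi (q n) t x x - i / b n * (E x * w x)| <=
      (b n)^-1 * ((i + 1) * 2 * e1 * w x).
    move=> dx; have := hR x dx; have := hP x dx; rewrite -/(w x) -/i -/(E x).
    set r := res _ _ _ _; set p := semi _ _ _ _ => h1 h2.
    have e21 : e2 <= e1 by rewrite ge_min lexx orbT.
    have e2_1 : e2 <= 1 by rewrite ge_min lexx.
    have -> : r * p - i / b n * (E x * w x) = (b n)^-1 * ((b n * r - w x * i) * p + i * w x * (p - E x)).
      by field; rewrite gt_eqF.
    rewrite normrM ger0_norm ?invr_ge0 ?(ltW (b0 n))// ler_wpM2l ?invr_ge0 ?(ltW (b0 n))//.
    apply: le_trans (ler_normD _ _) _.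
    have h3 : `|(b n * r - w x * i) * p| <= e1 * w x.
      have /andP[p0 p1] := P01 x.
      rewrite normrM (ger0_norm p0) -[leRHS]mulr1 ler_pM//.
      by apply: le_trans h2 _; rewrite ler_wpM2r.
    have h4 : `|i * w x * (p - E x)| <= i * w x * e1.
      rewrite normrM (ger0_norm (mulr_ge0 (ltW i0) (w0 x))) ler_wpM2l ?mulr_ge0 ?(ltW i0)//.
      exact: le_trans h1 e21.
    have := mulr_ge0 (ltW e10) (w0 x); have := mulr_ge0 (ltW i0) (mulr_ge0 (ltW e10) (w0 x)).
    nra.
  apply: le_trans (ler_sum _ tx) _; rewrite -mulr_sumr -mulr_sumr.
  have : \sum_(x | d <= u n x) w x <= \sum_x w x.
    by rewrite [leRHS](bigID (fun x => d <= u n x)) /= lerDl sumr_ge0.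
  move=> hw.
  apply: (@le_trans _ _ ((i + 1) * 2 * e1 * Sw)).
    rewrite /Sw mulrC -!mulrA ler_wpM2l ?(ltW (addr_gt0 _ _))// ?addr_gt0//.
    rewrite ler_wpM2l// ler_wpM2l ?(ltW e10)// ler_wpM2r ?invr_ge0 ?(ltW (b0 n))//.
  have i1 : 0 < i + 1 by rewrite addr_gt0.
  apply: (@le_trans _ _ ((i + 1) * 2 * e1 * (I l / l + 1))).
    by rewrite ler_wpM2l// !mulr_ge0 ?(ltW i1) ?(ltW e10).
  have : e1 <= e / (8 * (i + 1) * (I l / l + 1)) by rewrite !ge_min lexx !orbT.
  rewrite ler_pdivlMr ?mulr_gt0//; lra.
(* Shallow traps: nothing is compared; each of the two sums is small by itself, the second because
   [w <= u]. *)
pose T2 := \sum_(x | u n x < d) `|res (q n) l (o n) x * semi (q n) t x x - i / b n * (E x * w x)|.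
have hT2 : T2 <= e / 4.
  apply: (@le_trans _ _ (\sum_(x | u n x < d) (res (q n) l (o n) x + i / b n * u n x))).
    apply: ler_sum => x _; apply: le_trans (ler_normB _ _) _; apply: lerD.
      have /andP[p0 p1] := P01 x.
      have r0 : 0 <= res (q n) l (o n) x by apply: res_ge0.
      by rewrite (ger0_norm (mulr_ge0 r0 p0)) ler_piMr.
    have /andP[E0 E1] := E01 x.
    have ib0 : 0 <= i / b n := divr_ge0 (ltW i0) (ltW (b0 n)).
    rewrite (ger0_norm (mulr_ge0 ib0 (mulr_ge0 E0 (w0 x)))) ler_wpM2l//.
    by apply: le_trans (wu x); rewrite ler_piMl.
  rewrite big_split /= -mulr_sumr.
  have h1 : i / b n * \sum_(x | u n x < d) u n x <= e / 8.
    apply: (@le_trans _ _ (i * e1)).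
      rewrite -mulrA ler_wpM2l ?(ltW i0)// mulrC ler_pdivrMr//.
    have : e1 <= e / (8 * i) by rewrite !ge_min lexx !orbT.
    rewrite ler_pdivlMr ?mulr_gt0//; lra.
  have : e1 <= e / 8 by rewrite !ge_min lexx.
  lra.
have main : `|i * ((\sum_x E x * w x) / b n) - \sum_x res (q n) l (o n) x * semi (q n) t x x| <= e / 2.
  have -> : i * ((\sum_x E x * w x) / b n) - \sum_x res (q n) l (o n) x * semi (q n) t x x =
     - \sum_x (res (q n) l (o n) x * semi (q n) t x x - i / b n * (E x * w x)).
    by rewrite sumrB -mulr_sumr opprB; congr (_ - _); ring.
  rewrite normrN (bigID (fun x => d <= u n x)) /=; apply: le_trans (ler_normD _ _) _.
  have t3 : \sum_(x | ~~ (d <= u n x)) `|res (q n) l (o n) x * semi (q n) t x x - i / b n * (E x * w x)| = T2.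
    by apply: eq_bigl => x; rewrite -ltNge.
  apply: le_trans (lerD (ler_norm_sum _ _ _) (ler_norm_sum _ _ _)) _.
  by rewrite t3 -/T1; lra.
have hJ2 : `|J l t / I l - i * ((\sum_x E x * w x) / b n)| <= e / 8.
  rewrite [J l t / _]mulrC -/i -mulrBr normrM (ger0_norm (ltW i0)).
  apply: le_trans (ler_wpM2l (ltW i0) hJ) _.
  by rewrite le_eqVlt; apply/orP; left; apply/eqP; field; rewrite gt_eqF.
have -> : J l t / I l - \sum_x res (q n) l (o n) x * semi (q n) t x x =
  (J l t / I l - i * ((\sum_x E x * w x) / b n)) +
  (i * ((\sum_x E x * w x) / b n) - \sum_x res (q n) l (o n) x * semi (q n) t x x) by ring.
apply: le_trans (ler_normD _ _) _; lra.
Unshelve. all: by end_near. Qed.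

Lemma aging_limit (E Hc : R -> R) (th : R) : 0 < th ->
  (forall t i, 0 < t -> (0 < i)%N -> J i%:R t / I i%:R = E (i%:R * t) / i%:R) ->
  (forall p k t y, (0 < p)%N -> (0 < k)%N -> 0 < t -> 0 < y ->
    Hc y * ktail p k (t * y) <= \sum_(j < k) kcoef k j * E ((p * j.+1)%:R * t) <=
    Hc y + ktail p k (t * y)) ->
  (forall y, 0 <= Hc y <= 1) ->
  {for th^-1, continuous Hc} -> Hc y @[y --> +oo] --> (1 : R) ->
  \sum_x semi (q n) 1 (o n) x * semi (q n) th x x @[n --> \oo] --> Hc th^-1.
Proof.
move=> th0 JE mix Hc01 Hcont Hinf.
have P01 n x t : 0 <= t -> 0 <= semi (q n) t x x <= 1.
  by move=> t0; rewrite semi_ge0// semi_le1.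
apply: (@tauber_increment R (fun n s t => \sum_x semi (q n) s (o n) x * semi (q n) t x x)
  (fun n t l => \sum_x res (q n) l (o n) x * semi (q n) t x x) E Hc th) => //.
- move=> n s t s0 t0; apply/andP; split.
    by apply: sumr_ge0 => x _; rewrite mulr_ge0 ?semi_ge0.
  rewrite -(semi_row_sum (q n) s (o n)); apply: ler_sum => x _.
  by rewrite ler_piMr ?semi_ge0// semi_le1.
- move=> n s t t' s0 tt'; apply: ler_sum => x _; rewrite ler_wpM2l ?semi_ge0//.
  exact: semi_diag_noninc.
- move=> n s v t s0 v0 t0; apply: (@semi_increment R n.+1 (q n) (q0 (n := n))) => // x.
  exact: P01.
- move=> n t t0; apply: (@semi_has_laplace R n.+1 (q n) (q0 (n := n)) (o n)) => x.
  exact/P01/ltW.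
- move=> t i t0 i0; rewrite -JE//; apply: laplace_limit => //; by rewrite ltr0n.
Qed.

End Asymptotics.

(** * The limit law *)

Section Primitive.
Context {R : realType}.

Lemma primitive_exists (f : R -> R) : continuous f ->
  exists F : R -> R, F 0 = 0 /\ forall t : R, 0 <= t -> is_derive t 1 F (f t).
Proof.
move=> cf; pose mu := @lebesgue_measure R.
(* The integral starts at -1 so that the derivative at 0 is two-sided. *)
pose G x := (\int[mu]_(t in `[(-1)%R, x]) (f t))%R.
exists (fun x => G x - G 0); split; first by rewrite subrr.
move=> t t0.
have it : mu.-integrable `[(-1)%R, t + 1] (EFin \o f).
  apply: continuous_compact_integrable; first exact: segment_compact.
  exact: continuous_subspaceT.
have tt : t < t + 1 by rewrite ltrDl.
have t1 : -1 < t by apply: lt_le_trans t0; rewrite ltrN10.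
have [d1 d2] := @continuous_FTC1_closed R f (-1) t (t + 1) tt it t1 (cf t).
have e2 : 'D_1 G t = f t by rewrite -derive1E; exact: d2.
have dG : is_derive t 1 G (f t) by exact: (DeriveDef d1 e2).
apply: (is_derive_conv (is_deriveB dG (is_derive_cst (G 0) t 1))).
by rewrite subr0.
Qed.

Lemma is_derive_sub (f g : R -> R) (x df dg : R) :
  is_derive x 1 f df -> is_derive x 1 g dg ->
  is_derive x 1 (fun y => f y - g y) (df - dg).
Proof. exact: is_deriveB. Qed.

Lemma is_derive_continuous (f : R -> R) (x df : R) : is_derive x 1 f df -> {for x, continuous f}.
Proof. by case=> d _; apply: differentiable_continuous; apply/derivable1_diffP. Qed.

Lemma is_derive_powR (x c : R) : 0 < x ->
  is_derive x 1 (fun y => y `^ c) (c * x `^ (c - 1)).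
Proof.
move=> x0; apply: DeriveDef.
  by apply: derivable_powR; rewrite in_itv /= x0.
by rewrite -derive1E powR_derive1// in_itv /= x0.
Qed.

Lemma continuous_powR_gt0 (x c : R) : 0 < x -> {for x, continuous (fun y => y `^ c)}.
Proof. by move=> x0; exact: is_derive_continuous (is_derive_powR c x0). Qed.

Lemma continuous_powR_max (c : R) : 0 < c -> continuous (fun y : R => Num.max y 0 `^ c).
Proof.
move=> c0 x; have [x0|x0|->] := ltgtP x 0.
- have e : \forall y \near x, (0 : R) = Num.max y 0 `^ c.
    near=> y; rewrite max_r ?powR0 ?gt_eqF//.
    by apply: ltW; near: y; exact: lt_nbhsl.
  rewrite /continuous_at max_r ?(ltW x0)// powR0 ?gt_eqF//.
  by apply: cvg_near_cst; apply: filterS e => y /esym.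
- have e : \forall y \near x, y `^ c = Num.max y 0 `^ c.
    near=> y; rewrite max_l//.
    by apply: ltW; near: y; exact: lt_nbhsr.
  rewrite /continuous_at max_l ?(ltW x0)//.
  by apply: cvg_trans (continuous_powR_gt0 (c := c) x0); exact: near_eq_cvg.
rewrite /continuous_at maxxx powR0 ?gt_eqF//; apply/cvgr0Pnorm_le => e e0.
exists (e `^ c^-1) => /=; first by rewrite powR_gt0.
move=> y /=; rewrite sub0r normrN => ye.
rewrite ger0_norm ?powR_ge0//.
have -> : e = (e `^ c^-1) `^ c by rewrite -powRrM mulVf ?gt_eqF// powRr1// ltW.
apply: ge0_ler_powR; rewrite ?nnegrE ?le_max ?lexx ?orbT ?powR_ge0 ?(ltW c0)//.
by rewrite ge_max powR_ge0 andbT (le_trans (ler_norm _))// ltW.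
Unshelve. all: by end_near. Qed.

End Primitive.

Section Profile.
Context {R : realType} (alpha : R).
Implicit Types (x y v w s t e : R).
Hypothesis al0 : 0 < alpha.
Hypothesis al1 : alpha < 1.

(** Traps are described by [v = (l * u)^(- alpha)], a variable in which their number up to [v] is
    asymptotically linear; then [rho v = 1 / (l * u)]. The maximum with 0 makes the function
    continuous on the whole line. *)
Definition rho (v : R) : R := Num.max v 0 `^ alpha^-1.

Lemma rho_ge0 v : 0 <= rho v. Proof. exact: powR_ge0. Qed.

Lemma rho_mono v w : v <= w -> rho v <= rho w.
Proof.
move=> vw; apply: ge0_ler_powR; first by rewrite invr_ge0 ltW.
- by rewrite nnegrE le_max lexx orbT.
- by rewrite nnegrE le_max lexx orbT.
by rewrite ge_max !le_max vw lexx /= orbT.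
Qed.

Lemma rho_powR y : 0 <= y -> rho (y `^ alpha) = y.
Proof.
by move=> y0; rewrite /rho max_l ?powR_ge0// -powRrM mulfV ?gt_eqF// powRr1.
Qed.

Lemma rhoE v : 0 <= v -> rho v = v `^ alpha^-1.
Proof. by move=> v0; rewrite /rho max_l. Qed.

Lemma continuous_rho : continuous rho.
Proof. by apply: continuous_powR_max; rewrite invr_gt0. Qed.

(* [prof 0] integrates to the arcsine integral after the substitution
   [v = (s / (1 - s)) `^ alpha]. *)
Definition prof (x v : R) : R := expR (- x * rho v) / (1 + rho v).

Lemma rho1_gt0 v : 0 < 1 + rho v.
Proof. by rewrite ltr_pwDl// rho_ge0. Qed.

Lemma prof_gt0 x v : 0 < prof x v.
Proof. by rewrite divr_gt0 ?expR_gt0 ?rho1_gt0. Qed.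

Lemma prof_noninc x v w : 0 <= x -> v <= w -> prof x w <= prof x v.
Proof.
move=> x0 vw; rewrite /prof ler_pM ?expR_ge0 ?invr_ge0 ?(ltW (rho1_gt0 _))//.
  by rewrite ler_expR !mulNr lerN2 ler_wpM2l// rho_mono.
by rewrite lef_pV2 ?posrE ?rho1_gt0// lerD2l rho_mono.
Qed.

Lemma prof_le0 x v : 0 <= x -> prof x v <= prof 0 v.
Proof.
move=> x0; rewrite /prof ler_wpM2r ?invr_ge0 ?(ltW (rho1_gt0 _))//.
by rewrite ler_expR !mulNr lerN2 mul0r mulr_ge0// rho_ge0.
Qed.

Lemma prof_le1 x v : 0 <= x -> prof x v <= 1.
Proof.
move=> x0; apply: le_trans (prof_le0 v x0) _.
rewrite /prof oppr0 mul0r expR0 mul1r invf_le1 ?rho1_gt0//.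
by rewrite lerDl rho_ge0.
Qed.

Lemma continuous_prof x : continuous (prof x).
Proof.
move=> v; apply: cvgM.
  apply: (@continuous_comp _ _ _ (fun v => - x * rho v) expR); last exact: continuous_expR.
  by apply: cvgMr; exact: continuous_rho.
apply: cvgV; first by rewrite gt_eqF// rho1_gt0.
by apply: cvgD; [exact: cvg_cst|exact: continuous_rho].
Qed.

Definition iprof (x : R) : R -> R := sval (cid (primitive_exists (@continuous_prof x))).

Lemma iprof0 x : iprof x 0 = 0.
Proof. by rewrite /iprof; case: cid => F []. Qed.

Lemma is_derive_iprof x (t : R) : 0 <= t -> is_derive t 1 (iprof x) (prof x t).
Proof. by move=> t0; rewrite /iprof; case: cid => F /= [_ h]; exact: h. Qed.

Lemma iprof_incr x s t : 0 <= x -> 0 <= s <= t ->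
  prof x t * (t - s) <= iprof x t - iprof x s <= prof x s * (t - s).
Proof.
move=> x0 /andP[s0 st].
have lin (c y : R) : is_derive y 1 (fun y => c * y) c.
  by apply: (is_derive_conv (is_derive_scale c (is_derive_id y 1))); rewrite mulr1.
apply/andP; split.
  suff : iprof x s - prof x t * s <= iprof x t - prof x t * t by lra.
  apply: (@is_derive_ge0_le _ (fun y => iprof x y - prof x t * y)
    (fun y => prof x y - prof x t)); first exact: st.
    move=> y /andP[sy _].
    exact: (is_derive_sub (is_derive_iprof x (le_trans s0 sy)) (lin (prof x t) y)).
  by move=> y /andP[_ yt]; rewrite subr_ge0 prof_noninc.
suff : prof x s * s - iprof x s <= prof x s * t - iprof x t by lra.
apply: (@is_derive_ge0_le _ (fun y => prof x s * y - iprof x y)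
  (fun y => prof x s - prof x y)); first exact: st.
  move=> y /andP[sy _].
  exact: (is_derive_sub (lin (prof x s) y) (is_derive_iprof x (le_trans s0 sy))).
by move=> y /andP[sy _]; rewrite subr_ge0 prof_noninc.
Qed.

Lemma iprof_mono x s t : 0 <= x -> 0 <= s <= t -> iprof x s <= iprof x t.
Proof.
move=> x0 st; have /andP[h _] := iprof_incr x0 st.
have /andP[_ st'] := st; rewrite -subr_ge0 (le_trans _ h)// mulr_ge0 ?subr_ge0//.
exact/ltW/prof_gt0.
Qed.

Lemma iprof_le_iprof0 x s t : 0 <= x -> 0 <= s <= t ->
  iprof x t - iprof x s <= iprof 0 t - iprof 0 s.
Proof.
move=> x0 /andP[s0 st].
suff : iprof 0 s - iprof x s <= iprof 0 t - iprof x t by lra.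
apply: (@is_derive_ge0_le _ (fun y => iprof 0 y - iprof x y)
  (fun y => prof 0 y - prof x y)); first exact: st.
  by move=> y /andP[sy _]; apply: is_derive_sub; apply: is_derive_iprof; exact: le_trans sy.
by move=> y _; rewrite subr_ge0 prof_le0.
Qed.

(** The profile is below [v^(- 1 / alpha)], which is integrable at infinity because [alpha < 1]. *)
Lemma iprof0_tail s t : 0 < s <= t ->
  iprof 0 t - iprof 0 s <= alpha / (1 - alpha) * s `^ (1 - alpha^-1).
Proof.
move=> /andP[s0 st].
pose c := 1 - alpha^-1.
have c0 : c < 0 by rewrite subr_lt0 invf_gt1.
have a1 : 0 < 1 - alpha by rewrite subr_gt0.
have ce : alpha / (1 - alpha) = - c^-1.
  have -> : c = - ((1 - alpha) / alpha) by rewrite /c; field; rewrite gt_eqF.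
  by rewrite invrN invf_div opprK.
rewrite ce mulNr.
suff : c^-1 * s `^ c - iprof 0 s <= c^-1 * t `^ c - iprof 0 t.
  have : c^-1 * t `^ c <= 0 by rewrite mulr_le0_ge0 ?powR_ge0// invr_le0 ltW.
  lra.
apply: (@is_derive_ge0_le _ (fun y => c^-1 * y `^ c - iprof 0 y)
  (fun y => c^-1 * (c * y `^ (c - 1)) - prof 0 y)); first exact: st.
  move=> y /andP[sy _]; have y0 := lt_le_trans s0 sy.
  apply: is_derive_sub; first by apply: is_derive_scale; exact: is_derive_powR.
  by apply: is_derive_iprof; exact: ltW.
move=> y /andP[sy _]; have y0 := lt_le_trans s0 sy.
rewrite mulKf ?lt_eqF// subr_ge0 /prof oppr0 mul0r expR0 mul1r.
have -> : c - 1 = - alpha^-1 by rewrite /c; ring.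
rewrite powRN lef_pV2 ?posrE ?rho1_gt0 ?powR_gt0// rhoE ?(ltW y0)//.
by rewrite lerDr.
Qed.

Definition cprof (x : R) : R := limn (fun k : nat => iprof x k%:R).

Lemma cprof_cvg x : 0 <= x -> (fun k : nat => iprof x k%:R) @ \oo --> cprof x.
Proof.
move=> x0; apply: nondecreasing_is_cvgn.
  by move=> i j ij; apply: iprof_mono => //; rewrite ler0n ler_nat.
exists (iprof 0 1 + alpha / (1 - alpha)) => _ [k _ <-].
have k0 : 0 <= (0 : R) <= k%:R by rewrite lexx ler0n.
have := iprof_le_iprof0 x0 k0; rewrite !iprof0 !subr0 => /le_trans; apply.
have [k1|k1] := leqP k 1.
  have : iprof 0 k%:R <= iprof 0 1 by apply: iprof_mono => //; rewrite ler0n lern1.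
  by move=> /le_trans; apply; rewrite lerDl divr_ge0 ?subr_ge0 ?(ltW al1) ?(ltW al0).
have := @iprof0_tail 1 k%:R; rewrite ltr01 ler1n (ltn_trans _ k1)// => /(_ isT).
by rewrite powR1 mulr1; lra.
Qed.

Lemma iprof_le_cprof x t : 0 <= x -> 0 <= t -> iprof x t <= cprof x.
Proof.
move=> x0 t0; apply: limr_ge; first exact: (cvgP _ (cprof_cvg x0)).
near=> k; apply: iprof_mono => //; rewrite t0.
by near: k; exact: nbhs_infty_ger.
Unshelve. all: by end_near. Qed.

Lemma iprof_near_cprof x (e : R) : 0 <= x -> 0 < e ->
  exists T, 0 < T /\ forall t, T <= t -> cprof x - e <= iprof x t.
Proof.
move=> x0 e0; have /cvgrPdist_le /(_ _ e0) [k _ hk] := cprof_cvg x0.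
exists k.+1%:R; split; first by rewrite ltr0n.
move=> t kt; have := hk k.+1 (leqnSn k); rewrite ler_norml => /andP[_ h].
have : iprof x k.+1%:R <= iprof x t by apply: iprof_mono => //; rewrite ler0n kt.
lra.
Qed.

Lemma cprof_gt0 x : 0 <= x -> 0 < cprof x.
Proof.
move=> x0; apply: lt_le_trans (iprof_le_cprof x0 ler01).
have /andP[h _] := @iprof_incr x 0 1 x0 (ltac:(by rewrite lexx ler01)).
by rewrite iprof0 !subr0 mulr1 in h; apply: lt_le_trans h; exact: prof_gt0.
Qed.

(** Distribution function of the escape rate [rho v] when [v] has density [prof 0 / cprof 0]. *)
Definition Hlaw (y : R) : R := iprof 0 (Num.max y 0 `^ alpha) / cprof 0.

(** Laplace transform of the law [Hlaw]. Integration by parts makes [Elap (i * t) / i] the Laplace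
    transform at [i] of [s] to [Hlaw (s / t)], whence the limit [Hlaw th^-1] at [s = 1] and
    [t = th]. *)
Definition Elap (x : R) : R := cprof x / cprof 0.

Lemma Hlaw_bounds y : 0 <= Hlaw y <= 1.
Proof.
have c0 := cprof_gt0 (lexx 0).
apply/andP; split.
  rewrite divr_ge0 ?(ltW c0)// -[leLHS](iprof0 0); apply: iprof_mono => //.
  by rewrite lexx powR_ge0.
by rewrite ler_pdivrMr// mul1r iprof_le_cprof// powR_ge0.
Qed.

Lemma Hlaw_continuous y : 0 < y -> {for y, continuous Hlaw}.
Proof.
move=> y0; apply: cvgMl.
apply: (@continuous_comp _ _ _ (fun y => Num.max y 0 `^ alpha) (iprof 0)).
  exact: continuous_powR_max.
by apply: is_derive_continuous; apply: is_derive_iprof; exact: powR_ge0.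
Qed.

Lemma Hlaw_infty : Hlaw y @[y --> +oo] --> (1 : R).
Proof.
have c0 := cprof_gt0 (lexx 0).
apply/cvgrPdist_le => e e0.
have ec : 0 < e * cprof 0 by rewrite mulr_gt0.
have [T [T0 hT]] := iprof_near_cprof (lexx 0) ec.
near=> y.
have yT : T `^ alpha^-1 <= y by near: y; apply: nbhs_pinfty_ge; exact: num_real.
have y0 : 0 <= y := le_trans (powR_ge0 _ _) yT.
have h1 : T <= Num.max y 0 `^ alpha.
  rewrite max_l// -[leLHS]powRr1 ?(ltW T0)// -(mulVf (lt0r_neq0 al0)) powRrM.
  by apply: ge0_ler_powR => //; rewrite ?(ltW al0) ?nnegrE ?powR_ge0.
have h2 := hT _ h1; have /andP[_ h3] := Hlaw_bounds y.
rewrite ger0_norm ?subr_ge0// lerBlDr -lerBlDl /Hlaw ler_pdivlMr// mulrBl mul1r.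
exact: h2.
Unshelve. all: by end_near. Qed.

(** The alternating sum is the mean of [ktail p k (t * rho v)] under the limit law. Split at
    [rho v = y]: by monotonicity the tail lies between its value at [t * y] and 1 before the split,
    and below that value after it. *)
Lemma Elap_mixture p k t y : (0 < p)%N -> (0 < k)%N -> 0 < t -> 0 < y ->
  Hlaw y * ktail p k (t * y) <= \sum_(j < k) kcoef k j * Elap ((p * j.+1)%:R * t) <=
  Hlaw y + ktail p k (t * y).
Proof.
move=> p0 k0 t0 y0.
have c0 := cprof_gt0 (lexx 0).
pose x j : R := (p * j.+1)%:R * t.
have x0 j : 0 <= x j by rewrite mulr_ge0// ltW.
pose M v : R := \sum_(j < k) kcoef k j * iprof (x j) v.
have dM (v : R) : 0 <= v -> is_derive v 1 M (ktail p k (t * rho v) * prof 0 v).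
  move=> v0; apply: (is_derive_conv (@is_derive_big_sum R _ (index_enum _)
    (fun (j : 'I_k) v => kcoef k j * iprof (x j) v) _ v
    (fun j => is_derive_scale _ (is_derive_iprof (x j) v0)))).
  rewrite ktailE mulr_suml; apply: eq_bigr => j _.
  rewrite /prof oppr0 mul0r expR0 mul1r mulrA /x; congr (_ * expR _ / _); ring.
have M0 : M 0 = 0 by rewrite /M big1// => j _; rewrite iprof0 mulr0.
pose z := y `^ alpha; have z0 : 0 < z by rewrite powR_gt0.
have rz : rho z = y by rewrite rho_powR// ltW.
have kb v : 0 <= ktail p k (t * rho v) <= 1.
  by apply: ktail_bounds; rewrite mulr_ge0 ?rho_ge0// ltW.
have kle v : 0 <= v <= z -> ktail p k (t * y) <= ktail p k (t * rho v).
  move=> /andP[v0 vz]; apply: ktail_noninc; rewrite mulr_ge0 ?rho_ge0 ?(ltW t0)//=.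
  by rewrite ler_pM2l// -rz rho_mono.
have kge v : z <= v -> ktail p k (t * rho v) <= ktail p k (t * y).
  move=> zv; apply: ktail_noninc; rewrite mulr_ge0 ?(ltW y0) ?(ltW t0)//=.
  by rewrite ler_pM2l// -rz rho_mono.
set K := ktail p k (t * y).
have K0 : 0 <= K by have /andP[] := @ktail_bounds R p k (t * y) (ltW (mulr_gt0 t0 y0)).
have b1 : K * iprof 0 z <= M z.
  have := @is_derive_ge0_le _ (fun v => M v - K * iprof 0 v)
    (fun v => ktail p k (t * rho v) * prof 0 v - K * prof 0 v) 0 z (ltW z0).
  rewrite M0 iprof0 mulr0 subrr subr_ge0; apply.
    move=> v /andP[v0 _]; apply: is_derive_sub; first exact: dM.
    by apply: is_derive_scale; exact: is_derive_iprof.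
  by move=> v hv; rewrite -mulrBl mulr_ge0 ?subr_ge0 ?kle// ltW// prof_gt0.
have b2 : M z <= iprof 0 z.
  have := @is_derive_ge0_le _ (fun v => iprof 0 v - M v)
    (fun v => prof 0 v - ktail p k (t * rho v) * prof 0 v) 0 z (ltW z0).
  rewrite M0 iprof0 subrr subr_ge0; apply.
    by move=> v /andP[v0 _]; apply: is_derive_sub; [exact: is_derive_iprof|exact: dM].
  move=> v hv; rewrite subr_ge0 ler_piMl ?(ltW (prof_gt0 _ _))//.
  by have /andP[] := kb v.
have b3 T : z <= T -> M z <= M T.
  move=> zT; apply: (@is_derive_ge0_le _ M (fun v => ktail p k (t * rho v) * prof 0 v)).
  - exact: zT.
  - by move=> v /andP[zv _]; apply: dM; exact: le_trans (ltW z0) zv.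
  by move=> v _; rewrite mulr_ge0 ?(ltW (prof_gt0 _ _))//; have /andP[] := kb v.
have b4 T : z <= T -> M T - M z <= K * cprof 0.
  move=> zT; have Tz : 0 <= T := le_trans (ltW z0) zT.
  have : K * iprof 0 z - M z <= K * iprof 0 T - M T.
    apply: (@is_derive_ge0_le _ (fun v => K * iprof 0 v - M v)
      (fun v => K * prof 0 v - ktail p k (t * rho v) * prof 0 v)); first exact: zT.
      move=> v /andP[zv _]; have v0 := le_trans (ltW z0) zv.
      apply: is_derive_sub; last exact: dM.
      by apply: is_derive_scale; exact: is_derive_iprof.
    by move=> v /andP[zv _]; rewrite -mulrBl mulr_ge0 ?subr_ge0 ?kge// ltW// prof_gt0.
  have : K * iprof 0 T <= K * cprof 0 by rewrite ler_wpM2l// iprof_le_cprof.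
  have : 0 <= K * iprof 0 z.
    rewrite mulr_ge0// -[leLHS](iprof0 0); apply: iprof_mono => //.
    by rewrite lexx (ltW z0).
  lra.
have Mlim : (fun i : nat => M i%:R) @ \oo --> \sum_(j < k) kcoef k j * cprof (x j).
  by apply: cvg_big_sum => j; apply: cvgMr; exact: cprof_cvg.
have l1 : M z <= \sum_(j < k) kcoef k j * cprof (x j).
  rewrite -(cvg_lim (@norm_hausdorff _ _) Mlim); apply: limr_ge; first exact: (cvgP _ Mlim).
  by near=> i; apply: b3; near: i; exact: nbhs_infty_ger.
have l2 : \sum_(j < k) kcoef k j * cprof (x j) <= M z + K * cprof 0.
  rewrite -(cvg_lim (@norm_hausdorff _ _) Mlim); apply: limr_le; first exact: (cvgP _ Mlim).
  near=> i; have zi : z <= i%:R by near: i; exact: nbhs_infty_ger.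
  by have := b4 _ zi; lra.
have -> : \sum_(j < k) kcoef k j * Elap ((p * j.+1)%:R * t) =
    (\sum_(j < k) kcoef k j * cprof (x j)) / cprof 0.
  by rewrite mulr_suml; apply: eq_bigr => j _; rewrite /Elap mulrA.
rewrite /Hlaw max_l ?(ltW y0)// -/z; apply/andP; split.
  rewrite mulrAC ler_pM2r ?invr_gt0//; apply: le_trans l1; by rewrite mulrC.
rewrite ler_pdivrMr// mulrDl divfK ?gt_eqF//; apply: le_trans l2 _.
by rewrite lerD2r.
Unshelve. all: by end_near. Qed.

End Profile.

(** * From counting functions to Laplace functionals *)

Section StepBounds.
Context {R : realType}.

(** For decreasing [f] the jumps over a grid are nonnegative weights on the indicators of
    [v <= k.+1 * h]; this reduces sums of [f] over traps to counting functions. *)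
Lemma step_lower (f : R -> R) (h v : R) (K : nat) :
  0 < h -> 0 < v -> (forall s t, 0 <= s <= t -> f t <= f s) -> (forall s, 0 <= f s) ->
  \sum_(k < K) (f (k.+1%:R * h) - f (k.+2%:R * h)) * (v <= k.+1%:R * h)%R%:R <= f v.
Proof.
move=> h0 v0 fn f0.
have hk k : 0 <= k%:R * h by rewrite mulr_ge0// ltW.
suff [H1 H2] : (v <= K%:R * h -> \sum_(k < K) (f (k.+1%:R * h) - f (k.+2%:R * h)) *
      (v <= k.+1%:R * h)%R%:R <= f v - f (K.+1%:R * h)) /\
    (K%:R * h < v -> \sum_(k < K) (f (k.+1%:R * h) - f (k.+2%:R * h)) *
      (v <= k.+1%:R * h)%R%:R = 0).
  have [/H1 /le_trans|/H2 ->//] := leP v (K%:R * h).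
  by apply; rewrite gerBl.
elim: K => [|K [IH1 IH2]].
  by split; [rewrite mul0r leNgt v0|rewrite big_ord0].
have KS : K%:R * h <= K.+1%:R * h by rewrite ler_pM2r// ler_nat.
split => hv; rewrite big_ord_recr /=.
  rewrite hv mulr1; have [vK|Kv] := leP v (K%:R * h).
    by have := IH1 vK; lra.
  by rewrite IH2// add0r lerD2r fn// (ltW v0).
by rewrite IH2 ?(le_lt_trans KS)// leNgt hv mulr0 addr0.
Qed.

Lemma step_upper (f : R -> R) (h v : R) (K : nat) :
  0 < h -> 0 < v -> (forall s t, 0 <= s <= t -> f t <= f s) -> v <= K%:R * h ->
  f v <= \sum_(k < K) (f (k%:R * h) - f (k.+1%:R * h)) * (v <= k.+1%:R * h)%R%:R
    + f (K%:R * h).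
Proof.
move=> h0 v0 fn.
have hk k : 0 <= k%:R * h by rewrite mulr_ge0// ltW.
have d0 k : 0 <= f (k%:R * h) - f (k.+1%:R * h).
  by rewrite subr_ge0 fn// hk ler_pM2r// ler_nat /=.
elim: K => [|K IH] hv; first by move: hv; rewrite mul0r leNgt v0.
rewrite big_ord_recr /= hv mulr1.
have [vK|Kv] := leP v (K%:R * h); first by have := IH vK; lra.
have : 0 <= \sum_(k < K) (f (k%:R * h) - f (k.+1%:R * h)) * (v <= k.+1%:R * h)%R%:R.
  by apply: sumr_ge0 => k _; rewrite mulr_ge0.
have : f v <= f (K%:R * h) by rewrite fn// hk ltW.
lra.
Qed.

(** Summation by parts: since counts are linear in the limit, the weighted jumps recombine into a
    Riemann sum. *)
Lemma abel_upper (g : nat -> R) (K : nat) :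
  \sum_(k < K) (g k - g k.+1) * k.+1%:R + g K * K%:R = \sum_(k < K) g k.
Proof.
elim: K => [|K IH]; first by rewrite !big_ord0 mulr0 addr0.
rewrite !big_ord_recr /= -IH -!natr1; ring.
Qed.

Lemma abel_lower (g : nat -> R) (K : nat) :
  \sum_(k < K) (g k.+1 - g k.+2) * k.+1%:R + g K.+1 * K%:R = \sum_(k < K) g k.+1.
Proof. exact: (abel_upper (fun k => g k.+1)). Qed.

End StepBounds.

Lemma powR_le_inv {R : realType} (c a r : R) : 0 < c -> 0 <= a -> 0 <= r ->
  (a `^ c <= r) = (a <= r `^ c^-1).
Proof.
move=> c0 a0 r0; have ci : 0 <= c^-1 by rewrite invr_ge0 ltW.
apply/idP/idP => h.
  rewrite -[leLHS]powRr1// -(mulfV (lt0r_neq0 c0)) powRrM.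
  by apply: ge0_ler_powR => //; rewrite nnegrE ?powR_ge0.
rewrite -[leRHS]powRr1// -(mulVf (lt0r_neq0 c0)) powRrM.
by apply: ge0_ler_powR => //; rewrite ?(ltW c0) ?nnegrE ?powR_ge0.
Qed.

Lemma prof0E {R : realType} (alpha v : R) : prof alpha 0 v = (1 + rho alpha v)^-1.
Proof. by rewrite /prof oppr0 mul0r expR0 mul1r. Qed.

Section Counting.
Context {R : realType} (alpha : R).
Hypothesis al0 : 0 < alpha.
Hypothesis al1 : alpha < 1.
Context (T : nat -> finType) (u : forall n, T n -> R) (b : nat -> R).
Arguments u : clear implicits.
Hypothesis u0 : forall n x, 0 < u n x.
Hypothesis b0 : forall n, 0 < b n.
Hypothesis Hcount : forall d, 0 < d ->
  (\sum_x (d <= u n x)%R%:R) / b n @[n --> \oo] --> d `^ (- alpha).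
Hypothesis Hsmall : forall e, 0 < e -> exists d, 0 < d /\
  \forall n \near \oo, \sum_(x | u n x < d) u n x <= e * b n.

Local Notation prof := (prof alpha).
Local Notation iprof := (iprof al0).
Local Notation cprof := (cprof al0).

(** Up to a large level [L] the profile is squeezed between step functions whose sums converge by
    counting. Beyond [L] the traps are shallow, and the profile is at most [l * u], summed by
    [Hsmall]. *)
Lemma counting_limit (l x : R) : 0 < l -> 0 <= x ->
  (\sum_y prof x ((l * u n y)^-1 `^ alpha)) / b n @[n --> \oo] --> l `^ alpha * cprof x.
Proof.
move=> l0 x0; set c := l `^ alpha; have c0 : 0 < c by rewrite powR_gt0.
pose v n y := (l * u n y)^-1 `^ alpha.
have v0 n y : 0 < v n y by rewrite powR_gt0// invr_gt0 mulr_gt0.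
have lu n y : 0 < l * u n y by rewrite mulr_gt0.
have vle n y r : 0 < r -> (v n y <= r) = ((l * r `^ alpha^-1)^-1 <= u n y).
  move=> r0; have r1 : 0 < r `^ alpha^-1 by rewrite powR_gt0.
  rewrite /v powR_le_inv ?invr_ge0 ?(ltW (lu _ _)) ?(ltW r0)// invfM.
  by rewrite [in RHS]invfM !ler_pdivrMr// [in RHS]mulrC.
have cnt r : 0 < r -> (\sum_y (v n y <= r)%R%:R) / b n @[n --> \oo] --> c * r.
  move=> r0; have r1 : 0 < r `^ alpha^-1 by rewrite powR_gt0.
  have d0 : 0 < (l * r `^ alpha^-1)^-1 by rewrite invr_gt0 mulr_gt0.
  have -> : c * r = (l * r `^ alpha^-1)^-1 `^ (- alpha).
    have pV z : 0 < z -> z^-1 `^ (- alpha) = z `^ alpha.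
      by move=> z0; rewrite -[z^-1]powR_inv1 ?(ltW z0)// -powRrM mulN1r opprK.
    rewrite pV ?mulr_gt0// powRM ?(ltW l0) ?powR_ge0// -powRrM mulVf ?gt_eqF// powRr1// ltW//.
  apply: cvg_trans (Hcount d0); apply: near_eq_cvg; apply: nearW => n.
  by congr (_ / _); apply: eq_bigr => y _; rewrite vle.
pose f := prof x.
have fn s t : 0 <= s <= t -> f t <= f s by move=> /andP[_ st]; exact: prof_noninc.
have f0 s : 0 <= f s by exact/ltW/prof_gt0.
have f1 s : f s <= 1 by exact: prof_le1.
have scnt (g : nat -> R) (h : R) (K : nat) : 0 < h ->
    (\sum_y \sum_(k < K) g k * (v n y <= k.+1%:R * h)%R%:R) / b n @[n --> \oo] -->
    \sum_(k < K) g k * (c * (k.+1%:R * h)).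
  move=> h0; have H := @cvg_big_sum R 'I_K (index_enum _)
    (fun k n => g k * ((\sum_y (v n y <= k.+1%:R * h)%R%:R) / b n))
    (fun k => g k * (c * (k.+1%:R * h)))
    (fun k => ltac:(apply: cvgMr; apply: cnt; rewrite mulr_gt0// ltr0n//)).
  apply: cvg_trans H; apply: near_eq_cvg; apply: nearW => n.
  rewrite exchange_big /= mulr_suml; apply: eq_bigr => k _.
  by rewrite -mulr_sumr mulrA.
apply/cvgrPdist_le => /= e0 e00.
pose e : R := e0 / (4 * (c + l + 1)).
have cl : 0 < c + l + 1 by rewrite !addr_gt0.
have e_gt0 : 0 < e by rewrite divr_gt0// mulr_gt0.
have ee : 4 * (c + l + 1) * e = e0 by rewrite /e mulrC divfK// gt_eqF// mulr_gt0.
have [T1 [T10 HT1]] := iprof_near_cprof al0 al1 x0 e_gt0.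
have [d [d0 Hd]] := Hsmall e_gt0.
(* The first term places [L / 2] where the integral is complete up to [e]; the second makes every
   trap with [v > L] shallower than [d]. *)
pose L := Num.max (2 * T1) ((l * d)^-1 `^ alpha + 1).
have L0 : 0 < L by rewrite lt_max mulr_gt0.
pose K := (Num.truncn (L / e)).+1.
pose h := L / K%:R.
have K0 : (0 : R) < K%:R by rewrite ltr0n.
have h0 : 0 < h by rewrite divr_gt0.
have he : h <= e.
  rewrite /h ler_pdivrMr// mulrC -ler_pdivrMr//; exact/ltW/truncnS_gt.
have Kh : K%:R * h = L by rewrite /h mulrC divfK// gt_eqF.
pose g k := f (k%:R * h).
have hk k : 0 <= k%:R * h by rewrite mulr_ge0// ltW.
have inc k : g k.+1 * h <= iprof x (k.+1%:R * h) - iprof x (k%:R * h) <= g k * h.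
  have := @iprof_incr _ _ al0 x (k%:R * h) (k.+1%:R * h) x0.
  rewrite hk ler_pM2r// ler_nat leqnSn => /(_ isT).
  by have -> : k.+1%:R * h - k%:R * h = h by rewrite -natr1; ring.
have cp := @iprof_le_cprof _ _ al0 al1 x.
have U : \sum_(k < K) g k * h <= h + cprof x.
  rewrite big_ord_recl /= lerD//.
    by rewrite ler_piMl ?(ltW h0)//; exact: f1.
  apply: le_trans (cp ((Num.truncn (L / e))%:R * h) x0 (hk _)).
  have : forall m, \sum_(i < m) g (bump 0 i) * h <= iprof x (m%:R * h).
    elim=> [|m IH]; first by rewrite big_ord0 mul0r iprof0.
    rewrite big_ord_recr /= /bump /=; have /andP[+ _] := inc m; rewrite add1n.
    by move: IH; rewrite /bump /=; lra.
  exact.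
have Lo : iprof x L - h <= \sum_(k < K) g k.+1 * h.
  have low m : iprof x (m.+1%:R * h) - iprof x h <= \sum_(k < m) g k.+1 * h.
    elim: m => [|m IH]; first by rewrite big_ord0 mul1r subrr.
    by rewrite big_ord_recr /=; have /andP[_] := inc m.+1; lra.
  apply: le_trans (low K).
  have : iprof x L <= iprof x (K.+1%:R * h).
    by apply: iprof_mono => //; rewrite (ltW L0) -Kh ler_pM2r// ler_nat leqnSn.
  have /andP[_] := inc 0%N; rewrite mul0r mul1r iprof0 subr0.
  have : g 0%N * h <= h by rewrite ler_piMl ?(ltW h0)//; exact: f1.
  lra.
(* The profile decreases, so half of [L * f L] is at most its integral over [[L / 2, L]], which is
   at most [e]. *)
have tailL : g K.+1 * L <= 2 * e.
  have : 0 <= L / 2 <= L by lra.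
  move=> /(iprof_incr al0 x0) /andP[i1 _].
  have h1 : cprof x - e <= iprof x (L / 2).
    by apply: HT1; rewrite ler_pdivlMr// mulrC le_max lexx.
  have h2 := cp L x0 (ltW L0).
  have h3 : g K.+1 <= f L by apply: fn; rewrite (ltW L0) -Kh ler_pM2r// ler_nat leqnSn.
  have : g K.+1 * L <= f L * L by rewrite ler_wpM2r// ltW.
  have i2 : f L * (L - L / 2) = f L * L / 2 by field.
  move: i1; rewrite -/f -/(f L) i2; lra.
have /cvgrPdist_le /(_ _ e_gt0) HU := scnt (fun k => g k - g k.+1) h K h0.
have /cvgrPdist_le /(_ _ e_gt0) HL := scnt (fun k => g k.+1 - g k.+2) h K h0.
have /cvgrPdist_le /(_ _ e_gt0) HK := cnt L L0.
near=> n.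
have hU : `|\sum_(k < K) (g k - g k.+1) * (c * (k.+1%:R * h)) -
    (\sum_y \sum_(k < K) (g k - g k.+1) * (v n y <= k.+1%:R * h)%R%:R) / b n| <= e by near: n.
have hL : `|\sum_(k < K) (g k.+1 - g k.+2) * (c * (k.+1%:R * h)) -
    (\sum_y \sum_(k < K) (g k.+1 - g k.+2) * (v n y <= k.+1%:R * h)%R%:R) / b n| <= e by near: n.
have hK : `|c * L - (\sum_y (v n y <= L)%R%:R) / b n| <= e by near: n.
have hS : \sum_(y | u n y < d) u n y <= e * b n by near: n.
have bn := b0 n.
have eU : \sum_(k < K) (g k - g k.+1) * (c * (k.+1%:R * h)) + g K * (c * L) =
    c * \sum_(k < K) g k * h.
  rewrite -mulr_suml -(abel_upper g K) mulrDl mulr_suml mulrDr mulr_sumr -Kh.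
  by congr (_ + _); [apply: eq_bigr => k _|]; ring.
have eL : \sum_(k < K) (g k.+1 - g k.+2) * (c * (k.+1%:R * h)) + g K.+1 * (c * L) =
    c * \sum_(k < K) g k.+1 * h.
  rewrite -mulr_suml -(abel_lower g K) mulrDl mulr_suml mulrDr mulr_sumr -Kh.
  by congr (_ + _); [apply: eq_bigr => k _|]; ring.
have lower : (\sum_y \sum_(k < K) (g k.+1 - g k.+2) * (v n y <= k.+1%:R * h)%R%:R) / b n <=
    (\sum_y f (v n y)) / b n.
  rewrite ler_pM2r ?invr_gt0//; apply: ler_sum => y _.
  exact: step_lower.
have upper : (\sum_y f (v n y)) / b n <=
    (\sum_y \sum_(k < K) (g k - g k.+1) * (v n y <= k.+1%:R * h)%R%:R) / b n +
    g K * ((\sum_y (v n y <= L)%R%:R) / b n) + l * e.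
  have : (\sum_y f (v n y)) <=
    (\sum_y \sum_(k < K) (g k - g k.+1) * (v n y <= k.+1%:R * h)%R%:R) +
    g K * (\sum_y (v n y <= L)%R%:R) + l * (e * b n).
    rewrite mulr_sumr -big_split /= (bigID (fun y => v n y <= L)) /=.
    rewrite [X in _ <= X + _](bigID (fun y => v n y <= L)) /= -addrA; apply: lerD.
      apply: ler_sum => y vL; rewrite vL mulr1.
      have := @step_upper R f h (v n y) K h0 (v0 n y) fn; rewrite Kh => /(_ vL).
      by rewrite /g Kh.
    rewrite -[leLHS]add0r; apply: lerD.
      apply: sumr_ge0 => y _; apply: addr_ge0; last by rewrite mulr_ge0// f0.
      by apply: sumr_ge0 => k _; rewrite mulr_ge0// subr_ge0 fn// hk ler_pM2r// ler_nat leqnSn.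
    apply: (@le_trans _ _ (\sum_(y | ~~ (v n y <= L)) l * u n y)).
      apply: ler_sum => y _; apply: le_trans (prof_le0 _ _ x0) _.
      rewrite prof0E rho_powR ?invr_ge0 ?(ltW (lu _ _))//.
      have := lu n y; set r := l * u n y => r0.
      by rewrite invf_ple ?posrE ?ltr_pwDl ?invr_ge0 ?(ltW r0)// lerDr.
    rewrite -mulr_sumr ler_pM2l//; apply: le_trans hS.
    rewrite [leRHS](bigID (fun y => ~~ (v n y <= L))) /=.
    rewrite (eq_bigl (fun y => (u n y < d) && ~~ (v n y <= L))).
      by rewrite lerDl sumr_ge0// => y _; exact: ltW.
    move=> y; case: (boolP (v n y <= L)) => vL; rewrite ?andbF// andbT.
    apply/esym; rewrite ltNge; apply: contra vL => dy.
    apply: (@le_trans _ _ ((l * d)^-1 `^ alpha)).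
      apply: ge0_ler_powR; rewrite ?(ltW al0) ?nnegrE ?invr_ge0 ?mulr_ge0 ?(ltW l0) ?(ltW d0) ?(ltW (u0 _))//.
      by rewrite lef_pV2 ?posrE ?mulr_gt0// ler_pM2l.
    by rewrite le_max lerDl ler01 orbT.
  move=> H; rewrite ler_pdivrMr// mulrDl mulrDl divfK ?gt_eqF// -mulrA divfK ?gt_eqF//.
  by rewrite -[l * e * b n]mulrA.
have gK01 : 0 <= g K <= 1 by rewrite f0 f1.
move: hU hL hK; rewrite !ler_norml => /andP[U1 U2] /andP[L1 L2] /andP[K1 K2].
case/andP: gK01 => gK0 gK1.
set SU := (\sum_y \sum_(k < K) (g k - g k.+1) * _) / b n in upper U1 U2.
set SL := (\sum_y \sum_(k < K) (g k.+1 - g k.+2) * _) / b n in lower L1 L2.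
set CL := (\sum_y (v n y <= L)%R%:R) / b n in upper K1 K2.
set SS := (\sum_y f (v n y)) / b n in lower upper *.
have r1 : g K * CL <= g K * (c * L) + e.
  apply: (@le_trans _ _ (g K * (c * L + e))); first by rewrite ler_wpM2l//; lra.
  by rewrite mulrDr lerD2l ler_piMl ?(ltW e_gt0).
have r2 : SS <= c * (h + cprof x) + 2 * e + l * e.
  have : c * \sum_(k < K) g k * h <= c * (h + cprof x) by rewrite ler_pM2l.
  lra.
have r3 : c * (iprof x L - h) - c * (2 * e) - e <= SS.
  have : c * (iprof x L - h) <= c * \sum_(k < K) g k.+1 * h by rewrite ler_pM2l.
  have : c * (g K.+1 * L) <= c * (2 * e) by rewrite ler_pM2l.
  lra.
have r4 : cprof x - e <= iprof x L.
  apply: HT1; rewrite (@le_trans _ _ (2 * T1)) ?le_max ?lexx//; lra.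
have r5 : c * (cprof x - e) <= c * iprof x L by rewrite ler_pM2l.
have r6 : c * h <= c * e by rewrite ler_pM2l.
have r7 : 0 < c * e by rewrite mulr_gt0.
have r8 : 0 < l * e by rewrite mulr_gt0.
have : 4 * (c * e) + 4 * (l * e) + 4 * e = e0 by rewrite -ee; ring.
by move=> r9; apply/andP; split; lra.
Unshelve. all: by end_near. Qed.

Lemma counting_phi (l : R) : 0 < l ->
  (\sum_y l * u n y / (1 + l * u n y)) / b n @[n --> \oo] --> l `^ alpha * cprof 0.
Proof.
move=> l0; apply: cvg_trans (counting_limit l0 (lexx 0)); apply: near_eq_cvg.
apply: nearW => n; congr (_ / _); apply: eq_bigr => y _.
have r0 : 0 < l * u n y by rewrite mulr_gt0.
rewrite prof0E rho_powR ?invr_ge0 ?(ltW r0)//; move: (l * u n y) r0 => r r0.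
by field; rewrite !gt_eqF// ?addr_gt0.
Qed.

Lemma counting_laplace (l t : R) : 0 < l -> 0 <= t ->
  (\sum_y expR (- (u n y)^-1 * t) * (l + (u n y)^-1)^-1) / b n @[n --> \oo] -->
  l^-1 * (l `^ alpha * cprof (l * t)).
Proof.
move=> l0 t0; have lt0 : 0 <= l * t by rewrite mulr_ge0// ltW.
have H : l^-1 * ((\sum_y prof (l * t) ((l * u n y)^-1 `^ alpha)) / b n) @[n --> \oo] -->
    l^-1 * (l `^ alpha * cprof (l * t)) by apply: cvgMr; exact: counting_limit.
apply: cvg_trans H; apply: near_eq_cvg.
apply: nearW => n; rewrite mulrA; congr (_ / _); rewrite mulr_sumr; apply: eq_bigr => y _.
have r0 : 0 < l * u n y by rewrite mulr_gt0.
rewrite /prof rho_powR ?invr_ge0 ?(ltW r0)//.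
have -> : - (l * t) * (l * u n y)^-1 = - (u n y)^-1 * t.
  by field; rewrite !gt_eqF.
have uy := u0 y; move: (u n y) uy r0 => r r1 r0.
by field; rewrite !gt_eqF// ?addr_gt0// mulr_gt0.
Qed.

End Counting.

(** * The reflection formula *)

Section Fejer.
Context {R : realType}.
Implicit Types (t c alpha : R).

Lemma is_derive_sin_scale c t : is_derive t 1 (fun t : R => sin (c * t)) (c * cos (c * t)).
Proof.
have h : is_derive t (1 : R) (fun t : R => c * t) c.
  by apply: (is_derive_conv (is_derive_scale c (is_derive_id t 1))); rewrite mulr1.
apply: (is_derive_conv (is_derive1_comp (is_derive_sin (c * t)) h)).
by rewrite mulrC.
Qed.

Lemma cos_sin_natpi i : (cos (i%:R * pi) = (-1) ^+ i :> R) /\ (sin (i%:R * pi) = 0 :> R).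
Proof.
elim: i => [|i [IHc IHs]]; first by rewrite mul0r cos0 sin0 expr0.
have -> : i.+1%:R * pi = i%:R * pi + pi :> R by rewrite -natr1 mulrDl mul1r.
by rewrite cosDpi sinDpi IHc IHs oppr0 exprS mulN1r.
Qed.

(** A sum of consecutive powers of [exp (i * t)] has modulus at most [1 / |sin (t / 2)|]; real and
    imaginary parts telescope after multiplication by [2 * sin (t / 2)]. *)
Lemma fejer_bound (t : R) N :
  sin (t / 2) ^+ 2 * ((\sum_(i < N) cos (i%:R * t)) ^+ 2 + (\sum_(i < N) sin (i%:R * t)) ^+ 2) <= 1.
Proof.
pose h := t / 2; have th : t = 2 * h by rewrite /h mulrC divfK.
rewrite -/h.
have dc : 2 * sin h * (\sum_(i < N) cos (i%:R * t)) = sin ((2 * N%:R - 1) * h) + sin h.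
  elim: N => [|N IH]; first by rewrite big_ord0 mulr0 mulr0 sub0r mulN1r sinN addNr.
  rewrite big_ord_recr /= mulrDr IH th.
  have -> : (2 * N.+1%:R - 1) * h = N%:R * (2 * h) + h by rewrite -natr1; ring.
  have -> : (2 * N%:R - 1) * h = N%:R * (2 * h) - h by ring.
  rewrite sinB sinD; ring.
have ds : 2 * sin h * (\sum_(i < N) sin (i%:R * t)) = cos h - cos ((2 * N%:R - 1) * h).
  elim: N {dc} => [|N IH]; first by rewrite big_ord0 mulr0 mulr0 sub0r mulN1r cosN subrr.
  rewrite big_ord_recr /= mulrDr IH th.
  have -> : (2 * N.+1%:R - 1) * h = N%:R * (2 * h) + h by rewrite -natr1; ring.
  have -> : (2 * N%:R - 1) * h = N%:R * (2 * h) - h by ring.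
  rewrite cosB cosD; ring.
move: dc ds; set C := \sum_(i < N) _; set S := \sum_(i < N) _.
set s := sin h; set y := (_ - 1) * h => dc ds.
have e : 4 * (s ^+ 2 * (C ^+ 2 + S ^+ 2)) = 2 + 2 * (sin y * sin h - cos h * cos y).
  have -> : 4 * (s ^+ 2 * (C ^+ 2 + S ^+ 2)) = (2 * s * C) ^+ 2 + (2 * s * S) ^+ 2 by ring.
  rewrite dc ds -/s; have := cos2Dsin2 y; have := cos2Dsin2 h; rewrite -/s.
  set a := cos h; set b := cos y; set d := sin y => h1 h2.
  have -> : (d + s) ^+ 2 + (a - b) ^+ 2 = (a ^+ 2 + s ^+ 2) + (b ^+ 2 + d ^+ 2) +
    2 * (d * s - a * b) by ring.
  by rewrite h1 h2.
have : - cos (y + h) <= 1 by rewrite lerNl cos_geN1.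
rewrite cosD; lra.
Qed.

(* [1 - cos (alpha * t)] vanishes to second order at [0], hence its integral
   against the unnormalised Fejer kernel stays bounded. *)
Lemma fejer_reflection alpha N : 0 < alpha < 1 ->
  `|N%:R * pi - sin (alpha * pi) *
    \sum_(i < N) \sum_(j < N) (-1) ^+ i * (-1) ^+ j / (alpha + (i%:R - j%:R))|
  <= 8 * (cos 1) ^- 2 * pi :> R.
Proof.
move=> /andP[al0 al1].
have nz (i j : nat) : alpha + (i%:R - j%:R) != 0.
  have [ij|ji] := leqP j i.
    by rewrite gt_eqF// ltr_pwDl// subr_ge0 ler_nat.
  rewrite lt_eqF// addrC -subr_lt0; rewrite subr0.
  have : (i.+1%:R : R) <= j%:R by rewrite ler_nat.
  rewrite -natr1; lra.
pose A (i j : nat) (t : R) := if i == j then t else sin ((i%:R - j%:R) * t) / (i%:R - j%:R).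
have dA (i j : nat) (t : R) : is_derive t 1 (A i j) (cos ((i%:R - j%:R) * t)).
  rewrite /A; have [->|ij] := eqVneq i j.
    by apply: (is_derive_conv (is_derive_id t 1)); rewrite subrr mul0r cos0.
  have ij0 : (i%:R - j%:R : R) != 0 by rewrite subr_eq0 eqr_nat.
  have -> : (fun t0 : R => sin ((i%:R - j%:R) * t0) / (i%:R - j%:R)) =
    (fun t0 : R => (i%:R - j%:R)^-1 * sin ((i%:R - j%:R) * t0)).
    by apply/funext => z; rewrite mulrC.
  apply: (is_derive_conv (is_derive_scale (i%:R - j%:R)^-1 (is_derive_sin_scale _ t))).
  by rewrite mulKf.
pose B (i j : nat) (t : R) := (alpha + (i%:R - j%:R))^-1 * sin ((alpha + (i%:R - j%:R)) * t).
have dB (i j : nat) (t : R) : is_derive t 1 (B i j) (cos ((alpha + (i%:R - j%:R)) * t)).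
  apply: (is_derive_conv (is_derive_scale _ (is_derive_sin_scale _ t))).
  by rewrite mulKf.
(* Explicit primitive of [1 - cos (alpha * t)] times the Fejer kernel. The [sin (alpha * t)] part
   drops out by antisymmetry in [i] and [j], and at [pi] only the diagonal of [A] survives. *)
pose F (t : R) := \sum_(i < N) \sum_(j < N) (A i j t - B i j t).
pose C (t : R) := \sum_(i < N) cos (i%:R * t).
pose S (t : R) := \sum_(i < N) sin (i%:R * t).
pose dF (t : R) := (1 - cos (alpha * t)) * (C t ^+ 2 + S t ^+ 2).
have hF (t : R) : is_derive t 1 F (dF t).
  apply: (is_derive_conv (@is_derive_big_sum R _ (index_enum _)
    (fun (i : 'I_N) t => \sum_(j < N) (A i j t - B i j t)) _ t
    (fun i => @is_derive_big_sum R _ (index_enum _)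
    (fun (j : 'I_N) t => A i j t - B i j t) _ t
    (fun j => is_derive_sub (dA i j t) (dB i j t))))).
  have e1 : \sum_(i < N) \sum_(j < N) cos ((i%:R - j%:R) * t) = C t * C t + S t * S t.
    rewrite !big_distrlr /= -big_split /=; apply: eq_bigr => i _.
    rewrite -big_split /=; apply: eq_bigr => j _.
    by rewrite mulrBl cosB.
  have e2 : \sum_(i < N) \sum_(j < N) cos ((alpha + (i%:R - j%:R)) * t) =
      cos (alpha * t) * (C t * C t + S t * S t) - sin (alpha * t) * (S t * C t - C t * S t).
    rewrite -e1 !big_distrlr /= -sumrB !mulr_sumr -sumrB; apply: eq_bigr => i _.
    rewrite -sumrB !mulr_sumr -sumrB; apply: eq_bigr => j _.
    by rewrite !mulrDl cosD mulNr sinB.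
  have e3 : \sum_(i < N) \sum_(j < N) (cos ((i%:R - j%:R) * t) - cos ((alpha + (i%:R - j%:R)) * t))
    = (C t * C t + S t * S t) - (cos (alpha * t) * (C t * C t + S t * S t) -
       sin (alpha * t) * (S t * C t - C t * S t)).
    rewrite -e2 -e1 -sumrB; apply: eq_bigr => i _; by rewrite sumrB.
  by rewrite e3 /dF; ring.
have F0 : F 0 = 0.
  rewrite /F big1// => i _; rewrite big1// => j _; rewrite /A /B !mulr0 sin0 mulr0 mul0r.
  by case: ifP; rewrite subrr.
have Fpi : F pi = N%:R * pi - sin (alpha * pi) *
    \sum_(i < N) \sum_(j < N) (-1) ^+ i * (-1) ^+ j / (alpha + (i%:R - j%:R)).
  have eA : \sum_(i < N) \sum_(j < N) A i j pi = N%:R * pi.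
    transitivity (\sum_(i < N) (pi : R)).
      apply: eq_bigr => i _; rewrite (bigD1 i)//= /A eqxx big1 ?addr0// => j ji.
      have -> : (nat_of_ord i == j) = false by apply/negbTE; rewrite eq_sym.
      have [ci si] := cos_sin_natpi i; have [cj sj] := cos_sin_natpi j.
      by rewrite mulrBl sinB si sj mul0r mulr0 subrr mul0r.
    by rewrite sumr_const card_ord mulr_natl.
  rewrite -eA mulr_sumr -sumrB; apply: eq_bigr => i _.
  rewrite mulr_sumr -sumrB; apply: eq_bigr => j _; congr (_ - _).
  have [ci si] := cos_sin_natpi i; have [cj sj] := cos_sin_natpi j.
  rewrite /B mulrDl mulrBl sinD sinB cosB si sj ci cj.
  rewrite !mul0r !mulr0 subr0 addr0; move: (sin _) (_^-1) => a b; ring.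
(* [1 - cos (alpha * t) <= t^2 / 2], while [sin_ge] bounds the kernel by [16 / (cos 1 * t)^2]; the
   product is at most [K]. *)
pose K : R := 8 * (cos 1) ^- 2.
have c1 : 0 < (cos 1 : R) by exact: cos1_gt0.
have dF0 (t : R) : 0 <= t <= pi -> 0 <= dF t.
  by move=> _; rewrite mulr_ge0 ?subr_ge0 ?cos_le1// addr_ge0 ?sqr_ge0.
have dFK (t : R) : 0 <= t <= pi -> dF t <= K.
  move=> /andP[t0 tpi].
  have h1 : cos 1 / 2 * (t / 2) <= sin (t / 2).
    by apply: sin_ge; rewrite divr_ge0//= ler_pM2r.
  have h1' : 0 <= cos 1 / 2 * (t / 2) by rewrite !mulr_ge0 ?invr_ge0 ?(ltW c1).
  have h2 := fejer_bound t N; rewrite -/(C t) -/(S t) in h2.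
  rewrite /dF; move: h2; set q := _ + _ => h2.
  have q0 : 0 <= q by rewrite addr_ge0 ?sqr_ge0.
  have h3 : (cos 1 / 2 * (t / 2)) ^+ 2 * q <= 1.
    by apply: le_trans h2; rewrite ler_wpM2r// !expr2 ler_pM.
  have h4 : 1 - cos (alpha * t) <= t ^+ 2 / 2.
    have -> : alpha * t = (alpha * t / 2) *+ 2 by rewrite -mulr_natr divfK.
    rewrite cos_mulr2n cos2sin2.
    set x := alpha * t / 2.
    have x0 : 0 <= x by rewrite !mulr_ge0 ?invr_ge0 ?(ltW al0).
    have x1 : x <= t / 2 by rewrite ler_pM2r// ler_piMl// ltW.
    have : sin x ^+ 2 <= (t / 2) ^+ 2.
      have sx : 0 <= sin x.
        by apply: sin_ge0_pi; rewrite x0 (le_trans x1)// (le_trans _ tpi)// ler_pdivrMr// ler_peMr// ler1n.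
      by rewrite !expr2 ler_pM// (le_trans (sin_le x0)).
    have -> : (t / 2) ^+ 2 = t ^+ 2 / 4 by field.
    rewrite mulr2n; lra.
  apply: (@le_trans _ _ (t ^+ 2 / 2 * q)); first by rewrite ler_wpM2r.
  rewrite /K; have cc : 0 < (cos 1 : R) ^+ 2 by rewrite exprn_gt0.
  rewrite -[leRHS]/(8 / _) ler_pdivlMr//.
  move: h3; rewrite !expr2; move: (cos 1 : R) => c; lra.
have G1 : 0 <= F pi.
  by rewrite -F0; exact: (@is_derive_ge0_le _ F dF 0 pi (pi_ge0 R) (fun t _ => hF t) dF0).
have G2 : F pi <= K * pi.
  have := @is_derive_ge0_le _ (fun t => K * t - F t) (fun t => K - dF t) 0 pi (pi_ge0 R).
  rewrite F0 mulr0 subrr subr_ge0; apply.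
    move=> t _; have hK : is_derive t (1 : R) (fun t : R => K * t) K.
      by apply: (is_derive_conv (is_derive_scale K (is_derive_id t 1))); rewrite mulr1.
    exact: is_derive_sub hK (hF t).
  by move=> t ht; rewrite subr_ge0 dFK.
by rewrite -Fpi ger0_norm.
Qed.

Definition altsum (alpha : R) n : R := \sum_(k < n) (-1) ^+ k / (k%:R + alpha).

(** The summand depends on [i - j] only. Enlarging the square by one row and one column adds the
    differences [0..N], giving [altsum alpha], and [-1..-N], giving [altsum (1 - alpha)]. *)
Lemma fejer_altsum alpha N : 0 < alpha < 1 ->
  \sum_(i < N) \sum_(j < N) (-1) ^+ i * (-1) ^+ j / (alpha + (i%:R - j%:R)) =
  \sum_(n < N) (altsum alpha n.+1 + altsum (1 - alpha) n).
Proof.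
move=> /andP[al0 al1].
pose f (i j : nat) : R := (-1) ^+ i * (-1) ^+ j / (alpha + (i%:R - j%:R)).
elim: N => [|N IH]; first by rewrite !big_ord0.
rewrite [RHS]big_ord_recr /= -IH big_ord_recr /=.
rewrite (eq_bigr (fun i : 'I_N => \sum_(j < N) f i j + f i N)); last first.
  by move=> i _; rewrite big_ord_recr.
rewrite big_split /= -!addrA; congr (_ + _); rewrite addrC; congr (_ + _).
  rewrite /altsum (reindex_inj rev_ord_inj) /=; apply: eq_bigr => k _.
  have kN : (k <= N)%N by rewrite -ltnS.
  rewrite subSS -exprD natrB// -signr_odd oddD oddB// addbA addbb addFb signr_odd.
  by congr (_ / _); ring.
rewrite /altsum (reindex_inj rev_ord_inj) /=; apply: eq_bigr => k _.
have kN : (k.+1 <= N)%N by [].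
rewrite /f natrB// -exprD -signr_odd oddD oddB// addbC addbA addbb addFb /= signrN signr_odd.
rewrite -natr1 mulNr -mulrN -invrN; congr (_ / _); ring.
Qed.

End Fejer.

Section Reflection.
Context {R : realType}.

Lemma is_derive_compose (f g : R -> R) (x df dg : R) :
  is_derive (g x) 1 f df -> is_derive x 1 g dg ->
  is_derive x 1 (fun y => f (g y)) (df * dg).
Proof. exact: is_derive1_comp. Qed.

Lemma is_derive_eq0_cst (f : R -> R) (a b : R) : a <= b ->
  (forall x, a <= x <= b -> is_derive x 1 f 0) -> f a = f b.
Proof.
move=> ab df; apply/eqP; rewrite eq_le; apply/andP; split.
  exact: (@is_derive_ge0_le _ f (fun=> 0) a b ab df (fun _ _ => lexx 0)).
have dN x : a <= x <= b -> is_derive x 1 (fun y => 0 - f y) (0 - 0 : R).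
  by move=> /df h; exact: is_derive_sub (is_derive_cst 0 x 1) h.
have d0 (x : R) : a <= x <= b -> 0 <= (0 - 0 : R) by rewrite subrr.
have := @is_derive_ge0_le _ _ (fun=> 0 - 0) a b ab dN d0.
by rewrite !sub0r lerN2.
Qed.

(** Expand [1 / (1 + r)] with [r = v^(1 / alpha)] geometrically: the remainder is at most [r^K],
    whose primitive at 1 is [alpha / (K + alpha)]. *)
Lemma iprof_altsum (alpha : R) (al0 : 0 < alpha) K :
  `|iprof al0 0 1 - alpha * altsum alpha K| <= alpha / (K%:R + alpha).
Proof.
have ka (k : nat) : 0 < k%:R + alpha by rewrite ltr_wpDl.
pose p (k : nat) (v : R) := alpha / (k%:R + alpha) * v `^ ((k%:R + alpha) / alpha).
have dp (k : nat) (v : R) : 0 < v -> is_derive v 1 (p k) ((v `^ alpha^-1) ^+ k).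
  move=> v0; apply: (is_derive_conv (is_derive_scale _ (is_derive_powR _ v0))).
  have -> : (k%:R + alpha) / alpha - 1 = alpha^-1 * k%:R by field; rewrite gt_eqF.
  rewrite powRrM powR_mulrn ?powR_ge0// mulrA.
  by rewrite -[RHS]mul1r; congr (_ * _); field; rewrite !gt_eqF.
pose P (v : R) := \sum_(k < K) (-1) ^+ k * p k v.
have dP (v : R) : 0 < v -> is_derive v 1 P (\sum_(k < K) (-1) ^+ k * (v `^ alpha^-1) ^+ k).
  move=> v0; exact: (@is_derive_big_sum R _ (index_enum _)
    (fun (k : 'I_K) v => (-1) ^+ k * p k v) _ v (fun k => is_derive_scale _ (dp k v v0))).
have geo (r : R) n : (1 + r) * (\sum_(k < n) (-1) ^+ k * r ^+ k) = 1 - (-1) ^+ n * r ^+ n.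
  elim: n => [|n IH]; first by rewrite big_ord0 mulr0 !expr0 mulr1 subrr.
  rewrite big_ord_recr /= mulrDr IH !exprS; ring.
have diff (v : R) : 0 < v -> `|prof alpha 0 v - \sum_(k < K) (-1) ^+ k * (v `^ alpha^-1) ^+ k|
    <= (v `^ alpha^-1) ^+ K.
  move=> v0; rewrite prof0E rhoE ?(ltW v0)//.
  have := powR_ge0 v alpha^-1; set r := v `^ _ => r0.
  have r1 : 0 < 1 + r by rewrite ltr_pwDl.
  have -> : (1 + r)^-1 - \sum_(k < K) (-1) ^+ k * r ^+ k = (-1) ^+ K * (r ^+ K / (1 + r)).
    apply: (mulfI (lt0r_neq0 r1)); rewrite mulrBr geo mulfV ?gt_eqF//.
    by field; rewrite gt_eqF.
  rewrite normrM normrX normrN1 expr1n mul1r ger0_norm ?divr_ge0 ?exprn_ge0 ?(ltW r1)//.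
  by rewrite ler_pdivrMr// ler_peMr ?exprn_ge0// lerDl.
have pd k d : 0 < d <= 1 -> 0 <= p k d <= d.
  move=> /andP[d0 d1]; apply/andP; split.
    by rewrite mulr_ge0 ?powR_ge0// divr_ge0 ?(ltW al0) ?(ltW (ka k)).
  rewrite -[leRHS]mul1r ler_pM ?powR_ge0 ?divr_ge0 ?(ltW al0) ?(ltW (ka k))//.
    by rewrite ler_pdivrMr// mul1r lerDr.
  by apply: ge1r_powR; [rewrite d0|rewrite ler_pdivlMr// mul1r lerDr].
have Pd d : 0 < d <= 1 -> `|P d| <= K%:R * d.
  move=> d01; apply: le_trans (ler_norm_sum _ _ _) _.
  rewrite -[K%:R * d]/(_ * _) -[X in X%:R * d]card_ord mulr_natl -sumr_const.
  apply: ler_sum => k _; have /andP[h1 h2] := pd k d d01.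
  by rewrite normrM normrX normrN1 expr1n mul1r ger0_norm.
have P1 : P 1 = alpha * altsum alpha K.
  rewrite /P /altsum mulr_sumr; apply: eq_bigr => k _.
  by rewrite /p powR1 mulr1 mulrCA.
have p1 : p K 1 = alpha / (K%:R + alpha) by rewrite /p powR1 mulr1.
rewrite -P1 -p1; apply/ler_addgt0Pr => e e0.
(* The powers are differentiated only at positive points, so the comparison starts at [d], where all
   primitives together amount to at most [(K + 2) * d]. *)
pose d := Num.min 1 (e / (K%:R + 2)).
have K2 : 0 < (K%:R + 2 : R) by rewrite ltr_wpDl.
have d0 : 0 < d by rewrite lt_min ltr01 divr_gt0.
have d1 : d <= 1 by rewrite ge_min lexx.
have de : (K%:R + 2) * d <= e.
  by rewrite mulrC -ler_pdivlMr// ge_min lexx orbT.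
have d01 : 0 < d <= 1 by rewrite d0.
have i0 : 0 <= iprof al0 0 d <= d.
  have := @iprof_incr R alpha al0 0 0 d (lexx 0); rewrite lexx (ltW d0) => /(_ isT).
  rewrite iprof0 !subr0 => /andP[h1 h2]; apply/andP; split.
    by apply: le_trans h1; rewrite mulr_ge0 ?(ltW d0)// ltW// prof_gt0.
  by apply: le_trans h2 _; rewrite ler_piMl ?(ltW d0)// prof_le1.
have b1 : p K d - (iprof al0 0 d - P d) <= p K 1 - (iprof al0 0 1 - P 1).
  apply: (@is_derive_ge0_le _ (fun v => p K v - (iprof al0 0 v - P v))
    (fun v => (v `^ alpha^-1) ^+ K - (prof alpha 0 v -
      \sum_(k < K) (-1) ^+ k * (v `^ alpha^-1) ^+ k))); first exact: d1.
    move=> v /andP[dv _]; have v0 := lt_le_trans d0 dv.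
    exact: (is_derive_sub (dp K v v0) (is_derive_sub (is_derive_iprof al0 0 (ltW v0)) (dP v v0))).
  move=> v /andP[dv _]; have v0 := lt_le_trans d0 dv.
  by rewrite subr_ge0; exact: le_trans (ler_norm _) (diff v v0).
have b2 : p K d - (P d - iprof al0 0 d) <= p K 1 - (P 1 - iprof al0 0 1).
  apply: (@is_derive_ge0_le _ (fun v => p K v - (P v - iprof al0 0 v))
    (fun v => (v `^ alpha^-1) ^+ K - (
      \sum_(k < K) (-1) ^+ k * (v `^ alpha^-1) ^+ k - prof alpha 0 v))); first exact: d1.
    move=> v /andP[dv _]; have v0 := lt_le_trans d0 dv.
    exact: (is_derive_sub (dp K v v0) (is_derive_sub (dP v v0) (is_derive_iprof al0 0 (ltW v0)))).
  move=> v /andP[dv _]; have v0 := lt_le_trans d0 dv.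
  by rewrite subr_ge0; apply: le_trans (ler_norm _) _; rewrite distrC; exact: diff.
have /andP[q1 q2] := pd K d d01.
have := Pd d d01; rewrite !ler_norml => /andP[q3 q4].
have q5 : K%:R * d + 2 * d <= e by rewrite -mulrDl.
have /andP[i1 i2] := i0.
by apply/andP; split; lra.
Qed.

(* The half [v >= 1] is turned into the half [w <= 1] for the exponent
   [1 - alpha] by [w = v `^ (- (1 - alpha) / alpha)]. *)
Lemma cprof_split (alpha : R) (al0 : 0 < alpha) (al1 : alpha < 1) (be0 : 0 < 1 - alpha) :
  cprof al0 0 = iprof al0 0 1 + alpha / (1 - alpha) * iprof be0 0 1.
Proof.
set be := 1 - alpha in be0 *; pose c := - (be / alpha).
have c0 : c < 0 by rewrite oppr_lt0 divr_gt0.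
pose F (v : R) := iprof al0 0 v + alpha / be * iprof be0 0 (v `^ c).
have dF (v : R) : 0 < v -> is_derive v 1 F 0.
  move=> v0; have vc : 0 <= v `^ c by exact: powR_ge0.
  have h1 := is_derive_iprof al0 0 (ltW v0).
  have h2 := @is_derive_compose (iprof be0 0) (fun y => y `^ c) v _ _ (is_derive_iprof be0 0 vc) (is_derive_powR c v0).
  apply: (is_derive_conv (is_deriveD h1 (is_derive_scale (alpha / be) h2))).
  rewrite !prof0E !rhoE ?(ltW v0)//.
  have -> : (v `^ c) `^ be^-1 = (v `^ alpha^-1)^-1.
    by rewrite -powRrM -powRN; congr (_ `^ _); rewrite /c; field; rewrite !gt_eqF.
  have -> : c - 1 = - alpha^-1 by rewrite /c /be; field; rewrite gt_eqF.
  rewrite powRN; have := powR_gt0 alpha^-1 v0; set r := v `^ _ => r0.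
  rewrite /c; field; rewrite !gt_eqF// ?addr_gt0//.
have Fc (L : R) : 1 <= L -> iprof al0 0 L =
    iprof al0 0 1 + alpha / be * iprof be0 0 1 - alpha / be * iprof be0 0 (L `^ c).
  move=> L1; have dF1 v : 1 <= v <= L -> is_derive v 1 F 0.
    by move=> /andP[v1 _]; exact: dF (lt_le_trans ltr01 v1).
  have := is_derive_eq0_cst L1 dF1.
  by rewrite /F powR1 => ->; rewrite addrK.
have lim1 := @cprof_cvg R alpha al0 al1 0 (lexx 0).
have lim2 : iprof al0 0 k%:R @[k --> \oo] --> iprof al0 0 1 + alpha / be * iprof be0 0 1.
  apply/cvgrPdist_le => e e0.
  pose e1 := Num.min 1 (e / (alpha / be)).
  have ab : 0 < alpha / be by rewrite divr_gt0.
  have e10 : 0 < e1 by rewrite lt_min ltr01 divr_gt0.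
  near=> k; have k1 : (1 : R) <= k%:R by near: k; exact: nbhs_infty_ger.
  have kc : e1 `^ c^-1 <= k%:R by near: k; exact: nbhs_infty_ger.
  rewrite (Fc _ k1) opprB addrCA subrr addr0.
  have ke : k%:R `^ c <= e1.
    have -> : e1 = (e1 `^ c^-1) `^ c by rewrite -powRrM mulVf ?lt_eqF// powRr1// ltW.
    have N z : z `^ c = (z `^ (- c))^-1 by rewrite -powRN opprK.
    rewrite !(N (_ `^ _)) (N k%:R) lef_pV2 ?posrE ?powR_gt0 ?(lt_le_trans ltr01 k1)//.
    by apply: ge0_ler_powR; rewrite ?nnegrE ?powR_ge0// oppr_ge0 ltW.
  have i0 : 0 <= iprof be0 0 (k%:R `^ c) <= e1.
    have := @iprof_incr R be be0 0 0 (k%:R `^ c) (lexx 0); rewrite lexx powR_ge0 => /(_ isT).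
    rewrite iprof0 !subr0 => /andP[h1 h2]; apply/andP; split.
      by apply: le_trans h1; rewrite mulr_ge0 ?powR_ge0// ltW// prof_gt0.
    by apply: le_trans h2 (le_trans _ ke); rewrite ler_piMl ?powR_ge0// prof_le1.
  have /andP[i1 i2] := i0.
  rewrite ger0_norm ?(mulr_ge0 (ltW ab) i1)// mulrC -ler_pdivlMr//.
  by rewrite (le_trans i2)// ge_min lexx orbT.
by rewrite -(cvg_lim (@norm_hausdorff _ _) lim1) (cvg_lim (@norm_hausdorff _ _) lim2).
Unshelve. all: by end_near. Qed.

(** The Fejer double sum is a sum of partial sums, so its mean over [N] tends to [cprof / alpha] by
    Cesaro; dividing the bounded error in [fejer_reflection] by [N] shows that [sin (alpha * pi)]
    times this mean tends to [pi]. *)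
Lemma cprof_reflection (alpha : R) (al0 : 0 < alpha) : alpha < 1 ->
  sin (alpha * pi) * cprof al0 0 = alpha * pi.
Proof.
move=> al1; have be0 : 0 < 1 - alpha by rewrite subr_gt0.
have al01 : 0 < alpha < 1 by rewrite al0.
have cva (a : R) (a0 : 0 < a) : altsum a k @[k --> \oo] --> iprof a0 0 1 / a.
  apply/cvgrPdist_le => e e0; near=> k.
  have : e^-1 <= k%:R by near: k; exact: nbhs_infty_ger.
  move=> ke; have k0 : 0 < (k%:R : R) by apply: lt_le_trans ke; rewrite invr_gt0.
  have := iprof_altsum a0 k.
  have -> : iprof a0 0 1 - a * altsum a k = a * (iprof a0 0 1 / a - altsum a k).
    by field; rewrite gt_eqF.
  rewrite normrM gtr0_norm// ler_pM2l// => /le_trans; apply.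
  rewrite -[e]invrK lef_pV2 ?posrE ?invr_gt0 ?addr_gt0//.
  by apply: le_trans ke _; rewrite lerDl ltW.
pose S n := altsum alpha n.+1 + altsum (1 - alpha) n.
have cvS : S n @[n --> \oo] --> cprof al0 0 / alpha.
  have -> : cprof al0 0 / alpha = iprof al0 0 1 / alpha + iprof be0 0 1 / (1 - alpha).
    by rewrite (cprof_split al0 al1 be0); field; rewrite !gt_eqF.
  apply: cvgD; last exact: cva.
  have := cva _ al0; rewrite -cvg_shiftS; exact.
have := cesaro cvS.
have cvpi : sin (alpha * pi) * arithmetic_mean S n @[n --> \oo] --> (pi : R).
  apply/cvgrPdist_le => e e0; near=> n.
  pose K : R := 8 * (cos 1) ^- 2 * pi.
  have ke : K / e <= n.+1%:R.
    have : K / e <= n%:R by near: n; exact: nbhs_infty_ger.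
    by move/le_trans; apply; rewrite ler_nat.
  have n0 : (0 : R) < n.+1%:R by rewrite ltr0n.
  have := fejer_reflection n.+1 al01; rewrite fejer_altsum// -/K => h.
  rewrite /arithmetic_mean /= /series /= big_mkord.
  rewrite -(ler_pM2l n0) -[X in X * `|_|]gtr0_norm// -normrM mulrBr.
  have -> : n.+1%:R * (sin (alpha * pi) * (n.+1%:R^-1 * \sum_(i < n.+1) S i)) =
     sin (alpha * pi) * \sum_(i < n.+1) S i.
    by rewrite mulrCA mulVKf ?gt_eqF.
  by apply: le_trans h _; rewrite mulrC -ler_pdivrMl// mulrC.
move=> h; have h' : sin (alpha * pi) * arithmetic_mean S n @[n --> \oo] -->
   sin (alpha * pi) * (cprof al0 0 / alpha) by apply: cvgMr; exact: h.
have : pi = sin (alpha * pi) * (cprof al0 0 / alpha).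
  exact: etrans (esym (cvg_lim (@norm_hausdorff _ _) cvpi)) (cvg_lim (@norm_hausdorff _ _) h').
by move=> e; rewrite [in RHS]e mulrCA; congr (_ * _); rewrite mulrC divfK// gt_eqF.
Unshelve. all: by end_near. Qed.

End Reflection.

(** * Identification of the limit with the arcsine integral *)

Section ArcsineLaw.
Context {R : realType} (alpha : R).
Hypothesis al0 : 0 < alpha.
Hypothesis al1 : alpha < 1.

Lemma is_derive_odds (s : R) : s < 1 ->
  is_derive s 1 (fun s : R => s * (1 - s)^-1) ((1 - s) ^- 2).
Proof.
move=> s1; have s0 : 1 - s != 0 by rewrite gt_eqF// subr_gt0.
have h1 := @is_derive_sub R (fun=> 1) (fun s => s) s 0 1 (is_derive_cst (1 : R) s 1) (is_derive_id s 1).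
have h2 : is_derive s (1 : R) (fun s : R => (1 - s)^-1) ((1 - s) ^- 2).
  apply: (is_derive_conv (@is_deriveV R (fun s : R => 1 - s) s _ _ s0 h1)).
  by rewrite sub0r /GRing.scale /= mulrN1 opprK.
apply: (is_derive_conv (is_derive_mul (is_derive_id s 1) h2)).
by rewrite mul1r; field.
Qed.

Definition asl_prim (s : R) : R := iprof al0 0 (Num.max (s * (1 - s)^-1) 0 `^ alpha) / alpha.

Lemma is_derive_asl_prim (s : R) : 0 < s < 1 ->
  is_derive s 1 asl_prim (s `^ (alpha - 1) * (1 - s) `^ (- alpha)).
Proof.
move=> /andP[s0 s1]; have t0 : 0 < 1 - s by rewrite subr_gt0.
have o0 : 0 < s * (1 - s)^-1 by rewrite divr_gt0.
pose G (s : R) := alpha^-1 * iprof al0 0 ((s * (1 - s)^-1) `^ alpha).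
have GE : \forall y \near s, G y = asl_prim y.
  near=> y; rewrite /G /asl_prim mulrC max_l// divr_ge0//.
    by apply: ltW; near: y; exact: lt_nbhsr.
  by rewrite subr_ge0; apply: ltW; near: y; exact: lt_nbhsl.
apply: (near_eq_is_derive GE).
have p0 := powR_ge0 (s * (1 - s)^-1) alpha.
apply: (is_derive_conv (is_derive_scale alpha^-1
  (@is_derive_compose R (iprof al0 0) (fun s => (s * (1 - s)^-1) `^ alpha) s _ _ (is_derive_iprof al0 0 p0)
  (@is_derive_compose R (fun z => z `^ alpha) (fun s => s * (1 - s)^-1) s _ _
    (is_derive_powR alpha o0) (is_derive_odds s1))))).
rewrite prof0E rho_powR ?(ltW o0)// powRM ?invr_ge0 ?(ltW s0) ?(ltW t0)//.
have -> : (1 - s)^-1 `^ (alpha - 1) = (1 - s) * (1 - s) `^ (- alpha).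
  rewrite -powR_inv1 ?(ltW t0)// -powRrM -{2}[1 - s]powRr1 ?(ltW t0)// -powRD.
    by congr (_ `^ _); ring.
  by apply/implyP => _; rewrite gt_eqF.
move: (s `^ _) ((1 - s) `^ _) => a b.
by field; rewrite !gt_eqF//=; lra.
Unshelve. all: by end_near. Qed.

Lemma asl_prim0 : asl_prim 0 = 0.
Proof. by rewrite /asl_prim mul0r maxxx powR0 ?gt_eqF// iprof0 mul0r. Qed.

Lemma continuous_asl_prim (s : R) : s < 1 -> {for s, continuous asl_prim}.
Proof.
move=> s1.
have h1 : {for s, continuous (fun s : R => Num.max (s * (1 - s)^-1) 0 `^ alpha)}.
  apply: (@continuous_comp _ _ _ (fun s : R => s * (1 - s)^-1) (fun y => Num.max y 0 `^ alpha)).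
    exact: is_derive_continuous (is_derive_odds s1).
  exact: continuous_powR_max.
have h2 : {for s, continuous (fun s : R => iprof al0 0 (Num.max (s * (1 - s)^-1) 0 `^ alpha))}.
  apply: (@continuous_comp _ _ _ _ (iprof al0 0) _ h1).
  by apply: is_derive_continuous; apply: is_derive_iprof; exact: powR_ge0.
exact: cvgMl h2.
Qed.

Lemma asl_integral (y : R) : 0 < y < 1 ->
  Rintegral (@lebesgue_measure R) `]0, y[ (fun s => s `^ (alpha - 1) * (1 - s) `^ (- alpha)) =
  asl_prim y.
Proof.
move=> /andP[y0 y1].
pose f (s : R) := s `^ (alpha - 1) * (1 - s) `^ (- alpha).
(* The integrand may blow up at 0 and the interval is open, so it is exhausted by compact intervals;
   the offset 3 keeps [a n < b n] from [n = 0] on. *)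
pose a (n : nat) : R := y / n.+3%:R.
pose b (n : nat) : R := y - y / n.+3%:R.
have a0 n : 0 < a n by rewrite divr_gt0.
have ab n : a n < b n.
  have : 3 * a n <= y.
    by rewrite /a mulrCA ger_pMr// ler_pdivrMr// mul1r ler_nat.
  by have := a0 n; rewrite /b -/(a n); lra.
have by_ n : b n < y by rewrite gtrBl a0.
have fc (s : R) : 0 < s < 1 -> {for s, continuous f}.
  move=> /andP[s0 s1]; apply: cvgM; first exact: continuous_powR_gt0.
  apply: (@continuous_comp _ _ _ (fun s : R => 1 - s) (fun y => y `^ (- alpha))).
    by apply: cvgB; [exact: cvg_cst|exact: cvg_id].
  by apply: continuous_powR_gt0; rewrite subr_gt0.
have fw n : {within `[a n, b n], continuous f}.
  apply: continuous_in_subspaceT => s; rewrite inE /= in_itv /= => /andP[s1 s2].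
  by apply: fc; rewrite (lt_le_trans (a0 n) s1) (le_lt_trans s2)// (lt_trans (by_ n)).
have I n : (\int[@lebesgue_measure R]_(x in `[a n, b n]) (f x)%:E =
    (asl_prim (b n))%:E - (asl_prim (a n))%:E)%E.
  have in01 (s : R) : s \in `]a n, b n[ -> 0 < s < 1.
    rewrite in_itv /= => /andP[h1 h2].
    by rewrite (lt_trans (a0 n) h1) (lt_trans h2)// (lt_trans (by_ n)).
  apply: continuous_FTC2; [exact: ab|exact: fw| |].
    split.
    - by move=> s /in01 h; have [] := is_derive_asl_prim h.
    - apply: cvg_at_right_filter; apply: continuous_asl_prim.
      exact: lt_trans (ab n) (lt_trans (by_ n) y1).
    - apply: cvg_at_left_filter; apply: continuous_asl_prim.
      exact: (lt_trans (by_ n) y1).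
  by move=> s /in01 h; rewrite derive1E; have [_] := is_derive_asl_prim h.
have cup : \bigcup_n `[a n, b n]%classic = `]0, y[%classic.
  apply/seteqP; split => s /=.
    move=> [n _] /=; rewrite !in_itv /= => /andP[h1 h2].
    by rewrite (lt_le_trans (a0 n) h1) (le_lt_trans h2).
  rewrite in_itv /= => /andP[s0 sy].
  pose e := Num.min s (y - s); have e0 : 0 < e by rewrite lt_min s0 subr_gt0.
  exists (Num.truncn (y / e)) => //=; rewrite in_itv /=.
  have h : y / (Num.truncn (y / e)).+3%:R <= e.
    rewrite ler_pdivrMr// mulrC -ler_pdivrMr//; apply: (le_trans (ltW (truncnS_gt _))).
    by rewrite ler_nat ltnW.
  have /andP[h1 h2] : (e <= s) && (e <= y - s) by rewrite !ge_min !lexx orbT.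
  rewrite /a /b; have {h1} := le_trans h h1; have {h2} := le_trans h h2.
  by move: (y / _) => z *; apply/andP; split; lra.
have nd : nondecreasing_seq (fun n => `[a n, b n]%classic).
  apply/nondecreasing_seqP => n; rewrite subsetEset => s /=; rewrite !in_itv /=.
  have : y / n.+4%:R <= y / n.+3%:R by rewrite ler_pM2l// lef_pV2 ?posrE// ler_nat.
  rewrite /a /b; move: (y / _) (y / _) => z w h /andP[h1 h2]; apply/andP; split; lra.
have C1 : (\int[@lebesgue_measure R]_(x in `[a n, b n]) (f x)%:E)%E @[n --> \oo] -->
    (\int[@lebesgue_measure R]_(x in \bigcup_n `[a n, b n]%classic) (f x)%:E)%E.
  apply: ge0_nondecreasing_set_cvg_integral.
  - exact: nd.
  - by move=> n; exact: measurable_itv.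
  - by move=> n; apply/measurable_EFinP; apply: subspace_continuous_measurable_fun.
  - by move=> n x _; rewrite lee_fin mulr_ge0 ?powR_ge0.
rewrite cup in C1.
have a_0 : a n @[n --> \oo] --> (0 : R).
  rewrite -[0](mulr0 y); apply: cvgMr.
  have := @cvg_harmonic R; rewrite -(cvg_shiftn 2); apply: cvg_trans.
  by apply: near_eq_cvg; apply: nearW => n; rewrite /harmonic /= addn2.
have C2 : (asl_prim (b n) - asl_prim (a n)) @[n --> \oo] --> asl_prim y.
  rewrite -[asl_prim y]subr0 -[X in _ - X]asl_prim0; apply: cvgB.
    apply: continuous_cvg; first exact: continuous_asl_prim.
    by rewrite -[X in _ --> X]subr0; apply: cvgB; [exact: cvg_cst|exact: a_0].
  by apply: continuous_cvg; [apply: continuous_asl_prim|exact: a_0].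
have C3 : (\int[@lebesgue_measure R]_(x in `[a n, b n]) (f x)%:E)%E @[n --> \oo] -->
    (asl_prim y)%:E.
  apply: cvg_EFin; first by apply: nearW => n; rewrite I.
  by apply: cvg_trans C2; apply: near_eq_cvg; apply: nearW => n /=; rewrite I.
rewrite /Rintegral; have -> : (\int[@lebesgue_measure R]_(x in `]0%R, y[) (f x)%:E)%E = (asl_prim y)%:E.
  exact: etrans (esym (cvg_lim (@ereal_hausdorff _) C1)) (cvg_lim (@ereal_hausdorff _) C3).
by [].
Qed.

(** The odds of [1 / (1 + th)] are [1 / th], and the reflection formula cancels the prefactor
    against the normalisation of [Hlaw]. *)
Lemma AslE (th : R) : 0 < th -> Asl R alpha (1 / (1 + th)) = Hlaw al0 th^-1.
Proof.
move=> th0; have t1 : 0 < 1 + th by rewrite addr_gt0.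
rewrite /Asl asl_integral; last by rewrite divr_gt0//= ltr_pdivrMr// mul1r ltrDl.
have c0 := @cprof_gt0 R alpha al0 al1 0 (lexx 0).
have -> : asl_prim (1 / (1 + th)) = Hlaw al0 th^-1 * cprof al0 0 / alpha.
  rewrite /asl_prim /Hlaw divfK ?gt_eqF//; congr (iprof _ _ (Num.max _ _ `^ _) / _).
  by field; rewrite !gt_eqF//=; lra.
have := @cprof_reflection R alpha al0 al1.
have pi0 := pi_gt0 R; move: (pi : R) (sin _) pi0 => p s p0 e.
have -> : s / p * (Hlaw al0 th^-1 * cprof al0 0 / alpha) = Hlaw al0 th^-1 * (s * cprof al0 0) / (p * alpha).
  by field; rewrite !gt_eqF.
by rewrite e; field; rewrite !gt_eqF.
Qed.

End ArcsineLaw.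

(** * Probability estimates *)

Section ProbabilityTools.
Context {R : realType} {d : measure_display} {T : measurableType d} (P : probability T R).

Definition prb (A : set T) : R := fine (P A).

Lemma prb_ge0 A : 0 <= prb A.
Proof. by rewrite fine_ge0. Qed.

Lemma prbE A : measurable A -> (prb A)%:E = P A.
Proof. by move=> mA; rewrite fineK// fin_num_measure. Qed.

Lemma prb_le A B : measurable A -> measurable B -> A `<=` B -> prb A <= prb B.
Proof.
by move=> mA mB AB; rewrite -lee_fin !prbE// le_measure// inE.
Qed.

Lemma prb_le1 A : measurable A -> prb A <= 1.
Proof. by move=> mA; rewrite -lee_fin prbE// probability_le1. Qed.

Lemma prbT : prb setT = 1.
Proof. by rewrite /prb probability_setT. Qed.

Lemma prb_setC A : measurable A -> prb (~` A) = 1 - prb A.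
Proof.
move=> mA; have := probability_setC P mA; rewrite /prb => ->.
by rewrite -(prbE mA).
Qed.

Lemma level_markov (I : finType) (A : I -> set T) (c : I -> R) (k : R) :
  (forall i, measurable (A i)) -> (forall i, 0 <= c i) -> 0 <= k ->
  measurable [set w | k <= \sum_i c i * \1_(A i) w] /\
  k * prb [set w | k <= \sum_i c i * \1_(A i) w] <= \sum_i c i * prb (A i).
Proof.
move=> mA c0 k0; set S := fun w => \sum_i c i * \1_(A i) w.
have mi i : measurable_fun setT (fun w => c i * \1_(A i) w).
  by apply: measurable_funM; [exact: measurable_cst|exact: measurable_indic].
have mS : measurable_fun setT S by exact: measurable_sum.
set E := [set w | k <= _].
have mE : measurable E.
  have -> : E = setT `&` S @^-1` `[k, +oo[.
    by apply/seteqP; split => w; rewrite /E /= in_itv /= andbT // => -[].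
  by apply: mS => //; exact: measurable_itv.
split=> //; rewrite -lee_fin EFinM prbE// -sumEFin.
have -> : (k%:E * P E = \int[P]_w (k%:E * (\1_E w)%:E))%E.
  rewrite ge0_integralZl_EFin// ?integral_indic ?setIT//.
  by apply/measurable_EFinP; exact: measurable_indic.
have -> : (\sum_i (c i * prb (A i))%:E = \int[P]_w (\sum_i (c i * \1_(A i) w)%:E))%E.
  rewrite ge0_integral_sum//.
  - apply: eq_bigr => i _; rewrite EFinM prbE//.
    under [RHS]eq_integral do rewrite EFinM.
    rewrite ge0_integralZl_EFin// ?integral_indic ?setIT//.
    by apply/measurable_EFinP; exact: measurable_indic.
  - by move=> i; apply/measurable_EFinP; exact: mi.
  - by move=> i w _; rewrite lee_fin mulr_ge0.
apply: ge0_le_integral => //.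
- by move=> w _; rewrite mule_ge0 ?lee_fin.
- apply/measurable_EFinP; apply: measurable_funM; first exact: measurable_cst.
  exact: measurable_indic.
- under eq_fun do rewrite sumEFin; exact/measurable_EFinP.
move=> w _; rewrite sumEFin -EFinM lee_fin indicE.
case: (boolP (w \in E)) => [|_]; first by rewrite inE /E /= mulr1.
by rewrite mulr0 sumr_ge0// => i _; rewrite mulr_ge0.
Qed.

(** The product is expanded over choice functions into [option J], where [None] picks the summand 1;
    independence factorises every term, and Markov's inequality is applied to a finite combination
    of indicators. *)
Lemma chernoff (I J : finType) (B : I -> J -> set T) (c : J -> R) (M : R) :
  (forall i j, measurable (B i j)) -> (forall j, 0 <= c j) -> 0 <= M ->
  (forall f : I -> option J,
    prb (\bigcap_i (if f i is Some j then B i j else setT)) =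
    \prod_i prb (if f i is Some j then B i j else setT)) ->
  measurable [set w | M <= \prod_i (1 + \sum_j c j * \1_(B i j) w)] /\
  M * prb [set w | M <= \prod_i (1 + \sum_j c j * \1_(B i j) w)] <=
    \prod_i (1 + \sum_j c j * prb (B i j)).
Proof.
move=> mB c0 M0 ind.
pose B' i (j : option J) : set T := if j is Some j then B i j else setT.
pose c' (j : option J) : R := if j is Some j then c j else 1.
have optE (F : option J -> R) : \sum_j F j = F None + \sum_j F (Some j).
  rewrite (bigD1 None)//=; congr (_ + _).
  rewrite (reindex_omap Some id) /=; last by case.
  by apply: eq_bigl => j; rewrite eqxx.
have mB' i j : measurable (B' i j) by case: j => [j|] /=.
pose A (f : {ffun I -> option J}) : set T := \bigcap_i B' i (f i).
have mA f : measurable (A f).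
  apply: fin_bigcap_measurable => //; exact: finite_finset.
have c'0 (f : {ffun I -> option J}) : 0 <= \prod_i c' (f i).
  by apply: prodr_ge0 => i _; case: (f i) => [j|] /=.
have [m1 m2] := @level_markov _ A (fun f => \prod_i c' (f i)) M mA c'0 M0.
have e w : \sum_(f : {ffun I -> option J}) (\prod_i c' (f i)) * \1_(A f) w = \prod_i (1 + \sum_j c j * \1_(B i j) w).
  transitivity (\prod_i \sum_j c' j * \1_(B' i j) w); last first.
    apply: eq_bigr => i _; rewrite optE /= indicT mulr1//.
  rewrite bigA_distr_bigA /=; apply: eq_bigr => f _.
  rewrite big_split /=; congr (_ * _).
  rewrite indicE; case: (boolP (w \in A f)) => wA.
    rewrite big1// => i _; rewrite indicE mem_set//.
    by move: wA; rewrite inE => /(_ i); exact.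
  have [i wi] : exists i, ~ B' i (f i) w.
    apply: contrapT => h; move/negP: wA; apply; rewrite inE => i _.
    by apply: contrapT => hi; apply: h; exists i.
  rewrite (bigD1 i)//= indicE memNset//= mul0r//.
have e2 : \sum_(f : {ffun I -> option J}) (\prod_i c' (f i)) * prb (A f) = \prod_i (1 + \sum_j c j * prb (B i j)).
  transitivity (\prod_i \sum_j c' j * prb (B' i j)); last first.
    by apply: eq_bigr => i _; rewrite optE /= prbT mulr1.
  rewrite bigA_distr_bigA /=; apply: eq_bigr => f _.
  by rewrite big_split /=; congr (_ * _); exact: ind.
have es : [set w | M <= \sum_(f : {ffun I -> option J}) (\prod_i c' (f i)) * \1_(A f) w] =
    [set w | M <= \prod_i (1 + \sum_j c j * \1_(B i j) w)].
  by apply/seteqP; split => w /=; rewrite e.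
by split; rewrite -es// -e2.
Qed.

(** Summability is witnessed by a telescoping majorant, so the partial sums are bounded by one value
    of [g]. *)
Lemma borel_cantelli_telescope (F : nat -> set T) (g : nat -> R) :
  (forall n, measurable (F n)) -> (forall n, 0 <= g n) ->
  (\forall n \near \oo, prb (F n) <= g n - g n.+1) ->
  \forall w \ae P, \forall n \near \oo, ~ F n w.
Proof.
move=> mF g0 [m _ hm].
pose G n := F (n + m)%N.
have mG n : measurable (G n) by exact: mF.
have hG n : prb (G n) <= g (n + m)%N - g (n + m).+1 by apply: hm; rewrite /= leq_addl.
have nul : P (lim_sup_set G) = 0%E.
  apply: lim_sup_set_cvg0 => //.
  apply: (@le_lt_trans _ _ (g m)%:E); last exact: ltry.
  apply: lime_le; first exact: is_cvg_nneseries.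
  apply: nearW => k; rewrite big_mkord.
  have -> : (\sum_(i < k) P (G i) = (\sum_(i < k) prb (G i))%:E)%E.
    by rewrite -sumEFin; apply: eq_bigr => i _; rewrite prbE.
  rewrite lee_fin.
  suff : \sum_(i < k) prb (G i) <= g m - g (k + m)%N.
    by move/le_trans; apply; rewrite gerBl.
  elim: k => [|k IH]; first by rewrite big_ord0 subrr.
  rewrite big_ord_recr /= addSn; have := hG k; lra.
exists (lim_sup_set G); split => //.
  by apply: bigcap_measurable => // n _; exact: bigcup_measurable.
move=> w /= hw n _; apply: contrapT => h; apply: hw.
exists (n + m)%N => // k /= nk Fk; apply: h; exists (k - m)%N => /=.
  by rewrite leq_subRL ?(leq_trans _ nk)// ?leq_addl// addnC.
by rewrite /G subnK// (leq_trans _ nk)// leq_addl.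
Qed.

End ProbabilityTools.

(** * Depth scale and number of deep traps *)

Section Scales.
Context {R : realType}.

Lemma powR_le (p x y : R) : 0 <= p -> 0 <= x -> x <= y -> x `^ p <= y `^ p.
Proof.
move=> p0 x0 xy; apply: ge0_ler_powR => //; rewrite nnegrE//; exact: le_trans xy.
Qed.

Lemma powR_invK (p x : R) : 0 < p -> 0 <= x -> (x `^ p^-1) `^ p = x.
Proof. by move=> p0 x0; rewrite -powRrM mulVf ?gt_eqF// powRr1. Qed.

Lemma near_le_powR (p U : R) : 0 < p -> \forall n \near \oo, U <= n.+1%:R `^ p.
Proof.
move=> p0; near=> n.
have h : Num.max U 0 `^ p^-1 <= n.+1%:R.
  apply: (@le_trans _ _ n%:R); last by rewrite ler_nat.
  by near: n; exact: nbhs_infty_ger.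
apply: (@le_trans _ _ (Num.max U 0)); first by rewrite le_max lexx.
rewrite -[leLHS](powR_invK p0) ?le_max ?lexx ?orbT//.
by apply: powR_le h; rewrite ?powR_ge0 ?(ltW p0).
Unshelve. all: by end_near. Qed.

Lemma gdiag_bounds : exists c1 c2 : R, [/\ 0 < c1, 0 < c2 &
  forall n, c1 * n.+1%:R <= gdiag n <= c2 * n.+1%:R].
Proof.
have c : (0 : R) < cos 1 ^- 2 by rewrite invr_gt0 exprn_gt0// cos1_gt0.
have p : (0 : R) < (4 * pi ^+ 2)^-1 by rewrite invr_gt0 mulr_gt0// exprn_gt0// pi_gt0.
exists (4 * pi ^+ 2)^-1, (32 * cos 1 ^- 2); split; [exact: p|by rewrite mulr_gt0|].
move=> n; apply/andP; split; first exact: green_diag_ge.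
apply: le_trans green_diag_le _.
have -> : 32 * cos 1 ^- 2 * n.+1%:R = 16 * cos 1 ^- 2 * (2 * n.+1%:R) :> R by move: (_ ^- 2) => z; ring.
rewrite ler_pM2l ?mulr_gt0// -natrM ler_nat; lia.
Qed.

Context (alpha gamma : R).
Hypothesis al0 : 0 < alpha.
Hypothesis al1 : alpha < 1.
Hypothesis ga0 : 0 < gamma.
Hypothesis ga1 : gamma < 1 / 6.

(* On the time scale [tw] the walk visits a site [gdiag n] times, so a trap of
   depth [rsc n] is left after a time of order [tw]; the torus carries about
   [bsc n] such traps. *)
Definition rsc (n : nat) : R := tw R alpha gamma n.+1 / gdiag n.

Definition bsc (n : nat) : R := (4 ^ n.+1)%:R * rsc n `^ (- alpha).

Lemma gdiag_gt0 n : 0 < gdiag n :> R.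
Proof. exact: green_diag_gt0. Qed.

Lemma tw_gt0 n : 0 < tw R alpha gamma n.+1.
Proof. by rewrite mulr_gt0 ?powR_gt0. Qed.

Lemma rsc_gt0 n : 0 < rsc n.
Proof. exact: divr_gt0 (tw_gt0 n) (gdiag_gt0 n). Qed.

Lemma bsc_gt0 n : 0 < bsc n.
Proof. by rewrite mulr_gt0 ?powR_gt0 ?rsc_gt0// ltr0n expn_gt0. Qed.

(** The exponents of [tw] are made for this: the volume cancels, and since [gdiag n] is of order [n]
    the number of deep traps is of order [n^gamma]. *)
Lemma bscE n : bsc n = n.+1%:R `^ gamma * (gdiag n / n.+1%:R) `^ alpha.
Proof.
have m0 : (0 : R) < n.+1%:R by [].
rewrite /bsc /rsc /tw; have := gdiag_gt0 n; move: (gdiag n : R) => a a0.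
set m : R := n.+1%:R in m0 *.
rewrite !powRM ?invr_ge0 ?powR_ge0 ?(ltW a0) ?(ltW m0) ?mulr_ge0 ?powR_ge0//.
rewrite -!powRrM.
have -> : 2 * m / alpha * - alpha = - (2 * m) by field; rewrite gt_eqF.
have -> : (1 - gamma / alpha) * - alpha = gamma - alpha by field; rewrite gt_eqF.
have -> : a^-1 `^ (- alpha) = a `^ alpha.
  by rewrite -powR_inv1 ?(ltW a0)// -powRrM; congr (_ `^ _); ring.
have -> : m^-1 `^ alpha = m `^ (- alpha).
  by rewrite -powR_inv1 ?(ltW m0)// -powRrM; congr (_ `^ _); ring.
have -> : (4 ^ n.+1)%:R = 2 `^ (2 * m) :> R.
  by rewrite -natrM powR_mulrn// -natrX expnM.
rewrite powRD; last by apply/implyP => _; rewrite gt_eqF.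
rewrite powRN !mulrA mulfV ?mul1r; last by rewrite gt_eqF// powR_gt0.
by rewrite mulrAC.
Qed.

Lemma bsc_bounds : exists c1 c2 : R, [/\ 0 < c1, 0 < c2 &
  forall n, c1 * n.+1%:R `^ gamma <= bsc n <= c2 * n.+1%:R `^ gamma].
Proof.
have [c1 [c2 [c10 c20 h]]] := gdiag_bounds.
exists (c1 `^ alpha), (c2 `^ alpha); split; rewrite ?powR_gt0// => n.
have m0 : (0 : R) < n.+1%:R by [].
have /andP[h1 h2] := h n; rewrite bscE ![_ `^ alpha * _]mulrC !ler_pM2l ?powR_gt0//.
have a0 := gdiag_gt0 n.
have am := ltW (divr_gt0 a0 m0).
apply/andP; split; apply: powR_le; rewrite ?(ltW al0) ?(ltW c10)//.
  by rewrite ler_pdivlMr.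
by rewrite ler_pdivrMr.
Qed.

Lemma bsc_infty : bsc n @[n --> \oo] --> +oo.
Proof.
have [c1 [c2 [c10 c20 h]]] := bsc_bounds.
apply/cvgryPge => U; near=> n.
have hn : U / c1 <= n.+1%:R `^ gamma by near: n; exact: near_le_powR.
have /andP[h1 _] := h n; apply: le_trans h1.
by rewrite mulrC -ler_pdivrMr.
Unshelve. all: by end_near. Qed.

Lemma bsc_gdiag : bsc n / gdiag n @[n --> \oo] --> (0 : R).
Proof.
have [c1 [c2 [c10 c20 h]]] := bsc_bounds.
have [c3 [c4 [c30 c40 h']]] := gdiag_bounds.
apply/cvgr0Pnorm_le => e e0; near=> n.
have m0 : (0 : R) < n.+1%:R by [].
have g1 : 0 < 1 - gamma by move: ga1; lra.
have hn : c2 / (c3 * e) <= n.+1%:R `^ (1 - gamma).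
  by near: n; apply: near_le_powR; move: ga1; lra.
rewrite ger0_norm ?(ltW (divr_gt0 (bsc_gt0 n) (gdiag_gt0 n)))//.
rewrite ler_pdivrMr ?gdiag_gt0//; have /andP[_ h2] := h n; apply: le_trans h2 _.
have /andP[h3 _] := h' n; apply: (@le_trans _ _ (e * (c3 * n.+1%:R))); last by rewrite ler_pM2l.
have me : n.+1%:R = n.+1%:R `^ gamma * n.+1%:R `^ (1 - gamma) :> R.
  rewrite -powRD; last by apply/implyP => _; rewrite gt_eqF.
  by rewrite addrC subrK powRr1// ltW.
rewrite [X in c3 * X]me !mulrA [_ * n.+1%:R `^ gamma * _]mulrAC ler_pM2r ?powR_gt0//.
by rewrite mulrC -ler_pdivrMr ?mulr_gt0// [e * _]mulrC.
Unshelve. all: by end_near. Qed.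

Lemma rsc_powR n : rsc n `^ alpha = (4 ^ n.+1)%:R / bsc n.
Proof.
rewrite /bsc powRN; have := powR_gt0 alpha (rsc_gt0 n); set z := _ `^ _ => z0.
have N0 : 0 < (4 ^ n.+1)%:R :> R by rewrite ltr0n expn_gt0.
by move: (4 ^ n.+1)%:R N0 => N N0; field; rewrite !gt_eqF.
Qed.

Lemma rsc_infty : rsc n @[n --> \oo] --> +oo.
Proof.
have [c1 [c2 [c10 c20 h]]] := bsc_bounds.
apply/cvgryPge => U0; near=> n.
pose U := Num.max U0 0.
apply: (@le_trans _ _ U); first by rewrite le_max lexx.
have Ug : 0 <= U by rewrite le_max lexx orbT.
have r0 := rsc_gt0 n; have m0 : (0 : R) < n.+1%:R by [].
have hn : U `^ alpha * c2 <= n.+1%:R `^ (1 : R) by near: n; exact: near_le_powR.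
rewrite powRr1 ?(ltW m0)// in hn.
suff ha : U `^ alpha <= rsc n `^ alpha.
  have k0 : 0 <= alpha^-1 by rewrite invr_ge0 ltW.
  have := ge0_ler_powR k0 _ _ ha; rewrite !nnegrE !powR_ge0 -!powRrM mulfV ?gt_eqF//.
  by rewrite !powRr1 ?(ltW r0)//; apply.
rewrite rsc_powR ler_pdivlMr ?bsc_gt0//; have /andP[_ h2] := h n.
apply: (@le_trans _ _ (U `^ alpha * (c2 * n.+1%:R `^ gamma))); first by rewrite ler_wpM2l ?powR_ge0.
have mg : n.+1%:R `^ gamma <= n.+1%:R :> R.
  by apply: ler1_powR; [rewrite ler1n|move: ga1; lra].
rewrite mulrA; apply: (@le_trans _ _ (n.+1%:R * n.+1%:R)).
  by apply: ler_pM => //; rewrite ?powR_ge0// mulr_ge0 ?powR_ge0// ltW.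
rewrite -natrM ler_nat.
have : (n.+1 < 2 ^ n.+1)%N by exact: ltn_expl.
have -> : (4 ^ n.+1 = 2 ^ n.+1 * 2 ^ n.+1)%N by rewrite -expnMn.
by move=> /ltnW hh; exact: leq_mul.
Unshelve. all: by end_near. Qed.

End Scales.

Section Tail.
Context {R : realType} (alpha gamma : R) (Q : R -> R).
Hypothesis al0 : 0 < alpha.
Hypothesis al1 : alpha < 1.
Hypothesis ga0 : 0 < gamma.
Hypothesis ga1 : gamma < 1 / 6.
Hypothesis Q01 : forall u, 0 <= Q u <= 1.
Hypothesis Qlim : u `^ alpha * Q u @[u --> +oo] --> (1 : R).

Lemma tail_bound : exists2 C : R, 1 <= C & forall u, 0 < u -> Q u <= C * u `^ (- alpha).
Proof.
have /cvgrPdist_le /(_ 1 ltr01) [U [_ HU]] := Qlim.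
pose W := Num.max U 1.
exists (2 + W `^ alpha); first by have := powR_ge0 W alpha; lra.
move=> u u0; have p0 := powR_gt0 alpha u0; rewrite powRN ler_pdivlMr// mulrC.
have W0 := powR_ge0 W alpha.
have [uW|Wu] := leP u W.
  have : u `^ alpha <= W `^ alpha.
    by apply: powR_le; rewrite ?(ltW al0) ?(ltW u0).
  have /andP[q0 q1] := Q01 u.
  have : u `^ alpha * Q u <= u `^ alpha by rewrite ler_piMr// ltW.
  lra.
have := HU u; have -> : U < u by apply: le_lt_trans Wu; rewrite le_max lexx.
move=> /(_ isT); rewrite ler_norml => /andP[h _]; lra.
Qed.

Lemma tail_count (d : R) : 0 < d ->
  (4 ^ n.+1)%:R * Q (d * rsc alpha gamma n) / bsc alpha gamma n @[n --> \oo] --> d `^ (- alpha).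
Proof.
move=> d0; have rinf := rsc_infty al0 ga1.
have drinf : d * rsc alpha gamma n @[n --> \oo] --> +oo.
  apply/cvgryPge => U; near=> n; rewrite mulrC -ler_pdivrMr//.
  by near: n; move/cvgryPge : rinf; exact.
have H : d `^ (- alpha) * ((d * rsc alpha gamma n) `^ alpha * Q (d * rsc alpha gamma n))
    @[n --> \oo] --> d `^ (- alpha) * 1.
  by apply: cvgMr; exact: (cvg_comp _ _ drinf Qlim).
rewrite mulr1 in H; apply: cvg_trans H; apply: near_eq_cvg; apply: nearW => n.
have r0 := rsc_gt0 alpha gamma n; have N0 : 0 < (4 ^ n.+1)%:R :> R by rewrite ltr0n expn_gt0.
rewrite /bsc powRM ?(ltW d0) ?(ltW r0)// !powRN.
have := powR_gt0 alpha d0; have := powR_gt0 alpha r0.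
move: (_ `^ _) (_ `^ _) (Q _) (4 ^ n.+1)%:R N0 => x y z w w0 x0 y0.
by field; rewrite !gt_eqF.
Unshelve. all: by end_near. Qed.

End Tail.

Section DyadicLayers.
Context {R : realType}.

(** Dyadic staircase comparable with [Num.min u d / d] up to an error [2^-J]; being built from
    indicators, it needs only probabilities of level sets. *)
Definition layer (J : nat) (d u : R) : R :=
  \sum_(j < J) 2^-1 ^+ j * (d * 2^-1 ^+ j.+1 <= u)%R%:R.

Lemma layer_ge0 J d u : 0 <= layer J d u.
Proof. by apply: sumr_ge0 => j _; rewrite mulr_ge0 ?exprn_ge0 ?invr_ge0. Qed.

Lemma sum_half_le2 J : \sum_(j < J) (2^-1 : R) ^+ j <= 2.
Proof.
suff : \sum_(j < J) (2^-1 : R) ^+ j = 2 - 2 * 2^-1 ^+ J.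
  by move=> ->; rewrite gerBl mulr_ge0 ?exprn_ge0 ?invr_ge0.
elim: J => [|J IH]; first by rewrite big_ord0 expr0 mulr1 subrr.
by rewrite big_ord_recr /= IH exprS; move: (_ ^+ J) => x; field.
Qed.

Lemma layer_le2 J d u : layer J d u <= 2.
Proof.
apply: le_trans (sum_half_le2 J); apply: ler_sum => j _.
by rewrite ler_piMr ?exprn_ge0 ?invr_ge0// lern1 leq_b1.
Qed.

Lemma min_le_layer J d u : 0 < d -> 0 <= u -> Num.min u d <= d * (layer J d u + 2^-1 ^+ J).
Proof.
move=> d0 u0; elim: J => [|J IH].
  by rewrite /layer big_ord0 expr0 add0r mulr1 ge_min lexx orbT.
rewrite /layer big_ord_recr /= -/(layer J d u).
have l0 := layer_ge0 J d u; have h0 : 0 < (2^-1 : R) ^+ J by rewrite exprn_gt0 ?invr_gt0.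
case: (leP (d * 2^-1 ^+ J.+1) u) => h /=.
  apply: le_trans IH _; rewrite ler_pM2l// mulr1 -addrA lerD2l exprS; lra.
rewrite mulr0 addr0; apply: (@le_trans _ _ u); first by rewrite ge_min lexx.
by apply: le_trans (ltW h) _; rewrite ler_pM2l// lerDr.
Qed.

Lemma expR_le_1D (v : R) : 0 <= v -> expR (v / (1 + v)) <= 1 + v.
Proof.
move=> v0; have v1 : 0 < 1 + v by rewrite ltr_pwDl.
have := expR_ge1Dx (- (v / (1 + v))); rewrite expRN => h.
rewrite -[leRHS]invrK -[leLHS]invrK lef_pV2 ?posrE ?invr_gt0 ?expR_gt0//.
by apply: le_trans h; rewrite le_eqVlt; apply/orP; left; apply/eqP; field; rewrite gt_eqF.
Qed.

(** Converts a product of factors [1 + layer] into the exponential of a sum; 3 comes from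
    [1 + v <= 3], as layers are at most 2. *)
Lemma ln_layer (v : R) : 0 <= v <= 2 -> expR (v / 3) <= 1 + v.
Proof.
move=> /andP[v0 v2]; apply: le_trans (expR_le_1D v0).
rewrite ler_expR ler_wpM2l// lef_pV2 ?posrE//; lra.
Qed.

Lemma pow_1D_le_expR (x : R) N : 0 <= x -> (1 + x) ^+ N <= expR (x * N%:R).
Proof.
move=> x0; rewrite mulrC expRM_natl lerXn2r ?nnegrE ?expR_ge0 ?addr_ge0//.
exact: expR_ge1Dx.
Qed.

End DyadicLayers.

Section BorelCantelli.
Context {R : realType} {d : measure_display} {T : measurableType d} (P : probability T R).

(** [n^(- 7 / 6)] is minus the derivative of [6 * n^(- 1 / 6)], which supplies the telescoping
    majorant. The exponent is [5 * gamma - 2] at [gamma = 1 / 6]. *)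
Lemma borel_cantelli_pow (F : nat -> set T) (C : R) : 0 <= C ->
  (forall n, measurable (F n)) ->
  (\forall n \near \oo, prb P (F n) <= C * n.+1%:R `^ (- (7 / 6))) ->
  \forall w \ae P, \forall n \near \oo, ~ F n w.
Proof.
move=> C0 mF h.
apply: (@borel_cantelli_telescope R d T P F (fun n => 6 * C * n%:R `^ (- (1 / 6)))) => //.
  by move=> n; rewrite mulr_ge0 ?powR_ge0// mulr_ge0.
near=> n; have n0 : (0 : R) < n%:R by near: n; exact: nbhs_infty_gtr.
apply: (@le_trans _ _ (C * n.+1%:R `^ (- (7 / 6)))); first by near: n.
rewrite -mulrBr [6 * C]mulrC -mulrA ler_wpM2l//.
have nS : (n%:R : R) <= n.+1%:R by rewrite ler_nat.
pose c : R := n.+1%:R `^ (- (7 / 6)).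
have := @is_derive_ge0_le _ (fun s => (- 6) * s `^ (- (1 / 6)) - c * s)
  (fun s => (- 6) * (- (1 / 6) * s `^ (- (1 / 6) - 1)) - c * 1) n%:R n.+1%:R nS.
have -> : n.+1%:R = n%:R + 1 :> R by rewrite natr1.
have tmp : (forall x : R, n%:R <= x <= n%:R + 1 -> is_derive x (1 : R)
    (fun s : R => (- 6) * s `^ (- (1 / 6)) - c * s)
    ((- 6) * (- (1 / 6) * x `^ (- (1 / 6) - 1)) - c * 1)).
  move=> x /andP[nx _]; have x0 := lt_le_trans n0 nx.
  exact: (is_derive_sub (is_derive_scale _ (is_derive_powR _ x0)) (is_derive_scale c (is_derive_id x 1))).
move=> /(_ tmp) H.
suff /H : forall x : R, n%:R <= x <= n%:R + 1 ->
    0 <= (- 6) * (- (1 / 6) * x `^ (- (1 / 6) - 1)) - c * 1.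
  rewrite /c -[n.+1%:R]natr1; move: (_ `^ (- (7 / 6))) => z; lra.
move=> x /andP[nx xn]; have x0 := lt_le_trans n0 nx.
have -> : (- 6) * (- (1 / 6) * x `^ (- (1 / 6) - 1)) = x `^ (- (1 / 6) - 1) by field.
have -> : - (1 / 6) - 1 = - (7 / 6) :> R by field.
rewrite mulr1 subr_ge0 /c !powRN lef_pV2 ?posrE ?powR_gt0//.
by apply: powR_le; [lra|exact: ltW|rewrite -[n.+1%:R]natr1].
Unshelve. all: by end_near. Qed.

(** A stretched exponential beats every power: keep the term of order [k.+1] of the exponential
    series, with [k.+1 * g >= 7 / 6]. *)
Lemma borel_cantelli_exp (F : nat -> set T) (b : nat -> R) (c g : R) : 0 < c -> 0 < g ->
  (forall n, c * n.+1%:R `^ g <= b n) -> (forall n, measurable (F n)) ->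
  (\forall n \near \oo, prb P (F n) <= expR (- b n)) ->
  \forall w \ae P, \forall n \near \oo, ~ F n w.
Proof.
move=> c0 g0 hb mF h.
pose k := Num.truncn (7 / 6 / g).
have kg : 7 / 6 <= k.+1%:R * g :> R.
  by rewrite -ler_pdivrMr// ltW// truncnS_gt.
pose C : R := (k.+1)`!%:R / c ^+ k.+1.
have f0 : (0 : R) < (k.+1)`!%:R by rewrite ltr0n fact_gt0.
apply: (@borel_cantelli_pow F C) => //; first by rewrite divr_ge0 ?exprn_ge0 ?(ltW c0)// ltW.
near=> n; apply: (@le_trans _ _ (expR (- b n))); first by near: n.
have m1 : (1 : R) <= n.+1%:R by rewrite ler1n.
have m0 := lt_le_trans (@ltr01 R) m1.
have x0 : 0 < c * n.+1%:R `^ g by rewrite mulr_gt0 ?powR_gt0.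
rewrite expRN powRN; apply: (@le_trans _ _ ((c * n.+1%:R `^ g) ^+ k.+1 / (k.+1)`!%:R)^-1).
  rewrite lef_pV2 ?posrE ?expR_gt0 ?divr_gt0 ?exprn_gt0//.
  apply: (@le_trans _ _ (expR (c * n.+1%:R `^ g))); last by rewrite ler_expR.
  by have := expR_ge1Dxn k (ltW x0); lra.
rewrite invf_div exprMn invfM mulrA ler_pM2l ?divr_gt0 ?exprn_gt0//.
rewrite lef_pV2 ?posrE ?exprn_gt0 ?powR_gt0// -powR_mulrn ?powR_ge0// -powRrM.
by apply: ler_powR => //; rewrite (mulrC g).
Unshelve. all: by end_near. Qed.

End BorelCantelli.

(** * The random environment *)

Section Environment.
Context {R : realType} {d : measure_display} {T : measurableType d} (P : probability T R).
Context (tau : int * int -> T -> R) (alpha gamma : R).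
Hypothesis al0 : 0 < alpha.
Hypothesis al1 : alpha < 1.
Hypothesis ga0 : 0 < gamma.
Hypothesis ga1 : gamma < 1 / 6.
Hypothesis mtau : forall x, measurable_fun setT (tau x).
Hypothesis ind : mutually_independent R d T P (int * int)%type tau.
Hypothesis idd : identically_distributed R d T P (int * int)%type tau.

Local Notation rsc := (rsc alpha gamma).
Local Notation bsc := (bsc alpha gamma).
Local Notation prb := (prb P).

Definition tail (u : R) : R := prb (tau (0, 0)%R @^-1` [set y | u <= y]).

Hypothesis Htail : u `^ alpha * tail u @[u --> +oo] --> (1 : R).

Definition depth n w (x : V n.+1) : R := tau (emb n.+1 x) w / rsc n.

Arguments depth : clear implicits.

Lemma emb_inj n : injective (emb n).
Proof.
move=> [x1 x2] [y1 y2] [] /= e1 e2; congr pair; apply: val_inj; exact: e1 || exact: e2.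
Qed.

Lemma measurable_up (u : R) : measurable [set y : R | u <= y].
Proof.
have -> : [set y : R | u <= y] = `[u, +oo[%classic; last exact: measurable_itv.
by apply/seteqP; split => y /=; rewrite in_itv /= andbT.
Qed.

Lemma measurable_pre x (B : set R) : measurable B -> measurable (tau x @^-1` B).
Proof. by move=> mB; rewrite -[_ @^-1` _]setTI; exact: mtau. Qed.

Lemma prb_pre x (B : set R) : measurable B -> prb (tau x @^-1` B) = prb (tau (0, 0)%R @^-1` B).
Proof. by move=> mB; rewrite /prb; congr fine; exact: idd. Qed.

Lemma tail01 u : 0 <= tail u <= 1.
Proof.
by rewrite prb_ge0 prb_le1//; apply: measurable_pre; exact: measurable_up.
Qed.

(** Independence is given for sets indexed by sites of the plane; injectivity of [f] lets the family
    be transported there, with the full set at all other sites. *)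
Lemma indep_prod (I : finType) (f : I -> int * int) (B : I -> set R) : injective f ->
  (forall i, measurable (B i)) ->
  prb (\bigcap_i (tau (f i) @^-1` B i)) = \prod_i prb (tau (0, 0)%R @^-1` B i).
Proof.
move=> fi mB.
pose C j : set R := if [pick i | f i == j] is Some i then B i else setT.
have Cf i : C (f i) = B i.
  rewrite /C; case: pickP => [k /eqP /fi ->//|/(_ i)]; by rewrite eqxx.
have mC j : measurable (C j) by rewrite /C; case: pickP => [i _|_].
have un : uniq [seq f i | i <- enum I] by rewrite map_inj_uniq ?enum_uniq.
have := ind un mC; rewrite big_map.
have -> : \bigcap_(i in [set i | i \in [seq f i | i <- enum I]]) (tau i @^-1` C i) =
    \bigcap_i (tau (f i) @^-1` B i).
  apply/seteqP; split => w /=.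
    by move=> h i _; rewrite -Cf; apply: h => /=; rewrite map_f// mem_enum.
  by move=> h j /= /mapP[i _ ->]; rewrite /= Cf; exact: h.
rewrite /prb => ->; rewrite -big_enum /=.
elim: (enum I) => [|i s IH]; first by rewrite !big_nil.
rewrite !big_cons -IH fineM ?Cf.
- by congr (_ * _); congr fine; exact: idd.
- by apply: fin_num_measure; exact: measurable_pre.
- apply: prode_fin_num => j _; rewrite Cf.
  by apply: fin_num_measure; exact: measurable_pre.
Qed.

Lemma chernoff_torus n (J : finType) (S : J -> set R) (c : J -> R) (M : R) :
  (forall j, measurable (S j)) -> (forall j, 0 <= c j) -> 0 < M ->
  let E := [set w | M <= \prod_(x : V n.+1) (1 + \sum_j c j * (tau (emb n.+1 x) w \in S j)%:R)] in
  measurable E /\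
  prb E <= M^-1 * (1 + \sum_j c j * prb (tau (0, 0)%R @^-1` S j)) ^+ (4 ^ n.+1).
Proof.
move=> mS c0 M0 /=.
pose S' (o : option J) : set R := if o is Some j then S j else setT.
have mS' o : measurable (S' o) by case: o => [j|] /=.
pose B (x : V n.+1) j := tau (emb n.+1 x) @^-1` S j.
have mB x j : measurable (B x j) by exact: measurable_pre.
have eB x o : (if o is Some j then B x j else setT) = tau (emb n.+1 x) @^-1` S' o by case: o.
have hind (f : V n.+1 -> option J) : prb (\bigcap_x (if f x is Some j then B x j else setT)) =
    \prod_x prb (if f x is Some j then B x j else setT).
  have -> : (fun x => if f x is Some j then B x j else setT) =
      (fun x => tau (emb n.+1 x) @^-1` S' (f x)) by apply/funext => x; exact: eB.
  rewrite indep_prod//; last exact: emb_inj.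
  by apply: eq_bigr => x _; rewrite eB prb_pre.
have [m1 m2] := chernoff mB c0 (ltW M0) hind.
split=> //; rewrite mulrC ler_pdivlMr// mulrC; apply: le_trans m2 _.
rewrite (eq_bigr (fun=> 1 + \sum_j c j * prb (tau (0, 0)%R @^-1` S j))).
  by rewrite prodr_const card_torus.
by move=> x _; congr (1 + _); apply: eq_bigr => j _; rewrite prb_pre.
Qed.

Lemma depth_ge n w x (s : R) : (s <= depth n w x) = (s * rsc n <= tau (emb n.+1 x) w).
Proof. by rewrite /depth ler_pdivlMr ?rsc_gt0. Qed.

Lemma in_up (u y : R) : (y \in [set y | u <= y]) = (u <= y).
Proof. by apply/idP/idP => h; [move: h; rewrite inE|rewrite inE]. Qed.

(* Exponential moments are needed: [bsc n] grows only like a small power of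
   [n], so second moments would not be summable. *)
Lemma count_upper (s e : R) : 0 < s -> 0 < e -> \forall w \ae P, \forall n \near \oo,
  \sum_x (s <= depth n w x)%R%:R <= (s `^ (- alpha) + e) * bsc n.
Proof.
move=> s0 e0; set D := s `^ (- alpha); have D0 : 0 < D by rewrite powR_gt0.
have De : 0 < 4 * (D + e) by rewrite mulr_gt0// addr_gt0.
(* Tilt of the Chernoff bound. The loss between [c] and [c / (1 + c)] uses at most [e / 4] of the
   gap [e / 2] between the mean and the level; the other [e / 4] gives the exponent [k]. *)
have [c [c0 cD]] : exists c, 0 < c /\ c * (D + e) = e / 4.
  exists (e / (4 * (D + e))); split; first exact: divr_gt0.
  by field; rewrite gt_eqF// addr_gt0.
have c1 : 0 < 1 + c by rewrite addr_gt0.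
pose M n := expR (c / (1 + c) * ((D + e) * bsc n)).
pose S n := [set y | s * rsc n <= y].
pose F n := [set w | M n <= \prod_(x : V n.+1)
  (1 + \sum_(j < 1) c * (tau (emb n.+1 x) w \in S n)%:R)].
have FF n : measurable (F n) /\
    prb (F n) <= (M n)^-1 * (1 + \sum_(j < 1) c * tail (s * rsc n)) ^+ (4 ^ n.+1).
  apply: (@chernoff_torus n 'I_1 (fun=> S n) (fun=> c) (M n)).
  - by move=> _; exact: measurable_up.
  - by move=> _; exact: ltW.
  - exact: expR_gt0.
have [c2 [c3 [c20 c30 hb]]] := bsc_bounds gamma al0.
pose k := c * e / (4 * (1 + c)).
have k0 : 0 < k := divr_gt0 (mulr_gt0 c0 e0) (mulr_gt0 (ltr0Sn R 3) c1).
have : \forall w \ae P, \forall n \near \oo, ~ F n w.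
  apply: (@borel_cantelli_exp R d T P F (fun n => k * bsc n) (k * c2) gamma) => //.
  - by rewrite mulr_gt0.
  - by move=> n; rewrite -mulrA ler_pM2l//; have /andP[] := hb n.
  - by move=> n; have [] := FF n.
  have e2 : 0 < e / 2 by rewrite divr_gt0.
  have /cvgrPdist_le /(_ _ e2) lim := tail_count al0 ga1 Htail s0.
  near=> n; have [_ /le_trans] := FF n; apply.
  have b0 := bsc_gt0 alpha gamma n.
  have : `|D - (4 ^ n.+1)%:R * tail (s * rsc n) / bsc n| <= e / 2 by near: n; exact: lim.
  rewrite ler_norml => /andP[h _].
  have {}h : (4 ^ n.+1)%:R * tail (s * rsc n) <= (D + e / 2) * bsc n.
    by rewrite -ler_pdivrMr//; lra.
  have /andP[t0 _] := tail01 (s * rsc n).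
  rewrite big_ord1 /M -expRN.
  apply: (@le_trans _ _ (expR (- (c / (1 + c) * ((D + e) * bsc n))) *
     expR (c * tail (s * rsc n) * (4 ^ n.+1)%:R))).
    by rewrite ler_wpM2l ?expR_ge0// pow_1D_le_expR// mulr_ge0// ltW.
  rewrite -expRD ler_expR.
  have {}h : c * tail (s * rsc n) * (4 ^ n.+1)%:R <= c * ((D + e / 2) * bsc n).
    by rewrite -mulrA ler_pM2l// mulrC.
  have h2 : c * (D + e / 2) - c / (1 + c) * (D + e) <= - k.
    have -> : k = c / (1 + c) * (e / 4) by rewrite /k; field; rewrite gt_eqF.
    have -> : c * (D + e / 2) = c / (1 + c) * ((1 + c) * (D + e / 2)) by field; rewrite gt_eqF.
    rewrite -mulrBr -mulrN ler_pM2l ?divr_gt0//.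
    have : c * (D + e / 2) <= c * (D + e) by rewrite ler_pM2l//; lra.
    lra.
  have : (c * (D + e / 2) - c / (1 + c) * (D + e)) * bsc n <= - k * bsc n by rewrite ler_pM2r.
  lra.
apply: filterS => w [m _ hw]; exists m => // n mn.
rewrite leNgt; apply/negP => K; apply: (hw n mn).
rewrite /F /M /= -[leLHS]mul1r.
apply: (@le_trans _ _ (expR (c / (1 + c) * \sum_x (s <= depth n w x)%R%:R))).
  by rewrite mul1r ler_expR ler_pM2l ?divr_gt0// ltW.
rewrite mulr_sumr expR_sum; apply: ler_prod => x _.
rewrite expR_ge0 /= big_ord1 /S in_up -depth_ge.
case: (s <= depth n w x) => /=; first by rewrite !mulr1; apply: expR_le_1D; exact: ltW.
by rewrite !mulr0 expR0 addr0.
Unshelve. all: by end_near. Qed.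

(** Since [chernoff] takes nonnegative weights, the shallow sites are tilted instead: few deep sites
    make the product close to its maximum [(1 + c)^(4^n.+1)]. *)
Lemma count_lower (s e : R) : 0 < s -> 0 < e -> \forall w \ae P, \forall n \near \oo,
  (s `^ (- alpha) - e) * bsc n <= \sum_x (s <= depth n w x)%R%:R.
Proof.
move=> s0 e0; set D := s `^ (- alpha); have D0 : 0 < D by rewrite powR_gt0.
have De : 0 < 4 * (D + e) by rewrite mulr_gt0// addr_gt0.
have [c [c0 cD]] : exists c, 0 < c /\ c * (D + e) = e / 4.
  exists (e / (4 * (D + e))); split; first exact: divr_gt0.
  by field; rewrite gt_eqF// addr_gt0.
have c1 : 0 < 1 + c by rewrite addr_gt0.
pose M n := (1 + c) ^+ (4 ^ n.+1) * expR (- (c * ((D - e) * bsc n))).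
pose S n := ~` [set y | s * rsc n <= y].
have mS n : measurable (S n) by apply: measurableC; exact: measurable_up.
pose F n := [set w | M n <= \prod_(x : V n.+1)
  (1 + \sum_(j < 1) c * (tau (emb n.+1 x) w \in S n)%:R)].
have M0 n : 0 < M n by rewrite mulr_gt0 ?exprn_gt0 ?expR_gt0.
have FF n : measurable (F n) /\
    prb (F n) <= (M n)^-1 * (1 + \sum_(j < 1) c * prb (tau (0, 0)%R @^-1` S n)) ^+ (4 ^ n.+1).
  apply: (@chernoff_torus n 'I_1 (fun=> S n) (fun=> c) (M n)) => //.
  by move=> _; exact: ltW.
have [c2 [c3 [c20 c30 hb]]] := bsc_bounds gamma al0.
pose k := c * e / (4 * (1 + c)).
have k0 : 0 < k := divr_gt0 (mulr_gt0 c0 e0) (mulr_gt0 (ltr0Sn R 3) c1).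
have : \forall w \ae P, \forall n \near \oo, ~ F n w.
  apply: (@borel_cantelli_exp R d T P F (fun n => k * bsc n) (k * c2) gamma) => //.
  - by rewrite mulr_gt0.
  - by move=> n; rewrite -mulrA ler_pM2l//; have /andP[] := hb n.
  - by move=> n; have [] := FF n.
  have e2 : 0 < e / 2 by rewrite divr_gt0.
  have /cvgrPdist_le /(_ _ e2) lim := tail_count al0 ga1 Htail s0.
  near=> n; have [_ /le_trans] := FF n; apply.
  have b0 := bsc_gt0 alpha gamma n.
  have : `|D - (4 ^ n.+1)%:R * tail (s * rsc n) / bsc n| <= e / 2 by near: n; exact: lim.
  rewrite ler_norml => /andP[_ h].
  have {}h : (D - e / 2) * bsc n <= (4 ^ n.+1)%:R * tail (s * rsc n).
    by rewrite -ler_pdivlMr//; lra.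
  have /andP[t0 t1] := tail01 (s * rsc n).
  have -> : prb (tau (0, 0)%R @^-1` S n) = 1 - tail (s * rsc n).
    by rewrite /S -preimage_setC prb_setC//; apply: measurable_pre; exact: measurable_up.
  rewrite big_ord1 /M; set p := tail _ in t0 t1 h *.
  have -> : 1 + c * (1 - p) = (1 + c) * (1 + - (c / (1 + c) * p)) by field; rewrite gt_eqF.
  have -> : ((1 + c) ^+ (4 ^ n.+1) * expR (- (c * ((D - e) * bsc n))))^-1 *
      ((1 + c) * (1 + - (c / (1 + c) * p))) ^+ (4 ^ n.+1) =
      (1 + - (c / (1 + c) * p)) ^+ (4 ^ n.+1) * expR (c * ((D - e) * bsc n)).
    rewrite exprMn expRN invfM invrK mulrACA mulVf ?mul1r 1?mulrC// expf_neq0// gt_eqF//.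
  apply: (@le_trans _ _ (expR (- (c / (1 + c) * p)) ^+ (4 ^ n.+1) * expR (c * ((D - e) * bsc n)))).
    rewrite ler_pM2r ?expR_gt0// lerXn2r ?nnegrE ?expR_ge0 ?expR_ge1Dx//.
    rewrite subr_ge0 mulr_ile1 ?divr_ge0 ?(ltW c0) ?(ltW c1)// ler_pdivrMr// mul1r.
    by rewrite lerDr.
  rewrite -expRM_natl -expRD ler_expR.
  have {}h : c / (1 + c) * ((D - e / 2) * bsc n) <= c / (1 + c) * ((4 ^ n.+1)%:R * p).
    by rewrite ler_pM2l ?divr_gt0.
  have h2 : c * (D - e) - c / (1 + c) * (D - e / 2) <= - k.
    have -> : k = c / (1 + c) * (e / 4) by rewrite /k; field; rewrite gt_eqF.
    have -> : c * (D - e) = c / (1 + c) * ((1 + c) * (D - e)) by field; rewrite gt_eqF.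
    have z0 : 0 < c / (1 + c) by exact: divr_gt0.
    have zz : c * (D - e) <= c * (D + e) by rewrite ler_pM2l//; lra.
    have : c / (1 + c) * ((1 + c) * (D - e) - (D - e / 2)) <= c / (1 + c) * - (e / 4).
      by rewrite ler_pM2l//; lra.
    by rewrite mulrBr mulrN.
  have : (c * (D - e) - c / (1 + c) * (D - e / 2)) * bsc n <= - k * bsc n by rewrite ler_pM2r.
  move: h; move: (c / (1 + c)) (4 ^ n.+1)%:R => z N; lra.
apply: filterS => w [m _ hw]; exists m => // n mn.
rewrite leNgt; apply/negP => K; apply: (hw n mn).
rewrite /F /M /=.
apply: (@le_trans _ _ ((1 + c) ^+ (4 ^ n.+1) * expR (- (c * \sum_x (s <= depth n w x)%R%:R)))).
  by rewrite ler_pM2l ?exprn_gt0// ler_expR lerN2 ler_pM2l// ltW.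
rewrite mulr_sumr -sumrN expR_sum -(@card_torus n.+1) -prodr_const -big_split /=.
apply: ler_prod => x _.
rewrite mulr_ge0 ?expR_ge0 ?(ltW c1)//= big_ord1 /S in_setC in_up -depth_ge.
case: (s <= depth n w x) => /=; last by rewrite mulr0 oppr0 expR0 !mulr1.
by rewrite mulr1 mulr0 addr0 expRN ler_pdivrMr ?expR_gt0// mul1r expR_ge1Dx.
Unshelve. all: by end_near. Qed.

Lemma count_cvg (s : R) : 0 < s -> \forall w \ae P,
  (\sum_x (s <= depth n w x)%R%:R) / bsc n @[n --> \oo] --> s `^ (- alpha).
Proof.
move=> s0.
have eps k : \forall w \ae P, \forall n \near \oo,
    `|s `^ (- alpha) - (\sum_x (s <= depth n w x)%R%:R) / bsc n| <= k.+1%:R^-1.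
  have k0 : 0 < k.+1%:R^-1 :> R by rewrite invr_gt0.
  apply: filterS2 (count_upper s0 k0) (count_lower s0 k0) => w h1 h2.
  near=> n; have b0 := bsc_gt0 alpha gamma n.
  have : \sum_x (s <= depth n w x)%R%:R <= (s `^ (- alpha) + k.+1%:R^-1) * bsc n by near: n.
  have : (s `^ (- alpha) - k.+1%:R^-1) * bsc n <= \sum_x (s <= depth n w x)%R%:R by near: n.
  rewrite -ler_pdivlMr// => u1; rewrite -ler_pdivrMr// => u2; rewrite ler_norml.
  by move: u1 u2; move: (_^-1 : R) (_ / _ : R) => z y *; apply/andP; split; lra.
apply: filterS (ae_foralln eps) => w h; apply/cvgrPdist_le => e e0.
have [k hk] : exists k : nat, k.+1%:R^-1 <= e.
  exists (Num.truncn e^-1); rewrite -[leRHS]invrK lef_pV2 ?posrE ?invr_gt0//.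
  exact/ltW/truncnS_gt.
by apply: filterS (h k) => n /le_trans; apply.
Unshelve. all: by end_near. Qed.

(** The weight [2^-j] against the tail growth [2^(alpha * j)] leaves a geometric series of ratio
    [2^(alpha - 1) < 1], so the bound is uniform in [J]. *)
Lemma layer_mean : exists2 C : R, 1 <= C & forall n J (s : R), 0 < s ->
  (4 ^ n.+1)%:R * (\sum_(j < J) 2^-1 ^+ j * tail (s * 2^-1 ^+ j.+1 * rsc n)) <=
  C * s `^ (- alpha) * bsc n.
Proof.
have [C C1 HC] := tail_bound al0 tail01 Htail.
pose x : R := 2 `^ (alpha - 1).
have x0 : 0 < x by rewrite powR_gt0.
have x1 : x < 1.
  have -> : (1 : R) = 2 `^ 0 by rewrite powRr0.
  rewrite /x /powR !(negbTE (lt0r_neq0 _))// ltr_expR ltr_pM2r ?ln_gt0 ?ltr1n//.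
  by rewrite subr_lt0.
have x1' : 0 < 1 - x by rewrite subr_gt0.
have geo J : \sum_(j < J) x ^+ j <= (1 - x)^-1.
  have := subrX1 x J; rewrite -(ler_pM2l x1') mulfV ?gt_eqF// => e.
  have -> : (1 - x) * \sum_(j < J) x ^+ j = 1 - x ^+ J by move: e; lra.
  by rewrite gerBl exprn_ge0// ltW.
exists (2 * C / (1 - x)).
  rewrite ler_pdivlMr// mul1r; lra.
move=> n J s s0; have r0 := rsc_gt0 alpha gamma n.
have N0 : 0 < (4 ^ n.+1)%:R :> R by rewrite ltr0n expn_gt0.
have half j : 0 < (2^-1 : R) ^+ j by rewrite exprn_gt0 ?invr_gt0.
have term j : 2^-1 ^+ j * tail (s * 2^-1 ^+ j.+1 * rsc n) <=
    C * s `^ (- alpha) * rsc n `^ (- alpha) * 2 * x ^+ j.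
  have p0 : 0 < s * 2^-1 ^+ j.+1 * rsc n := mulr_gt0 (mulr_gt0 s0 (half j.+1)) r0.
  apply: (@le_trans _ _ (2^-1 ^+ j * (C * (s * 2^-1 ^+ j.+1 * rsc n) `^ (- alpha)))).
    by rewrite ler_pM2l// HC.
  rewrite (powRM _ (ltW (mulr_gt0 s0 (half j.+1))) (ltW r0)) (powRM _ (ltW s0) (ltW (half j.+1))).
  have e1 : (2^-1 ^+ j.+1) `^ (- alpha) = 2 `^ alpha * (2 `^ alpha) ^+ j.
    have h2 : (2 : R) ^+ j.+1 = 2 `^ j.+1%:R by rewrite powR_mulrn.
    have h3 : (2 `^ alpha) ^+ j.+1 = 2 `^ (alpha * j.+1%:R) by rewrite powRrM powR_mulrn ?powR_ge0.
    rewrite -exprS h3 exprVn -powR_inv1 ?exprn_ge0// h2 -!powRrM.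
    by congr (_ `^ _); move: (j.+1%:R : R) => z; ring.
  have e2 : x ^+ j = 2^-1 ^+ j * (2 `^ alpha) ^+ j.
    rewrite -exprMn /x powRD; last by apply/implyP.
    by rewrite powR_inv1// mulrC.
  rewrite e1 e2.
  have t2 : 2 `^ alpha <= 2 :> R by apply: ler1_powR; [rewrite ler1n|exact: ltW].
  have -> : 2^-1 ^+ j * (C * (s `^ (- alpha) * (2 `^ alpha * 2 `^ alpha ^+ j) * rsc n `^ (- alpha))) =
    (2^-1 ^+ j * 2 `^ alpha ^+ j * C * s `^ (- alpha) * rsc n `^ (- alpha)) * 2 `^ alpha by ring.
  have -> : C * s `^ (- alpha) * rsc n `^ (- alpha) * 2 * (2^-1 ^+ j * 2 `^ alpha ^+ j) =
    (2^-1 ^+ j * 2 `^ alpha ^+ j * C * s `^ (- alpha) * rsc n `^ (- alpha)) * 2 by ring.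
  rewrite ler_wpM2l// !mulr_ge0 ?powR_ge0 ?(ltW (half _)) ?exprn_ge0 ?powR_ge0//.
  exact: le_trans ler01 C1.
have C0 : 0 < C := lt_le_trans ltr01 C1.
apply: (@le_trans _ _ ((4 ^ n.+1)%:R * (C * s `^ (- alpha) * rsc n `^ (- alpha) * 2 * (1 - x)^-1))).
  rewrite ler_pM2l//; apply: (@le_trans _ _ (\sum_(j < J)
      C * s `^ (- alpha) * rsc n `^ (- alpha) * 2 * x ^+ j)).
    by apply: ler_sum => j _; exact: term.
  by rewrite -mulr_sumr ler_wpM2l// !mulr_ge0 ?powR_ge0// ltW.
rewrite /bsc le_eqVlt; apply/orP; left; apply/eqP.
by move: (4 ^ n.+1)%:R (_ `^ _) (_ `^ _) => a b c; field; rewrite gt_eqF.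
Qed.

(** Exponential moments of the layers. In the factor [7 * C], 6 is twice the mean bound times the 3
    of [ln_layer], and 1 absorbs the remainder of the dyadic staircase. *)
Lemma small_sum : exists2 C : R, 0 < C & forall s : R, 0 < s ->
  (\forall w \ae P, forall n (x : V n.+1), 0 < depth n w x) ->
  \forall w \ae P, \forall n \near \oo,
  \sum_(x | depth n w x < s) depth n w x <= C * s `^ (1 - alpha) * bsc n.
Proof.
have [C C1 HC] := layer_mean; have C0 : 0 < C := lt_le_trans ltr01 C1.
exists (7 * C); first by rewrite mulr_gt0.
move=> s s0 pos; set D := s `^ (- alpha); have D0 : 0 < D by rewrite powR_gt0.
(* With this depth the error [2^-J] per site adds up to exactly 1 over the [4^n.+1] sites. *)
pose J n := (2 * n.+1)%N.
pose S n (j : 'I_(J n)) := [set y | s * 2^-1 ^+ j.+1 * rsc n <= y].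
pose M n := expR (2 * (C * D * bsc n)).
pose F n := [set w | M n <= \prod_(x : V n.+1)
  (1 + \sum_(j < J n) 2^-1 ^+ j * (tau (emb n.+1 x) w \in S n j)%:R)].
have half j : 0 <= (2^-1 : R) ^+ j by rewrite exprn_ge0 ?invr_ge0.
have FF n : measurable (F n) /\ prb (F n) <= (M n)^-1 *
    (1 + \sum_(j < J n) 2^-1 ^+ j * tail (s * 2^-1 ^+ j.+1 * rsc n)) ^+ (4 ^ n.+1).
  apply: (@chernoff_torus n 'I_(J n) (S n) (fun j => 2^-1 ^+ j) (M n)).
  - by move=> j; exact: measurable_up.
  - by [].
  - exact: expR_gt0.
have layerE n w x : \sum_(j < J n) 2^-1 ^+ j * (tau (emb n.+1 x) w \in S n j)%:R =
    layer (J n) s (depth n w x).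
  by apply: eq_bigr => j _; rewrite /S in_up depth_ge.
have [c2 [c3 [c20 c30 hb]]] := bsc_bounds gamma al0.
pose k := C * D; have k0 : 0 < k by exact: mulr_gt0.
have : \forall w \ae P, \forall n \near \oo, ~ F n w.
  apply: (@borel_cantelli_exp R d T P F (fun n => k * bsc n) (k * c2) gamma) => //.
  - by rewrite mulr_gt0.
  - by move=> n; rewrite -mulrA ler_pM2l//; have /andP[] := hb n.
  - by move=> n; have [] := FF n.
  apply: nearW => n; have [_ /le_trans] := FF n; apply.
  have := HC n (J n) s s0; set q := \sum_(j < _) _ => hq.
  have q0 : 0 <= q.
    by apply: sumr_ge0 => j _; rewrite mulr_ge0//; have /andP[] := tail01 (s * 2^-1 ^+ j.+1 * rsc n).
  rewrite /M -expRN.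
  apply: (@le_trans _ _ (expR (- (2 * (C * D * bsc n))) * expR (q * (4 ^ n.+1)%:R))).
    by rewrite ler_pM2l ?expR_gt0// pow_1D_le_expR.
  rewrite -expRD ler_expR /k; move: hq; rewrite -/D [q * _]mulrC; lra.
apply: filterS2 pos => w pw [m _ hw].
have /cvgryPge /(_ k^-1) hb1 := bsc_infty al0 ga0.
near=> n; have {}hw : ~ F n w by apply: hw => /=; near: n; exact: nbhs_infty_ge.
have b0 := bsc_gt0 alpha gamma n.
have hk : 1 <= k * bsc n by rewrite mulrC -ler_pdivrMr// div1r; near: n.
have hV : \sum_(x : V n.+1) layer (J n) s (depth n w x) <= 6 * (k * bsc n).
  rewrite leNgt; apply/negP => K; apply: hw.
  rewrite /F /M /=.
  apply: (@le_trans _ _ (expR ((\sum_(x : V n.+1) layer (J n) s (depth n w x)) / 3))).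
    by rewrite ler_expR -/D -/k; lra.
  rewrite mulr_suml expR_sum; apply: ler_prod => x _.
  by rewrite expR_ge0 /= layerE ln_layer// layer_ge0 layer_le2.
have hN : \sum_(x : V n.+1) (2^-1 : R) ^+ J n = 1.
  rewrite sumr_const card_torus -[LHS]mulr_natl /J exprM.
  have -> : (2^-1 : R) ^+ 2 = 4^-1 by field.
  by rewrite exprVn natrX mulfV// expf_neq0.
apply: (@le_trans _ _ (s * (6 * (k * bsc n) + 1))).
  apply: (@le_trans _ _ (\sum_(x : V n.+1) s * (layer (J n) s (depth n w x) + 2^-1 ^+ J n))).
    rewrite big_mkcond /=; apply: ler_sum => x _; case: ifP => dx.
      apply: le_trans (min_le_layer (J n) s0 (ltW (pw n x))).
      by rewrite le_min lexx ltW.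
    by rewrite mulr_ge0 ?addr_ge0 ?layer_ge0 ?half// ltW.
  rewrite -mulr_sumr ler_pM2l// big_split /= hN lerD2r//.
have -> : s `^ (1 - alpha) = s * D.
  by rewrite powRD ?powRr1 ?(ltW s0)//; apply/implyP => _; rewrite gt_eqF.
have -> : 7 * C * (s * D) * bsc n = s * (7 * (k * bsc n)) by rewrite /k; ring.
rewrite ler_pM2l//; lra.
Unshelve. all: by end_near. Qed.

(** The last term covers [y = z], where the conditions on [y] and [z] concern one variable and only
    the first is kept. *)
Lemma prb_triple n (x y z : V n.+1) (A B C : set R) :
  measurable A -> measurable B -> measurable C -> x != y -> x != z ->
  prb (tau (emb n.+1 x) @^-1` A `&` (tau (emb n.+1 y) @^-1` B `&` tau (emb n.+1 z) @^-1` C)) <=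
  prb (tau (0, 0)%R @^-1` A) * (prb (tau (0, 0)%R @^-1` B) * prb (tau (0, 0)%R @^-1` C) +
    (y == z)%:R * prb (tau (0, 0)%R @^-1` B)).
Proof.
move=> mA mB mC xy xz.
pose S (v : V n.+1) : set R :=
  if v == x then A else if v == y then B else if (v == z) then C else setT.
have mS v : measurable (S v) by rewrite /S; case: eqP => // _; case: eqP => // _; case: eqP.
have mp v D : measurable D -> measurable (tau (emb n.+1 v) @^-1` D) by exact: measurable_pre.
have p0 D := prb_ge0 P (tau (0, 0)%R @^-1` D).
have := @indep_prod _ (emb n.+1) S (@emb_inj n.+1) mS.
rewrite (bigD1 x)//= (bigD1 y)//= 1?eq_sym//.
have -> : S x = A by rewrite /S eqxx.
have -> : S y = B by rewrite /S eq_sym (negbTE xy) eqxx.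
have Sx : S x = A by rewrite /S eqxx.
have Sy : S y = B by rewrite /S eq_sym (negbTE xy) eqxx.
have [yz|yz] := eqVneq y z.
  rewrite big1 ?mulr1 => [h|v /andP[vx vy]]; last first.
    by rewrite /S (negbTE vx) (negbTE vy) -yz (negbTE vy) preimage_setT prbT.
  rewrite mul1r; apply: (@le_trans _ _ (prb (\bigcap_v (tau (emb n.+1 v) @^-1` S v)))); last first.
    by rewrite h ler_wpM2l// lerDr mulr_ge0.
  apply: prb_le.
  - by apply: measurableI; [exact: mp|apply: measurableI; exact: mp].
  - by apply: fin_bigcap_measurable => [|v _]; [exact: finite_finset|exact: mp].
  move=> w /= [h1 [h2 _]] v _; rewrite /S.
  case: eqP => [->//|_]; case: eqP => [->//|/eqP vy].
  by rewrite -yz (negbTE vy).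
rewrite (bigD1 z)//=; last by rewrite eq_sym xz eq_sym.
have Sz : S z = C by rewrite /S eq_sym (negbTE xz) eq_sym (negbTE yz) eqxx.
rewrite big1 ?mulr1 => [h|v /andP[/andP[vx vy] vz]]; last first.
  by rewrite /S (negbTE vx) (negbTE vy) (negbTE vz) preimage_setT prbT.
rewrite mul0r addr0 -[X in _ * (_ * prb (_ @^-1` X))]Sz -h; apply: prb_le.
- by apply: measurableI; [exact: mp|apply: measurableI; exact: mp].
- by apply: fin_bigcap_measurable => [|v _]; [exact: finite_finset|exact: mp].
move=> w /= [h1 [h2 h3]] v _; rewrite /S.
case: eqP => [->//|_]; case: eqP => [->//|_]; by case: eqP => [->//|_].
Qed.

End Environment.

(** * Deep traps are not crowded: a second moment bound *)

Section Crowding.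
Context {R : realType} {d : measure_display} {T : measurableType d} (P : probability T R).
Context (tau : int * int -> T -> R) (alpha gamma : R).
Hypothesis al0 : 0 < alpha.
Hypothesis al1 : alpha < 1.
Hypothesis ga0 : 0 < gamma.
Hypothesis ga1 : gamma < 1 / 6.
Hypothesis mtau : forall x, measurable_fun setT (tau x).
Hypothesis ind : mutually_independent R d T P (int * int)%type tau.
Hypothesis idd : identically_distributed R d T P (int * int)%type tau.
Local Notation rsc := (rsc alpha gamma).
Local Notation bsc := (bsc alpha gamma).
Local Notation prb := (prb P).
Local Notation tail := (tail P tau).
Local Notation depth n := (@depth R d T tau alpha gamma n).
Hypothesis Htail : u `^ alpha * tail u @[u --> +oo] --> (1 : R).

(** Both sums are proportional to the volume: the [l^2] bound is [green_sqr_le], and [z <= 1 + z^2]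
    deduces the other from it. *)
Lemma green_l1_l2 : exists2 K : R, 0 < K & forall n (x : V n),
  \sum_(y | y != x) `|green x y| <= K * (4 ^ n)%:R /\
  \sum_(y | y != x) `|green x y| ^+ 2 <= K * (4 ^ n)%:R :> R.
Proof.
have c0 : 0 < 32 / cos 1 ^+ 4 :> R by rewrite divr_gt0// exprn_gt0// cos1_gt0.
exists (1 + 32 / cos 1 ^+ 4); first by rewrite addr_gt0.
move=> n x.
have S2 : \sum_(y | y != x) `|green x y| ^+ 2 <= 32 / cos 1 ^+ 4 * (4 ^ n)%:R :> R.
  apply: le_trans green_sqr_le; rewrite -(sum_green_sqr x) big_mkcond /=.
  by apply: ler_sum => y _; case: ifP => _; rewrite ?sqr_ge0// real_normK ?num_real.
have N0 : 0 <= (4 ^ n)%:R :> R by [].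
split; last by apply: le_trans S2 _; rewrite ler_wpM2r// lerDr.
apply: (@le_trans _ _ (\sum_(y | y != x) (1 + `|green x y| ^+ 2))).
  apply: ler_sum => y _; set z := `|_|; have : 0 <= (z - 1) ^+ 2 by exact: sqr_ge0.
  have : 0 <= z by exact: normr_ge0.
  rewrite !expr2; nra.
rewrite big_split /= mulrDl mul1r lerD// sumr_const.
by rewrite ler_nat -(@card_torus n) max_card.
Qed.

(** The square of the layered crowding is expanded over a site and two neighbours, and the sum over
    sites replaces a union bound. The factor with the tail counts expected deep sites, its [+ 1] is
    the origin; the second factor separates distinct from equal neighbours. *)
Lemma crowd_level (K : R) n J (s t : R) :
  (forall x : V n.+1, \sum_(y | y != x) `|green x y| <= K * (4 ^ n.+1)%:R /\
    \sum_(y | y != x) `|green x y| ^+ 2 <= K * (4 ^ n.+1)%:R :> R) ->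
  0 < s -> 0 < t ->
  let q := \sum_(j < J) 2^-1 ^+ j * tail (1 * 2^-1 ^+ j.+1 * rsc n) in
  exists F : set T, [/\ measurable F,
    t ^+ 2 * prb F <= ((4 ^ n.+1)%:R * tail (s * rsc n) + 1) *
      ((K * (4 ^ n.+1)%:R * q) ^+ 2 + K * (4 ^ n.+1)%:R * q * 2) &
    forall w, (forall x, 0 < depth n w x) -> ~ F w -> forall x,
      (s <= depth n w x) || (x == origin n.+1) ->
      crowd (depth n w) x <= t + 2^-1 ^+ J * (K * (4 ^ n.+1)%:R)].
Proof.
move=> HK s0 t0 q.
(* The flag is false for a site required to be deep and true for the origin, which enters without a
   depth condition: [D] is then the full set and [wt] keeps only that site. *)
pose X : finType := (V n.+1 * bool)%type; pose Y : finType := (V n.+1 * 'I_J)%type.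
pose S (j : nat) := [set y | 1 * 2^-1 ^+ j.+1 * rsc n <= y].
pose D (a : X) : set R := if a.2 then setT else [set y | s * rsc n <= y].
pose wt (a : X) : R := if a.2 then (a.1 == origin n.+1)%:R else 1.
pose h (x : V n.+1) (p : Y) : R := (p.1 != x)%:R * `|green x p.1| * 2^-1 ^+ p.2.
pose pre x (B : set R) := tau (emb n.+1 x) @^-1` B.
pose Ev (a : X) (p r : Y) := pre a.1 (D a) `&` (pre p.1 (S p.2) `&` pre r.1 (S r.2)).
pose c (a : X) (p r : Y) : R := wt a * (h a.1 p * h a.1 r).
have mS j : measurable (S j) by exact: measurable_up.
have mD a : measurable (D a) by rewrite /D; case: ifP => // _; exact: measurable_up.
have mp x B : measurable B -> measurable (pre x B) by exact: measurable_pre.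
have mEv a p r : measurable (Ev a p r).
  by apply: measurableI; [exact: mp|apply: measurableI; exact: mp].
have half j : 0 <= (2^-1 : R) ^+ j by rewrite exprn_ge0 ?invr_ge0.
have wt0 a : 0 <= wt a by rewrite /wt; case: ifP.
have h0 x p : 0 <= h x p by rewrite mulr_ge0 ?mulr_ge0.
have c0 a p r : 0 <= c a p r by rewrite mulr_ge0 ?mulr_ge0.
have sum3 (G : X -> Y -> Y -> R) :
    \sum_(i : (X * Y) * Y) G i.1.1 i.1.2 i.2 = \sum_a \sum_p \sum_r G a p r.
  by rewrite (pair_bigA _ (fun a p => \sum_r G a p r)) (pair_bigA _ (fun ap r => G ap.1 ap.2 r)).
have [mF hF] := @level_markov R d T P ((X * Y) * Y)%type (fun i => Ev i.1.1 i.1.2 i.2)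
  (fun i => c i.1.1 i.1.2 i.2) (t ^+ 2) (fun i => mEv _ _ _) (fun i => c0 _ _ _) (sqr_ge0 t).
set F := [set w | _] in mF hF.
have sumY (f : V n.+1 -> R) (g : nat -> R) x :
    \sum_(p : Y) (p.1 != x)%:R * f p.1 * g p.2 = (\sum_(y | y != x) f y) * (\sum_(j < J) g j).
  rewrite big_distrlr /= [RHS]big_mkcond /= -(pair_bigA _ (fun y (j : 'I_J) => (y != x)%:R * f y * g j)) /=.
  apply: eq_bigr => y _; case: ifP => yx; first by apply: eq_bigr => j _; rewrite mul1r.
  by rewrite big1// => j _; rewrite !mul0r.
exists F; split => //.
- apply: le_trans hF _; rewrite (sum3 (fun a p r => c a p r * prb (Ev a p r))).
  pose pD a := prb (tau (0, 0)%R @^-1` D a).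
  pose pS j := tail (1 * 2^-1 ^+ j.+1 * rsc n).
  have pS0 j : 0 <= pS j by have /andP[] := tail01 P mtau (1 * 2^-1 ^+ j.+1 * rsc n).
  have q0 : 0 <= q by apply: sumr_ge0 => j _; exact: mulr_ge0 (half j) (pS0 j).
  have pD0 a : 0 <= pD a by exact: prb_ge0.
  have B a : \sum_p \sum_r c a p r * prb (Ev a p r) <= wt a * pD a *
      ((K * (4 ^ n.+1)%:R * q) ^+ 2 + K * (4 ^ n.+1)%:R * q * 2).
    have [K1 K2] := HK a.1.
    have step p r : c a p r * prb (Ev a p r) <=
        wt a * pD a * (h a.1 p * pS p.2 * (h a.1 r * pS r.2) +
          h a.1 p * pS p.2 * ((p.1 == r.1)%:R * h a.1 r)).
      have -> : wt a * pD a * (h a.1 p * pS p.2 * (h a.1 r * pS r.2) +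
          h a.1 p * pS p.2 * ((p.1 == r.1)%:R * h a.1 r)) =
          c a p r * (pD a * (pS p.2 * pS r.2 + (p.1 == r.1)%:R * pS p.2)).
        by rewrite /c; ring.
      have [e|px] := eqVneq p.1 a.1; first by rewrite /c /h e eqxx !mul0r mulr0 !mul0r.
      have [e|rx] := eqVneq r.1 a.1; first by rewrite /c /h e eqxx !mul0r !mulr0 !mul0r.
      rewrite ler_wpM2l//; apply: prb_triple => //; by rewrite eq_sym.
    apply: le_trans (ler_sum _ (fun p _ => ler_sum _ (fun r _ => step p r))) _.
    have e1 : \sum_(p : Y) h a.1 p * pS p.2 = (\sum_(y | y != a.1) `|green a.1 y|) * q.
      rewrite -(sumY _ (fun j => 2^-1 ^+ j * pS j)); apply: eq_bigr => p _.
      by rewrite /h !mulrA.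
    have e2 : \sum_(p : Y) \sum_(r : Y) h a.1 p * pS p.2 * ((p.1 == r.1)%:R * h a.1 r) <=
        K * (4 ^ n.+1)%:R * q * 2.
      apply: (@le_trans _ _ (\sum_(p : Y) (p.1 != a.1)%:R * `|green a.1 p.1| ^+ 2 *
          (2^-1 ^+ p.2 * pS p.2) * 2)).
        apply: ler_sum => p _; rewrite -mulr_sumr.
        have -> : \sum_(r : Y) (p.1 == r.1)%:R * h a.1 r =
            (p.1 != a.1)%:R * `|green a.1 p.1| * \sum_(j < J) 2^-1 ^+ j.
          rewrite -(pair_bigA _ (fun y (j : 'I_J) => (p.1 == y)%:R * h a.1 (y, j))) /=.
          rewrite (bigD1 p.1)//= [X in _ + X]big1 ?addr0.
            by rewrite mulr_sumr; apply: eq_bigr => j _; rewrite eqxx mul1r /h.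
          by move=> y yp; rewrite big1// => j _; rewrite eq_sym (negbTE yp) mul0r.
        rewrite /h; have := sum_half_le2 (R := R) J; set H := \sum_(j < J) _ => H2.
        have : (p.1 != a.1)%:R * `|green a.1 p.1| ^+ 2 * (2^-1 ^+ p.2 * pS p.2) * H <=
          (p.1 != a.1)%:R * `|green a.1 p.1| ^+ 2 * (2^-1 ^+ p.2 * pS p.2) * 2.
          by rewrite ler_wpM2l// !mulr_ge0 ?sqr_ge0.
        apply: le_trans; rewrite le_eqVlt; apply/orP; left; apply/eqP.
        by case: (p.1 != a.1); rewrite ?mul0r ?mul1r //; ring.
      rewrite -mulr_suml (sumY (fun y => `|green a.1 y| ^+ 2) (fun j => 2^-1 ^+ j * pS j)).
      by rewrite -/q ler_pM2r// ler_wpM2r.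
    rewrite (eq_bigr (fun p => wt a * pD a * (h a.1 p * pS p.2 * (\sum_r h a.1 r * pS r.2) +
       \sum_r h a.1 p * pS p.2 * ((p.1 == r.1)%:R * h a.1 r)))); last first.
      by move=> p _; rewrite [X in _ * (X + _)]mulr_sumr -big_split /= mulr_sumr.
    rewrite -mulr_sumr ler_wpM2l ?mulr_ge0// big_split /= lerD//.
    have G0 : 0 <= \sum_(y | y != a.1) `|green a.1 y| :> R by exact: sumr_ge0.
    rewrite -mulr_suml e1 -expr2 lerXn2r ?nnegrE ?(mulr_ge0 G0 q0)//.
      exact: mulr_ge0 (le_trans G0 K1) q0.
    by rewrite ler_wpM2r.
  apply: le_trans (ler_sum _ (fun a _ => B a)) _.
  rewrite -mulr_suml le_eqVlt; apply/orP; left; apply/eqP; congr (_ * _).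
  rewrite -(pair_bigA _ (fun x b => wt (x, b) * pD (x, b))) /=.
  rewrite (eq_bigr (fun x => (x == origin n.+1)%:R + tail (s * rsc n))); last first.
    move=> x _; rewrite big_bool /= /wt /pD /D /= mul1r preimage_setT prbT mulr1.
    by [].
  rewrite big_split /= addrC; congr (_ + _).
    by rewrite sumr_const card_torus mulr_natl.
  by rewrite (bigD1 (origin n.+1))//= big1 ?addr0// => x /negbTE ->.
- move=> w pw nF x hx.
  pose W := \sum_(y | y != x) `|green x y| * layer J 1 (depth n w y).
  have W0 : 0 <= W by apply: sumr_ge0 => y _; rewrite mulr_ge0// layer_ge0.
  have Wt : W <= t.
    rewrite leNgt; apply/negP => tW; apply: nF; rewrite /F /=.
    apply: (@le_trans _ _ (W ^+ 2)); first by rewrite lerXn2r ?nnegrE// ltW// ltW.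
    (* All summands are nonnegative, so the single index [a] attached to [x] already contributes
       [W ^+ 2]. *)
    rewrite (sum3 (fun a p r => c a p r * \1_(Ev a p r) w)).
    have [a [ax awt aD]] : exists a : X, [/\ a.1 = x, wt a = 1 & pre a.1 (D a) w].
      case/orP: hx => [dx|/eqP x0].
        by exists (x, false); split => //=; rewrite /pre /D /= -depth_ge.
      by exists (x, true); split => //=; rewrite /wt /= x0 eqxx.
    rewrite (bigD1 a)//=; apply: (@le_trans _ _ (\sum_p \sum_r c a p r * \1_(Ev a p r) w)); last first.
      rewrite lerDl; apply: sumr_ge0 => a' _; apply: sumr_ge0 => p _; apply: sumr_ge0 => r _.
      by rewrite mulr_ge0// c0.
    have WE : W = \sum_(p : Y) h x p * \1_(pre p.1 (S p.2)) w.
      rewrite /W -(pair_bigA _ (fun y (j : 'I_J) => h x (y, j) * \1_(pre y (S j)) w)) /=.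
      rewrite big_mkcond /=; apply: eq_bigr => y _; rewrite /h /=.
      case: ifP => yx; last by rewrite big1// => j _; rewrite !mul0r.
      rewrite /layer mulr_sumr; apply: eq_bigr => j _; rewrite mulrA; congr (_ * _).
        by rewrite mul1r.
      by rewrite indicE depth_ge -in_up.
    rewrite expr2 {1}WE mulr_suml le_eqVlt; apply/orP; left; apply/eqP; apply: eq_bigr => p _.
    rewrite {1}WE mulr_sumr; apply: eq_bigr => r _.
    rewrite /c awt mul1r ax /Ev !indicI /= -ax (_ : \1_(pre a.1 (D a)) w = 1); last first.
      by rewrite indicE mem_set.
    by rewrite mul1r; ring.
  rewrite /crowd; apply: (@le_trans _ _ (\sum_(y | y != x)
     `|green x y| * (layer J 1 (depth n w y) + 2^-1 ^+ J))).
    apply: ler_sum => y _; rewrite ler_wpM2l//.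
    by have := min_le_layer J ltr01 (ltW (pw y)); rewrite mul1r.
  rewrite (eq_bigr (fun y => `|green x y| * layer J 1 (depth n w y) + 2^-1 ^+ J * `|green x y|)); last first.
    by move=> y _; rewrite mulrDr [2^-1 ^+ J * _]mulrC.
  rewrite big_split /= lerD// -mulr_sumr ler_wpM2l//.
  by have [] := HK x.
Qed.

(** Half of the tolerance is the level [t] of the second moment bound. The other half absorbs the
    staircase remainder, a constant [K], because [bsc / gdiag] tends to 0. *)
Lemma crowd_small (s e : R) : 0 < s -> 0 < e ->
  (\forall w \ae P, forall n (x : V n.+1), 0 < depth n w x) ->
  \forall w \ae P, \forall n \near \oo, forall x,
    (s <= depth n w x) || (x == origin n.+1) ->
    crowd (depth n w) x <= e * gdiag n / bsc n.
Proof.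
move=> s0 e0 pos.
have [K K0 HK] := green_l1_l2.
have [C1 C11 HC1] := layer_mean gamma al0 al1 mtau Htail.
have [C2 C21 HC2] := tail_bound al0 (tail01 P mtau) Htail.
have [c1 [c2 [c10 c20 hb]]] := bsc_bounds gamma al0.
have [c3 [c4 [c30 c40 ha]]] := gdiag_bounds (R := R).
pose J n := (2 * n.+1)%N.
pose t n : R := e / 2 * gdiag n / bsc n.
have t0 n : 0 < t n.
  exact: divr_gt0 (mulr_gt0 (divr_gt0 e0 (ltr0Sn R 1)) (gdiag_gt0 n)) (bsc_gt0 _ _ n).
have /choice [F HF] n := @crowd_level K n (J n) s (t n) (HK n.+1) s0 (t0 n).
pose D := C2 * s `^ (- alpha) + 1; pose G := (K * C1) ^+ 2 + K * C1 * 2.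
have D0 : 0 < D by rewrite addr_gt0// mulr_gt0 ?powR_gt0// (lt_le_trans ltr01 C21).
have KC : 0 < K * C1 by rewrite mulr_gt0// (lt_le_trans ltr01 C11).
have G0 : 0 < G := addr_gt0 (exprn_gt0 2 KC) (mulr_gt0 KC (ltr0Sn R 1)).
(* The moment bound is [D * G * b^3] and dividing by [t^2] adds [4 * b^2 / (e * a)^2]; then
   [b <= c2 * n^gamma] and [a >= c3 * n] are inserted. *)
pose M := 4 * D * G * c2 ^+ 5 / (e ^+ 2 * c3 ^+ 2).
have e20 : 0 < e ^+ 2 by rewrite exprn_gt0.
have c320 : 0 < c3 ^+ 2 by rewrite exprn_gt0.
have M0 : 0 <= M.
  rewrite divr_ge0 ?(ltW (mulr_gt0 e20 c320))//.
  by rewrite (mulr_ge0 _ (exprn_ge0 5 (ltW c20)))// (mulr_ge0 _ (ltW G0))// mulr_ge0// ltW.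
have near1 : \forall n \near \oo, 1 <= bsc n.
  by have /cvgryPge := bsc_infty al0 ga0; exact.
have : \forall w \ae P, \forall n \near \oo, ~ F n w.
  apply: (@borel_cantelli_pow R d T P F M) => //; first by move=> n; have [] := HF n.
  near=> n; have [_ + _] := HF n.
  have b1 : 1 <= bsc n by near: n.
  have b0 := bsc_gt0 alpha gamma n; have a0 := gdiag_gt0 (R := R) n.
  have r0 := rsc_gt0 alpha gamma n.
  have := HC1 n (J n) 1 ltr01; rewrite powR1 mulr1.
  set N : R := (4 ^ n.+1)%:R; set q := \sum_(j < _) _ => hq hF.
  have q0 : 0 <= N * q.
    rewrite mulr_ge0// sumr_ge0// => j _; rewrite mulr_ge0 ?exprn_ge0 ?invr_ge0//.
    by have /andP[] := tail01 P mtau (1 * 2^-1 ^+ j.+1 * rsc n).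
  have ht : N * tail (s * rsc n) <= C2 * s `^ (- alpha) * bsc n.
    have := HC2 _ (mulr_gt0 s0 r0); rewrite powRM ?(ltW s0) ?(ltW r0)// => hh.
    have -> : C2 * s `^ (- alpha) * bsc n = N * (C2 * (s `^ (- alpha) * rsc n `^ (- alpha))).
      by rewrite /bsc -/N; ring.
    by rewrite ler_wpM2l.
  have t1 : 0 <= N * tail (s * rsc n).
    by rewrite mulr_ge0//; have /andP[] := tail01 P mtau (s * rsc n).
  have f1 : N * tail (s * rsc n) + 1 <= D * bsc n.
    by rewrite /D mulrDl mul1r lerD.
  have f2 : (K * N * q) ^+ 2 + K * N * q * 2 <= G * bsc n ^+ 2.
    have g1 : K * N * q <= K * C1 * bsc n by rewrite -mulrA -[leRHS]mulrA ler_pM2l.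
    have g0 : 0 <= K * N * q by rewrite -mulrA; exact: mulr_ge0 (ltW K0) q0.
    rewrite /G mulrDl lerD//.
      by rewrite -exprMn lerXn2r ?nnegrE// (le_trans g0).
    rewrite [leRHS]mulrAC ler_pM2r//; apply: le_trans g1 _; rewrite ler_pM2l//.
    by rewrite expr2 ler_peMr// ltW.
  have f3 : t n ^+ 2 * prb (F n) <= D * G * bsc n ^+ 3.
    apply: le_trans hF _; have -> : D * G * bsc n ^+ 3 = (D * bsc n) * (G * bsc n ^+ 2).
      by rewrite !exprS expr0; ring.
    apply: ler_pM => //; first by rewrite addr_ge0.
    have g0 : 0 <= K * N * q by rewrite -mulrA; exact: mulr_ge0 (ltW K0) q0.
    by rewrite addr_ge0 ?sqr_ge0// mulr_ge0.
  have m1 : (1 : R) <= n.+1%:R by rewrite ler1n.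
  have m0 := lt_le_trans (@ltr01 R) m1.
  have t20 : 0 < t n ^+ 2 by rewrite exprn_gt0.
  have f4 : prb (F n) <= 4 * D * G / e ^+ 2 * (bsc n ^+ 5 / gdiag n ^+ 2).
    rewrite -(ler_pM2l t20); apply: le_trans f3 _; rewrite le_eqVlt; apply/orP; left; apply/eqP.
    rewrite /t; move: (gdiag n) a0 (bsc n) b0 => a a0 b b0.
    by field; rewrite !gt_eqF.
  apply: le_trans f4 _.
  have -> : M * n.+1%:R `^ (- (7 / 6)) = 4 * D * G / e ^+ 2 * (c2 ^+ 5 / c3 ^+ 2 * n.+1%:R `^ (- (7 / 6))).
    rewrite /M; move: (n.+1%:R `^ _) => z; by field; rewrite !gt_eqF.
  rewrite ler_pM2l; last by rewrite divr_gt0// mulr_gt0// mulr_gt0.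
  have /andP[_ hb2] := hb n; have /andP[ha1 _] := ha n.
  rewrite ler_pdivrMr ?exprn_gt0//.
  apply: (@le_trans _ _ ((c2 * n.+1%:R `^ gamma) ^+ 5)).
    by rewrite lerXn2r ?nnegrE ?(ltW b0) ?mulr_ge0 ?powR_ge0 ?(ltW c20).
  apply: (@le_trans _ _ (c2 ^+ 5 / c3 ^+ 2 * n.+1%:R `^ (- (7 / 6)) * (c3 * n.+1%:R) ^+ 2)); last first.
    have zz : 0 <= c2 ^+ 5 / c3 ^+ 2 * n.+1%:R `^ (- (7 / 6)).
      by rewrite mulr_ge0 ?powR_ge0// divr_ge0 ?exprn_ge0 ?(ltW c20) ?(ltW c30).
    by rewrite ler_wpM2l// lerXn2r ?nnegrE ?(ltW a0) ?(ltW (mulr_gt0 c30 m0)).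
  have p5 : (n.+1%:R `^ gamma) ^+ 5 = n.+1%:R `^ (gamma * 5) by rewrite powRrM powR_mulrn ?powR_ge0.
  have p2 : n.+1%:R ^+ 2 = n.+1%:R `^ 2 :> R by rewrite powR_mulrn ?(ltW m0).
  rewrite !exprMn p5.
  have -> : c2 ^+ 5 / c3 ^+ 2 * n.+1%:R `^ (- (7 / 6)) * (c3 ^+ 2 * n.+1%:R ^+ 2) =
     c2 ^+ 5 * (n.+1%:R `^ (- (7 / 6)) * n.+1%:R ^+ 2).
    by move: (n.+1%:R `^ _) (n.+1%:R ^+ 2) => y z; field; rewrite gt_eqF.
  rewrite ler_pM2l ?exprn_gt0// p2 -powRD; last first.
    by apply/implyP => _; rewrite gt_eqF.
  by apply: ler_powR => //; move: ga1; lra.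
have K20 : 0 < e / (2 * K) by rewrite divr_gt0 ?mulr_gt0.
have /cvgr0Pnorm_le /(_ _ K20) near2 := bsc_gdiag al0 ga1.
apply: filterS2 pos => w pw [m _ hw]; near=> n => x hx.
have nF : ~ F n w by apply: hw => /=; near: n; exact: nbhs_infty_ge.
have [_ _ /(_ w (pw n) nF x hx) hc] := HF n; apply: le_trans hc _.
have b0 := bsc_gt0 alpha gamma n; have a0 := gdiag_gt0 (R := R) n.
have -> : 2^-1 ^+ J n * (K * (4 ^ n.+1)%:R) = K.
  rewrite /J exprM; have -> : (2^-1 : R) ^+ 2 = 4^-1 by field.
  by rewrite exprVn natrX mulrCA mulVf ?mulr1// expf_neq0.
have : `|bsc n / gdiag n| <= e / (2 * K) by near: n.
rewrite ger0_norm ?(ltW (divr_gt0 b0 a0))// ler_pdivrMr// => hk.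
have hk2 : K <= e / 2 * gdiag n / bsc n.
  rewrite ler_pdivlMr//; have : K * bsc n <= K * (e / (2 * K) * gdiag n) by rewrite ler_pM2l.
  move/le_trans; apply; rewrite le_eqVlt; apply/orP; left; apply/eqP.
  by field; rewrite gt_eqF.
rewrite /t; have -> : e * gdiag n / bsc n = e / 2 * gdiag n / bsc n + e / 2 * gdiag n / bsc n.
  by field; rewrite gt_eqF.
by rewrite lerD2l.
Unshelve. all: by end_near. Qed.

End Crowding.

(** * Conclusion *)

Section Assembly.
Context {R : realType}.

(** Measuring time in units of [t] multiplies the rates [1 / tau] by [t]. For [t = t_w] the new rate
    is [a / u], the one of the asymptotic analysis. *)
Lemma prob_same_semi (tau : int * int -> R) n (t th : R) :
  (forall x : V n, 0 < tau (emb n x)) ->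
  prob_same R tau n t ((1 + th) * t) =
  \sum_x semi (fun x => t / tau (emb n x)) 1 (origin n) x *
    semi (fun x => t / tau (emb n x)) th x x.
Proof.
move=> tau0.
have tr s x y : trans R tau n (s * t) x y = semi (fun x => t / tau (emb n x)) s x y.
  rewrite -[LHS]/(mexp (gen R tau n) (s * t) x y) mexpZ /semi.
  congr (mexp _ s x y); apply/funext => u; apply/funext => v.
  have := lt0r_neq0 (tau0 u).
  rewrite /tgen /lapm /lap /gen; move: (tau _) (\sum_(k < 4) _) => z w z0.
  by field.
rewrite /prob_same; apply: eq_bigr => x _; rewrite -!tr mul1r; congr (_ * trans _ _ _ _ _ _).
ring.
Qed.

Lemma ae_forall_countable {d} {T : measurableType d} (P : probability T R) (I : countType)
    (Q : I -> T -> Prop) :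
  (forall i, \forall w \ae P, Q i w) -> \forall w \ae P, forall i, Q i w.
Proof.
move=> H; pose Q' k w := if unpickle k is Some i then Q i w else True.
have : \forall w \ae P, forall k, Q' k w.
  apply: ae_foralln => k; rewrite /Q'; case: unpickle => [i|]; first exact: H.
  exact: aeW.
by apply: filterS => w h i; have := h (pickle i); rewrite /Q' pickleK.
Qed.

(** Monotonicity squeezes [f n x] between rational points where [g] is close to [g x]; it lets a
    single null set serve all levels of the counting function. *)
Lemma monotone_cvg_dense (f : nat -> R -> R) (g : R -> R) :
  (forall n x y, x <= y -> f n y <= f n x) ->
  (forall x, 0 < x -> {for x, continuous g}) ->
  (forall q : rat, 0 < ratr q :> R -> f n (ratr q) @[n --> \oo] --> g (ratr q)) ->
  forall x, 0 < x -> f n x @[n --> \oo] --> g x.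
Proof.
move=> fm gc fq x x0; apply/cvgrPdist_le => e e0.
have e2 : 0 < e / 2 by rewrite divr_gt0.
have /cvgrPdist_le /(_ _ e2) [del /= del0 hdel] := gc x x0.
pose y := Num.max (x - del) (x / 2).
have yx : y < x by rewrite gt_max; apply/andP; split; lra.
have y0 : 0 < y by rewrite lt_max; apply/orP; right; rewrite divr_gt0.
have [q1] := rat_in_itvoo yx; rewrite in_itv /= => /andP[yq1 q1x].
have xd : x < x + del by rewrite ltrDl.
have [q2] := rat_in_itvoo xd; rewrite in_itv /= => /andP[xq2 q2d].
have q10 := lt_trans y0 yq1; have q20 := lt_trans x0 xq2.
have dq1 : x - del < ratr q1 by apply: le_lt_trans yq1; rewrite le_max lexx.
have g1 : `|g x - g (ratr q1)| <= e / 2.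
  by apply: hdel => /=; rewrite ltr_norml; apply/andP; split; lra.
have g2 : `|g x - g (ratr q2)| <= e / 2.
  by apply: hdel => /=; rewrite ltr_norml; apply/andP; split; lra.
have /cvgrPdist_le /(_ _ e2) n1 := fq _ q10.
have /cvgrPdist_le /(_ _ e2) n2 := fq _ q20.
near=> n.
have : `|g (ratr q1) - f n (ratr q1)| <= e / 2 by near: n.
have : `|g (ratr q2) - f n (ratr q2)| <= e / 2 by near: n.
have := fm n _ _ (ltW q1x); have := fm n _ _ (ltW xq2).
move: g1 g2; rewrite !ler_norml => /andP[? ?] /andP[? ?] ? ? /andP[? ?] /andP[? ?].
by apply/andP; split; lra.
Unshelve. all: by end_near. Qed.

Lemma exists_inv_le (e : R) : 0 < e -> exists k : nat, k.+1%:R^-1 <= e.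
Proof.
move=> e0; exists (Num.truncn e^-1); rewrite -[leRHS]invrK lef_pV2 ?posrE ?invr_gt0//.
exact/ltW/truncnS_gt.
Qed.

Lemma depth_origin (alpha gamma : R) {d} {T : measurableType d} (tau : int * int -> T -> R) w :
  0 < alpha -> gamma < 1 / 6 ->
  @depth R d T tau alpha gamma n w (origin n.+1) @[n --> \oo] --> (0 : R).
Proof.
move=> al0 ga1.
have lim0 : (rsc alpha gamma n)^-1 @[n --> \oo] --> (0 : R).
  apply/cvgr0Pnorm_le => e e0; near=> n.
  have r0 := rsc_gt0 alpha gamma n.
  rewrite ger0_norm ?invr_ge0 ?(ltW r0)// -[leRHS]invrK lef_pV2 ?posrE ?invr_gt0//.
  by near: n; have /cvgryPge := rsc_infty al0 ga1; exact.
have h : tau (0, 0)%R w * (rsc alpha gamma n)^-1 @[n --> \oo] --> tau (0, 0)%R w * 0.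
  by apply: cvgMr; exact: lim0.
by rewrite mulr0 in h; exact: h.
Unshelve. all: by end_near. Qed.

End Assembly.

Lemma aging_of_environment (R : realType) (d : measure_display) (T : measurableType d)
  (tau : int * int -> T -> R) (alpha gamma : R) (al0 : 0 < alpha) (w : T) :
  alpha < 1 -> 0 < gamma -> gamma < 1 / 6 ->
  let u n (x : V n.+1) := @depth R d T tau alpha gamma n w x in
  let b := bsc alpha gamma in
  (forall n x, 0 < u n x) ->
  (forall s, 0 < s -> (\sum_x (s <= u n x)%R%:R) / b n @[n --> \oo] --> s `^ (- alpha)) ->
  (forall e, 0 < e -> exists s, 0 < s /\
    \forall n \near \oo, \sum_(x | u n x < s) u n x <= e * b n) ->
  (forall s e, 0 < s -> 0 < e -> \forall n \near \oo, forall x,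
    (s <= u n x) || (x == origin n.+1) -> crowd (u n) x <= e * gdiag n / b n) ->
  forall th, 0 < th ->
  prob_same R (fun x => tau x w) n (tw R alpha gamma n) ((1 + th) * tw R alpha gamma n)
    @[n --> \oo] --> Asl R alpha (1 / (1 + th)).
Proof.
move=> al1 ga0 ga1 u b u0 Hcount Hsmall Hcrowd th th0.
have b0 n : 0 < b n by exact: bsc_gt0.
pose I (l : R) := l `^ alpha * cprof al0 0.
pose J (l t : R) := l^-1 * (l `^ alpha * cprof al0 (l * t)).
have c0 := @cprof_gt0 R alpha al0 al1 0 (lexx 0).
have I0 l : 0 < l -> 0 < I l by move=> l0; exact: mulr_gt0 (powR_gt0 _ l0) c0.
have HI l : 0 < l -> (\sum_x phi (u n) l x) / b n @[n --> \oo] --> I l.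
  by move=> l0; exact: (counting_phi (al0 := al0) al1 u0 b0 Hcount Hsmall l0).
have HJ l t : 0 < l -> 0 < t ->
    (\sum_x expR (- (u n x)^-1 * t) * (l + (u n x)^-1)^-1) / b n @[n --> \oo] --> J l t.
  by move=> l0 t0; exact: (counting_laplace (al0 := al0) al1 u0 b0 Hcount Hsmall l0 (ltW t0)).
have JE t i : 0 < t -> (0 < i)%N -> J i%:R t / I i%:R = Elap al0 (i%:R * t) / i%:R.
  move=> t0 i0; have i1 : (0 : R) < i%:R by rewrite ltr0n.
  rewrite /J /I /Elap; have z0 := powR_gt0 alpha i1.
  by field; rewrite !gt_eqF.
have mix p k t y : (0 < p)%N -> (0 < k)%N -> 0 < t -> 0 < y -> _ := @Elap_mixture R alpha al0 al1 p k t y.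
have thi : 0 < th^-1 by rewrite invr_gt0.
have hc : {for th^-1, continuous (Hlaw al0)} by apply: Hlaw_continuous.
have hi : Hlaw al0 y @[y --> +oo] --> (1 : R) by apply: Hlaw_infty.
have hb y : 0 <= Hlaw al0 y <= 1 by apply: Hlaw_bounds.
have lim := @aging_limit R u b I J u0 b0 (bsc_infty al0 ga0) (bsc_gdiag al0 ga1) I0 HI HJ
  Hsmall Hcrowd (depth_origin tau w al0 ga1) (Elap al0) (Hlaw al0) th th0 JE mix hb hc hi.
rewrite AslE// -cvg_shiftS; apply: cvg_trans lim; apply: near_eq_cvg; apply: nearW => n.
have r0 := rsc_gt0 alpha gamma n; have a0 := gdiag_gt0 (R := R) n.
have tau0 (x : V n.+1) : 0 < tau (emb n.+1 x) w.
  by have := u0 n x; rewrite /u /depth pmulr_lgt0 ?invr_gt0.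
have e : (fun x : V n.+1 => gdiag n / u n x) =
    (fun x => tw R alpha gamma n.+1 / tau (emb n.+1 x) w).
  apply/funext => x; rewrite /u /depth /rsc; have := tau0 x; have := tw_gt0 alpha gamma n.
  by move: (tw _ _ _ _) (tau _ _) (gdiag n) a0 => y z a a0 y0 z0; field; rewrite !gt_eqF.
rewrite e; apply/esym; exact: (@prob_same_semi R (fun x => tau x w)).
Qed.

Unset Implicit Arguments.
Set Strict Implicit.

Theorem theoremt (R : realType) (d : measure_display) (T : measurableType d)
  (P : probability T R) (tau : int * int -> T -> R) (alpha gamma : R) :
  0 < alpha < 1 -> 0 < gamma < 1 / 6 ->
  (forall x, measurable_fun setT (tau x)) ->
  mutually_independent R d T P (int * int)%type tau ->
  identically_distributed R d T P (int * int)%type tau ->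
  (forall x, (\forall w \ae P, 0 < tau x w)) ->
  (u `^ alpha * fine (P (tau (0, 0)%R @^-1` [set y | u <= y])))
    @[u --> +oo%R] --> (1 : R) ->
  forall theta : R, 0 < theta ->
    \forall w \ae P,
      (fun n : nat => prob_same R (fun x => tau x w) n (tw R alpha gamma n)
                        ((1 + theta) * tw R alpha gamma n))
        @ \oo --> Asl R alpha (1 / (1 + theta)).
Proof.
move=> /andP[al0 al1] /andP[ga0 ga1] mtau ind idd pos Htail theta th0.
have posd : \forall w \ae P, forall n (x : V n.+1), 0 < depth tau alpha gamma w x.
  have pos' : \forall w \ae P, forall x, 0 < tau x w by exact: ae_forall_countable.
  apply: filterS pos' => w h n x.
  exact: divr_gt0 (h _) (rsc_gt0 alpha gamma n).
(* Each level has its own exceptional set, so only countably many levels are used here and in the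
   next two estimates; monotonicity recovers the others. *)
have Hcount : \forall w \ae P, forall q : rat, 0 < ratr q :> R ->
    (\sum_(x : V n.+1) (ratr q <= depth tau alpha gamma w x)%R%:R) / bsc alpha gamma n
      @[n --> \oo] --> ratr q `^ (- alpha).
  apply: ae_forall_countable => q; have [q0|q0] := ltP 0 (ratr q : R).
    by have h := count_cvg al0 ga0 ga1 mtau ind idd Htail q0; apply: filterS h => w h _.
  by apply: aeW => w.
have [C C0 HC] := small_sum al0 al1 ga0 mtau ind idd Htail.
have Hsmall : \forall w \ae P, forall k : nat, \forall n \near \oo,
    \sum_(x : V n.+1 | depth tau alpha gamma w x < k.+1%:R^-1) depth tau alpha gamma w x <=
    C * k.+1%:R^-1 `^ (1 - alpha) * bsc alpha gamma n.
  by apply: ae_foralln => k; apply: HC; [rewrite invr_gt0|exact: posd].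
have Hcrowd : \forall w \ae P, forall kj : nat * nat, \forall n \near \oo, forall x : V n.+1,
    (kj.1.+1%:R^-1 <= depth tau alpha gamma w x) || (x == origin n.+1) ->
    crowd (depth tau alpha gamma w) x <= kj.2.+1%:R^-1 * gdiag n / bsc alpha gamma n.
  apply: ae_forall_countable => kj; apply: crowd_small => //; by rewrite invr_gt0.
near=> w.
have pw : forall n (x : V n.+1), 0 < depth tau alpha gamma w x by near: w.
apply: (@aging_of_environment R d T tau alpha gamma al0 w) => //.
- move=> s s0.
  have h : forall q : rat, 0 < ratr q :> R ->
      (\sum_(x : V n.+1) (ratr q <= depth tau alpha gamma w x)%R%:R) / bsc alpha gamma n
      @[n --> \oo] --> ratr q `^ (- alpha) by near: w.
  apply: (@monotone_cvg_dense R (fun n s => (\sum_(x : V n.+1)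
    (s <= depth tau alpha gamma w x)%R%:R) / bsc alpha gamma n) (fun s => s `^ (- alpha))) => //.
    move=> n x y xy; rewrite ler_pM2r ?invr_gt0 ?bsc_gt0//; apply: ler_sum => z _.
    by rewrite ler_nat; case: (leP y) => // /(le_trans xy) ->.
  by move=> x x0; exact: continuous_powR_gt0.
- move=> e e0; have eC : 0 < e / C by rewrite divr_gt0.
  have a1 : 0 < 1 - alpha by rewrite subr_gt0.
  (* The level is chosen so that [C * s^(1 - alpha) <= e], which is possible because [alpha < 1]. *)
  have [k hk] := exists_inv_le (powR_gt0 (1 - alpha)^-1 eC).
  exists k.+1%:R^-1; split; first by rewrite invr_gt0.
  have h : forall k : nat, \forall n \near \oo,
    \sum_(x : V n.+1 | depth tau alpha gamma w x < k.+1%:R^-1) depth tau alpha gamma w x <=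
    C * k.+1%:R^-1 `^ (1 - alpha) * bsc alpha gamma n by near: w.
  apply: filterS (h k) => n /le_trans; apply; rewrite ler_pM2r ?bsc_gt0//.
  rewrite mulrC -ler_pdivlMr// -[leRHS](powR_invK a1) ?(ltW eC)//.
  by apply: powR_le => //; rewrite ?invr_ge0// ltW.
- move=> s e s0 e0; have [k hk] := exists_inv_le s0; have [j hj] := exists_inv_le e0.
  have h : forall kj : nat * nat, \forall n \near \oo, forall x : V n.+1,
    (kj.1.+1%:R^-1 <= depth tau alpha gamma w x) || (x == origin n.+1) ->
    crowd (depth tau alpha gamma w) x <= kj.2.+1%:R^-1 * gdiag n / bsc alpha gamma n by near: w.
  apply: filterS (h (k, j)) => n hn x hx; apply: le_trans (hn x _) _ => /=.
    by case/orP: hx => [/(le_trans hk) ->//|->]; rewrite orbT.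
  by rewrite ler_pM2r ?invr_gt0 ?bsc_gt0// ler_pM2r ?gdiag_gt0.
Unshelve. all: by end_near. Qed.
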